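(* Let $M$ be a closed $2$-dimensional Riemannian manifold. Then there exists no isometric minimal immersion $\Phi:M\to\mathbb{S}^N$, for any $N$, such that $\frac53\le S_{\min}\le\frac95$ and $$S_{\max}<S_{\min}+\frac{134-114S_{\min}+\sqrt{\mathcal F}}{108},$$ where $\mathcal F=(134-114S_{\min})^2+864(3S_{\min}-5)(9-5S_{\min})$, and $S_{\max}=\sup_{p\in M}S(p)$, $S_{\min}=\inf_{p\in M}S(p)$ with $S=|h|^2$ the squared norm of the second fundamental form $h$ of $\Phi$.
   Context: $\mathbb{S}^N$ is the unit sphere in $\mathbb{R}^{N+1}$; closed means compact without boundary. With respect to a local orthonormal frame $e_1,e_2$ tangent to $M$ and $e_3,\dots,e_N$ normal to $M$ in $\mathbb{S}^N$, $h=\sum h_{ij}^\alpha\,\omega_i\omega_j e_\alpha$ and $S=\sum_{i,j,\alpha}(h_{ij}^\alpha)^2$. Minimal means $h_{11}^\alpha+h_{22}^\alpha=0$ for all $\alpha$. *)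

(* Defs.v *)
From HB Require Import structures.
From mathcomp Require Import all_boot all_order all_algebra.
From mathcomp Require Import all_classical all_reals all_analysis.

Set Implicit Arguments.
Unset Strict Implicit.
Unset Printing Implicit Defensive.

Import Order.TTheory GRing.Theory Num.Theory.
Import numFieldNormedType.Exports.

Local Open Scope classical_set_scope.
Local Open Scope ring_scope.

Section smooth.
Context {R : realType} {V W : normedModType R}.

Fixpoint Ck_on (k : nat) (U : set V) (f : V -> W) : Prop :=
  match k with
  | 0 => {in U, continuous f}
  | k'.+1 => {in U, continuous f} /\
      forall v : V, {in U, forall x, derivable f x v} /\ Ck_on k' U ('D_v f)
  end.

(* Only meaningful for [U] open: continuity and derivatives at a point of [U]
   are those of the total function [f]. *)
Definition smooth_on (U : set V) (f : V -> W) : Prop := forall k, Ck_on k U f.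

End smooth.

Definition dotp {R : realType} {m : nat} (u v : 'rV[R]_m) : R := (u *m v^T) 0 0.

(* [param] is the inverse of [coord]; the values of [coord] outside [dom] and
   of [param] outside [coord @` dom] are irrelevant. *)
Record chart (R : realType) (n : nat) (M : topologicalType) := Chart {
  dom : set M;
  coord : M -> 'rV[R]_n;
  param : 'rV[R]_n -> M;
  dom_open : open dom;
  codom_open : open (coord @` dom);
  coordK : {in dom, cancel coord param};
  coord_continuous : {in dom, continuous coord};
  param_continuous : {in coord @` dom, continuous param}
}.

(* Smooth Riemannian manifolds of dimension [n].  The charts take values in
   open subsets of R^n, so there is no boundary and "closed" means compact.
   [metric c x] is the Gram matrix of the coordinate vector fields of the chart
   [c] at the point of coordinates [x]; [metric_change] says that these local
   expressions define one bilinear form on each tangent space, the vector with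
   coordinates [v] in [c] having coordinates ['D_v (coord d \o param c)] in
   [d]. *)
Record riemannianManifold (R : realType) (n : nat) := RiemannianManifold {
  carrier :> topologicalType;
  carrier_hausdorff : hausdorff_space carrier;
  carrier_second_countable : @second_countable carrier;
  atlas : set (chart R n carrier);
  atlas_cover : forall p : carrier, exists2 c, atlas c & dom c p;
  atlas_compatible : forall c d, atlas c -> atlas d ->
    smooth_on (coord c @` (dom c `&` dom d)) (coord d \o param c);
  metric : chart R n carrier -> 'rV[R]_n -> 'M[R]_n;
  metric_smooth : forall c, atlas c ->
    smooth_on (coord c @` dom c) (metric c);
  metric_sym : forall c p, atlas c -> dom c p ->
    (metric c (coord c p))^T = metric c (coord c p);
  metric_posdef : forall c p, atlas c -> dom c p ->
    forall v : 'rV[R]_n, v != 0 -> 0 < dotp (v *m metric c (coord c p)) v;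
  metric_change : forall c d p, atlas c -> atlas d -> dom c p -> dom d p ->
    forall v w : 'rV[R]_n,
      dotp (v *m metric c (coord c p)) w =
      dotp ('D_v (coord d \o param c) (coord c p) *m metric d (coord d p))
           ('D_w (coord d \o param c) (coord c p))
}.

Section immersion.
Context {R : realType} {n N : nat} (M : riemannianManifold R n).
Implicit Types (c : chart R n M) (p : M) (Phi : M -> 'rV[R]_N.+1).

(* Maps into the unit sphere of R^(N+1). *)
Definition spherical Phi : Prop := forall p, dotp (Phi p) (Phi p) = 1.

Definition smooth_map Phi : Prop := forall c, atlas c ->
  smooth_on (coord c @` dom c) (Phi \o param c).

(* The differential of [Phi] at [p], applied to the tangent vector of
   coordinates [v] in the chart [c]. *)
Definition differential Phi c p (v : 'rV[R]_n) : 'rV[R]_N.+1 :=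
  'D_v (Phi \o param c) (coord c p).

Definition immersion Phi : Prop := smooth_map Phi /\
  forall c p, atlas c -> dom c p -> injective (differential Phi c p).

Definition isometric Phi : Prop := forall c p, atlas c -> dom c p ->
  forall v w : 'rV[R]_n,
    dotp (differential Phi c p v) (differential Phi c p w) =
    dotp (v *m metric c (coord c p)) w.

(* The rows of [e] are the coordinates in [c] of an orthonormal basis of the
   tangent space of [M] at [p]; the rows of [nu] are an orthonormal basis of
   the normal space of [M] in the sphere, i.e. of the orthogonal complement in
   R^(N+1) of the position vector and of the image of the differential.  Its
   dimension is [N - n], where [n <= N] as soon as [Phi] is an immersion into
   the sphere. *)
Definition adapted_frame Phi c p (e : 'M[R]_n) (nu : 'M[R]_(N - n, N.+1)) :=
  [/\ e *m metric c (coord c p) *m e^T = 1%:M,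
      nu *m nu^T = 1%:M,
      forall a, dotp (row a nu) (Phi p) = 0 &
      forall a v, dotp (row a nu) (differential Phi c p v) = 0].

(* The coefficient h_ij^a of the second fundamental form, i.e. the component
   along [row a nu] of the covariant derivative, in the sphere, of a vector
   field extending e_j in the direction e_i.  The field used has constant
   coordinates in [c], and the covariant derivative of the sphere differs from
   the derivative in R^(N+1) by a multiple of the position vector, which is
   orthogonal to [nu]. *)
Definition sff Phi c p (e : 'M[R]_n) (nu : 'M[R]_(N - n, N.+1))
    (i j : 'I_n) (a : 'I_(N - n)) : R :=
  dotp ('D_(row i e) ('D_(row j e) (Phi \o param c)) (coord c p)) (row a nu).

Definition minimal Phi : Prop := forall c p e nu, atlas c -> dom c p ->
  adapted_frame Phi c p e nu -> forall a, \sum_i sff Phi c p e nu i i a = 0.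

(* The squared norm S of the second fundamental form at [p].  The value does
   not depend on the chart and the adapted frame, so the set below is a
   singleton when [Phi] is an isometric immersion into the sphere. *)
Definition sff_sqnorm Phi p : R :=
  xget 0 [set s | exists c e nu, [/\ atlas c, dom c p,
    adapted_frame Phi c p e nu &
    s = \sum_i \sum_j \sum_a sff Phi c p e nu i j a ^+ 2]].

Definition Smax Phi : R := sup (range (sff_sqnorm Phi)).
Definition Smin Phi : R := inf (range (sff_sqnorm Phi)).

End immersion.

Definition calF {R : realType} (s : R) : R :=
  (134 - 114 * s) ^+ 2 + 864 * (3 * s - 5) * (9 - 5 * s).

(* Main.v *)
From HB Require Import structures.
Require Import Defs.
From mathcomp Require Import all_boot all_order all_algebra.
From mathcomp Require Import all_classical all_reals all_analysis.
From mathcomp Require Import complex ring lra.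

(** Write S = 2 u, and let D = (E1 - i E2)/sqrt 2 for a local orthonormal frame.
  The (2,0)-part H of the second fundamental form satisfies nabla_bar H = - u z
  with z = D Phi, whence, for L half the Laplacian, L log u = v - 3 u + 2, where
  v = u |xi|^2 and xi is the covariant derivative of H / u.  Going on, with zeta and
  chi the next two derivatives of xi and g = u |zeta|^2,
    L v = v (1 - 2 v) + g,
    L g = u |chi|^2 + (4 - 5 v - u) g - 5 |D v|^2 + v (1 - 2 v)^2,
  and |D v|^2 <= g v by Cauchy-Schwarz.  The functions u, v, g are global, and the
  maximum principle is applied to combinations of them.  The pinching hypothesis
  says that 5/6 < u < 9/10 and that u oscillates by less than 1/400.
  - At a maximum, w = u^3 (g v - |D v|^2) satisfies L w >= (9 - 10 u) w, because the
    first-order terms are absorbed by the Cauchy-Schwarz inequality for the Gram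
    form of xi; hence w = 0 and g v = |D v|^2.
  - A maximum of v u^4 gives v <= 1, as u is almost constant; then a maximum of
    2 g + 5 v^2, in which the terms in |D v|^2 cancel, bounds g.
  - With these bounds a minimum of v + 40 u gives v > 0: the coefficient 40 is large
    enough for 40 L u to dominate, and small enough for 40 u to vary by at most 1/10.
  - Finally g v = |D v|^2 gives L log (v u^2) = 5 - 6 u < 0, which is impossible at a
    minimum of v u^2. *)

Set Implicit Arguments.
Unset Strict Implicit.
Unset Printing Implicit Defensive.

Import Order.TTheory GRing.Theory Num.Theory.
Import numFieldNormedType.Exports.
Local Open Scope classical_set_scope.
Local Open Scope ring_scope.

(** [S = 5/3] and [S = 9/5] are the values on the minimal spheres of constant curvature 1/6 and
    1/10. Here they are the zeros of [5 - 6 u] and [9 - 10 u]. The powers of [u] in the auxiliary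
    functions come from [L log u = v - 3 u + 2]: a factor [u^k] adds [k v] to the Laplacian of the
    logarithm. The exponent 3 removes [v] for [w], 2 removes it for [v u^2], and 4 leaves a positive
    multiple of it, which bounds [v]. In general there is no global null frame, and [M] need not be
    orientable. The calculus is therefore done in an abstract commutative ring with a derivation [D]
    and an involution [cj], instantiated by the smooth complex functions on an open part of a chart.
    Such a ring has zero divisors and may be zero, whence the explicit inverse [j] of [u] and the
    hypothesis [two_reg]. The functions become global because [v] and [g] can be recovered from [u]
    by squared gradients and Laplacians, which no change of frame affects, even if it reverses the
    orientation. *)

Section Ck_closure.
Context {R : realType} {V W : normedModType R}.
Implicit Types (U : set V) (k : nat).

(** * Closure properties of the classes [Ck_on] *)

Lemma Ck_on_le k U (f : V -> W) : Ck_on k.+1 U f -> Ck_on k U f.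
Proof.
elim: k f => [|k IH] f /=; first by case.
move=> [cf df]; split=> // v; have [dv ck] := df v.
by split=> //; exact: IH.
Qed.

Lemma Ck_on_continuous k U (f : V -> W) : Ck_on k U f -> {in U, continuous f}.
Proof. by case: k => [//|k] []. Qed.

Lemma Ck_on_subset k U U' (f : V -> W) :
  U' `<=` U -> Ck_on k U f -> Ck_on k U' f.
Proof.
move=> sub; elim: k f => [|k IH] f /=.
  by move=> cf x /[!inE] /sub Ux; apply: cf; rewrite inE.
move=> [cf df]; split; first by move=> x /[!inE] /sub Ux; apply: cf; rewrite inE.
move=> v; have [dv ck] := df v; split; last exact: IH.
by move=> x /[!inE] /sub Ux; apply: dv; rewrite inE.
Qed.

Lemma eq_on_near U (f g : V -> W) x : open U -> {in U, f =1 g} -> U x ->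
  \near x, f x = g x.
Proof.
move=> oU fg Ux; have := open_nbhs_nbhs (conj oU Ux).
by apply: filterS => y Uy; apply: fg; rewrite inE.
Qed.

Lemma eq_on_derive U (f g : V -> W) v : open U -> {in U, f =1 g} ->
  {in U, 'D_v f =1 'D_v g}.
Proof.
move=> oU fg x /[!inE] Ux; apply: near_eq_derive.
exact: eq_on_near fg Ux.
Qed.

Lemma eq_Ck_on k U (f g : V -> W) : open U -> {in U, f =1 g} ->
  Ck_on k U f -> Ck_on k U g.
Proof.
move=> oU; elim: k f g => [|k IH] f g fg /=.
  move=> cf x xU; rewrite /prop_for /continuous_at -(fg _ xU).
  apply: cvg_trans (cf x xU); apply: near_eq_cvg.
  by move: xU; rewrite inE => Ux; apply: eq_on_near fg Ux.
move=> [cf df]; split; last first.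
  move=> v; have [dv ck] := df v; split.
    move=> x xU; apply: near_eq_derivable (dv x xU).
    by move: xU; rewrite inE => Ux; apply: eq_on_near fg Ux.
  by apply: IH ck; exact: eq_on_derive.
move=> x xU; rewrite /prop_for /continuous_at -(fg _ xU).
apply: cvg_trans (cf x xU); apply: near_eq_cvg.
by move: xU; rewrite inE => Ux; apply: eq_on_near fg Ux.
Qed.

Lemma Ck_on_cst k U (a : W) : Ck_on k U (cst a).
Proof.
elim: k a => [|k IH] a /=; first by move=> x _; exact: cst_continuous.
split; first by move=> x _; exact: cst_continuous.
move=> v; split; first by move=> x _; exact: derivable_cst.
by rewrite (_ : 'D_v (cst a) = cst 0) //; apply/funext => x; rewrite derive_cst.
Qed.

Lemma Ck_onD k U (f g : V -> W) : open U ->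
  Ck_on k U f -> Ck_on k U g -> Ck_on k U (f \+ g).
Proof.
move=> oU; elim: k f g => [|k IH] f g /=.
  by move=> cf cg x xU; apply: continuousD; [exact: cf|exact: cg].
move=> [cf df] [cg dg]; split.
  by move=> x xU; apply: continuousD; [exact: cf|exact: cg].
move=> v; have [dfv ckf] := df v; have [dgv ckg] := dg v; split.
  by move=> x xU; apply: derivableD; [exact: dfv|exact: dgv].
apply: eq_Ck_on (IH _ _ ckf ckg) => // x xU /=.
by rewrite -deriveD //; [exact: dfv|exact: dgv].
Qed.

Lemma Ck_onN k U (f : V -> W) : open U ->
  Ck_on k U f -> Ck_on k U (\- f).
Proof.
move=> oU; elim: k f => [|k IH] f /=.
  by move=> cf x xU; apply: continuousN; exact: cf.
move=> [cf df]; split.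
  by move=> x xU; apply: continuousN; exact: cf.
move=> v; have [dfv ckf] := df v; split.
  by move=> x xU; apply: derivableN; exact: dfv.
apply: eq_Ck_on (IH _ ckf) => // x xU /=.
by rewrite -deriveN //; exact: dfv.
Qed.

End Ck_closure.

(** Restriction to the line through the point turns a directional derivative into one of a function
    of one real variable, where the chain rule and the mean value theorem apply. *)
Lemma is_derive_lineE {R : realType} {V W : normedModType R} (f : V -> W)
    (s : R) x v df :
  is_derive (s *: v + x) v f df = is_derive s 1 (fun h : R => f (h *: v + x)) df.
Proof.
have E : (fun h : R => h^-1 *: ((f \o shift (s *: v + x)) (h *: v)
      - f (s *: v + x))) =
    (fun h => h^-1 *: (((fun h => f (h *: v + x)) \o shift s) (h *: 1)
      - f (s *: v + x))).
  by apply/funext => h /=; rewrite [_%:A]mulr1 scalerDl addrA.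
apply/propext; split=> -[].
  by rewrite /derivable /derive E; exact: DeriveDef.
by rewrite /derivable /derive -E; exact: DeriveDef.
Qed.

Section Ck_closure_real.
Context {R : realType} {V : normedModType R}.
Implicit Types (U : set V) (k : nat) (f g : V -> R).

Lemma Ck_onM k U f g : open U ->
  Ck_on k U f -> Ck_on k U g -> Ck_on k U (f \* g).
Proof.
move=> oU; elim: k f g => [|k IH] f g /=.
  by move=> cf cg x xU; apply: continuousM; [exact: cf|exact: cg].
move=> /[dup] Hf [cf df] /[dup] Hg [cg dg]; split.
  by move=> x xU; apply: continuousM; [exact: cf|exact: cg].
move=> v; have [dfv ckf] := df v; have [dgv ckg] := dg v; split.
  by move=> x xU; apply: derivableM; [exact: dfv|exact: dgv].
apply: eq_Ck_on (Ck_onD oU (IH _ _ (Ck_on_le Hf) ckg)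
  (IH _ _ (Ck_on_le Hg) ckf)) => // x xU /=.
by rewrite deriveM //; [exact: dfv|exact: dgv].
Qed.

(** The derivative of [1/f] is [- (1/f)^2 'D_v f], so the induction on [k] uses the statement for
    the same [f] at the preceding order. *)
Lemma Ck_onV k U f : open U -> (forall x, U x -> f x != 0) ->
  Ck_on k U f -> Ck_on k U (fun x => (f x)^-1).
Proof.
move=> oU f0; elim: k f f0 => [|k IH] f f0 /=.
  move=> cf x xU; apply: continuousV; last exact: cf.
  by apply: f0; rewrite inE in xU.
move=> /[dup] Hf [cf df]; split.
  move=> x xU; apply: continuousV; last exact: cf.
  by apply: f0; rewrite inE in xU.
move=> v; have [dfv ckf] := df v; split.
  move=> x xU; apply: derivableV; last exact: dfv.
  by apply: f0; rewrite inE in xU.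
have Hi : Ck_on k U (fun x => (f x)^-1) by apply: IH => //; exact: Ck_on_le.
apply: eq_Ck_on (Ck_onN oU (Ck_onM oU (Ck_onM oU Hi Hi) ckf)) => //.
move=> x xU /=; rewrite deriveV //; last exact: dfv.
  by rewrite scaleNr /GRing.scale /= expr2 invfM.
by apply: f0; rewrite inE in xU.
Qed.

Lemma is_derive_sqrt f x v : 0 < f x -> derivable f x v ->
  is_derive x v (fun x => Num.sqrt (f x)) ((2 * Num.sqrt (f x))^-1 * 'D_v f x).
Proof.
move=> f0 dfv.
have E g dg : is_derive x v g dg = is_derive (0 : R) 1 (fun h : R => g (h *: v + x)) dg.
  by rewrite -is_derive_lineE scale0r add0r.
have [dl el] : is_derive (0 : R) 1 (fun h : R => f (h *: v + x)) ('D_v f x).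
  by rewrite -E; exact: derivableP.
have [ds es] : is_derive (f (0 *: v + x)) (1 : R) (@Num.sqrt R)
    (2 * Num.sqrt (f x))^-1.
  by rewrite scale0r add0r; exact: is_derive1_sqrt.
rewrite (E (fun x => Num.sqrt (f x))); apply: DeriveDef.
  apply/derivable1_diffP.
  by apply: (@differentiable_comp _ _ _ _ (fun h : R => f (h *: v + x))
    (@Num.sqrt R)); exact/derivable1_diffP.
by rewrite -derive1E (derive1_comp dl ds) !derive1E es el.
Qed.

Lemma Ck_on_sqrt k U f : open U -> (forall x, U x -> 0 < f x) ->
  Ck_on k U f -> Ck_on k U (fun x => Num.sqrt (f x)).
Proof.
move=> oU f0.
have cs : {in U, continuous f} -> {in U, continuous (fun x => Num.sqrt (f x))}.
  by move=> cf x xU; apply: continuous_comp; [exact: cf|exact: sqrt_continuous].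
elim: k => [|k IH] /=; first exact: cs.
move=> /[dup] Hf [cf df]; split; first exact: cs.
have is_d v x : U x -> is_derive x v (fun x => Num.sqrt (f x))
    ((2 * Num.sqrt (f x))^-1 * 'D_v f x).
  move=> Ux; apply: is_derive_sqrt; first exact: f0.
  by have [dfv _] := df v; apply: dfv; rewrite inE.
move=> v; have [dfv ckf] := df v; split.
  by move=> x /[!inE] Ux; have [] := is_d v x Ux.
have Hs := IH (Ck_on_le Hf).
have H2 : Ck_on k U (fun x => (2 * Num.sqrt (f x))^-1).
  apply: Ck_onV => //.
    by move=> x Ux; rewrite mulf_neq0 // gt_eqF // sqrtr_gt0 f0.
  by apply: (Ck_onM oU _ Hs); exact: Ck_on_cst.
apply: eq_Ck_on (Ck_onM oU H2 ckf) => // x /[!inE] Ux /=.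
by have [_ ->] := is_d v x Ux.
Qed.
End Ck_closure_real.

(** The line in direction [t v] is the line in direction [v] reparametrized by [h |-> h t], so the
    chain rule in one variable applies, also for [t = 0]. *)
Lemma is_deriveZv {R : realType} {V W : normedModType R} (f : V -> W) x v (t : R) :
  derivable f x v -> is_derive x (t *: v) f (t *: 'D_v f x).
Proof.
move=> dfv.
have E w dg : is_derive x w f dg = is_derive (0 : R) 1 (fun h : R => f (h *: w + x)) dg.
  by rewrite -is_derive_lineE scale0r add0r.
have /derivableP := dfv; rewrite !E => -[/derivable1_diffP dl el].
have dt : differentiable ( *%R^~ t : R -> R) 0.
  apply/derivable1_diffP; apply: (@derivableM _ _ id (cst t)).
    exact: derivable_id.
  exact: derivable_cst.
have h0 : (0 : R) * t = 0 by rewrite mul0r.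
rewrite (_ : (fun _ => _) = (fun h : R => f (h *: v + x)) \o ( *%R^~ t)); last first.
  by apply/funext => h /=; rewrite scalerA.
have dl' : differentiable (fun h : R => f (h *: v + x)) ((0 : R) * t) by rewrite h0.
apply: DeriveDef; first by apply/derivable1_diffP; exact: differentiable_comp.
rewrite deriveE; last exact: differentiable_comp.
rewrite diff_comp //= h0 -(deriveE _ dt).
have -> : 'D_1 ( *%R^~ t : R -> R) 0 = t.
  have -> : ( *%R^~ t : R -> R) = id * cst t by [].
  have [_ ->] : is_derive (0 : R) 1 (id * cst t : R -> R) (0 *: 0 + t *: 1).
    exact: is_deriveM.
  by rewrite scale0r add0r [_ *: _]mulr1.
rewrite -[X in 'd _ _ X]mulr1 -[X in 'd _ _ X]/(t *: (1 : R)) linearZ /=.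
by rewrite -deriveE // el.
Qed.

Lemma MVT_line {R : realType} {V : normedModType R} (f : V -> R) x v :
  (forall s : R, 0 <= s <= 1 -> derivable f (s *: v + x) v) ->
  exists2 s : R, 0 < s < 1 & f (v + x) - f x = 'D_v f (s *: v + x).
Proof.
move=> dfv.
pose g (h : R) := f (h *: v + x).
have dg (s : R) : 0 <= s <= 1 -> is_derive s 1 g ('D_v f (s *: v + x)).
  by move=> /dfv /derivableP; rewrite is_derive_lineE.
have [||c] := @MVT R g (fun s => 'D_v f (s *: v + x)) 0 1 ltr01.
- by move=> s /[!in_itv] /= /andP[s0 s1]; apply: dg; rewrite !ltW.
- apply: derivable_within_continuous => s /[!in_itv] /= s01.
  by have [] := dg s s01.
rewrite in_itv /= => c01; rewrite /g scale1r scale0r add0r subr0 mulr1.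
by move=> e; exists c.
Qed.

(** * Functions on the plane: from directional to total derivatives *)

Section plane.
Context {R : realType}.
Local Notation V := 'rV[R]_2.
Implicit Types (U : set V) (f : V -> R) (x v : V).

Definition ev0 : V := delta_mx 0 0.
Definition ev1 : V := delta_mx 0 1.

Lemma rV2_decomp x : x = x 0 0 *: ev0 + x 0 1 *: ev1.
Proof.
apply/rowP => i; rewrite !mxE /=; case: i => [[|[|//]] Hi] /=.
  by rewrite mulr1 mulr0 addr0; congr (x _ _); apply/val_inj.
by rewrite mulr1 mulr0 add0r; congr (x _ _); apply/val_inj.
Qed.

Lemma rV2_coord_le x i : `|x 0 i| <= `|x|.
Proof.
rewrite [leRHS]/Num.Def.normr /= mx_normrE.
exact: (le_bigmax _ (fun ij : 'I_1 * 'I_2 => `|x ij.1 ij.2|) (0, i)).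
Qed.

Lemma rV2_norm_le x (r : R) : 0 <= r -> `|x 0 0| <= r -> `|x 0 1| <= r -> `|x| <= r.
Proof.
move=> r0 h0 h1; rewrite [leLHS]/Num.Def.normr /= mx_normrE.
apply: bigmax_le => // -[i j] _ /=; rewrite (ord1 i).
by case: j => [[|[|//]] Hj]; [have -> : Ordinal Hj = 0 by exact: val_inj|
  have -> : Ordinal Hj = 1 by exact: val_inj].
Qed.

(** [Ck_on] only speaks of derivatives along fixed vectors. Total differentiability is obtained by
    going from [x] to [x + h] parallel to the axes, with the mean value theorem on each leg and the
    continuity of the partial derivatives. *)
Lemma C1_increment U f x : open U -> Ck_on 1 U f -> U x ->
  forall e : R, 0 < e -> \forall h \near (0 : V),
    `|f (h + x) - f x - (h 0 0 * 'D_ev0 f x + h 0 1 * 'D_ev1 f x)| <= e * `|h|.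
Proof.
move=> oU [cf df] Ux e e0.
have [d0 c0] := df ev0; have [d1 c1] := df ev1.
have xU : x \in U by rewrite inE.
have e20 : 0 < e / 2 by rewrite divr_gt0.
have N : \forall y \near x, [/\ U y, `|'D_ev0 f x - 'D_ev0 f y| <= e / 2 &
    `|'D_ev1 f x - 'D_ev1 f y| <= e / 2].
  have n0 : \forall y \near x, U y by exact: open_nbhs_nbhs.
  have n1 : \forall t \near x, `|'D_ev0 f x - 'D_ev0 f t| <= e / 2 .
    by apply: ((cvgrPdist_le _ _).1 (c0 x xU)).
  have n2 : \forall t \near x, `|'D_ev1 f x - 'D_ev1 f t| <= e / 2 .
    by apply: ((cvgrPdist_le _ _).1 (c1 x xU)).
  have FF : Filter (nbhs x) by exact: nbhs_filter.
  apply: (@filterS _ _ FF _ _ _ (@filterI _ _ FF _ _ n0 (@filterI _ _ FF _ _ n1 n2))).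
  by move=> y [? [? ?]]; split.
have [r /= r0 Br] := (nbhs_ballP _ _).1 N.
have B y : `|y| < r -> [/\ U (y + x), `|'D_ev0 f x - 'D_ev0 f (y + x)| <= e / 2 &
    `|'D_ev1 f x - 'D_ev1 f (y + x)| <= e / 2].
  move=> yr; apply: Br; rewrite -ball_normE /= opprD addrCA subrr addr0.
  by rewrite normrN.
have : \forall h \near (0 : V), `|h| < r.
  by apply/nbhs_normP; exists r => // h /=; rewrite sub0r normrN.
apply: filterS => h hr.
(* Both legs stay in the ball of radius [r], because the norm is the maximum of the two
   coordinates. *)
have small (s a b : R) : 0 <= s <= 1 -> `|a| <= `|h| -> `|b| <= `|h| ->
    `|s *: (a *: ev0) + b *: ev1| < r.
  move=> /andP[s0 s1] ah bh; apply: le_lt_trans hr.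
  apply: rV2_norm_le => //; rewrite !mxE /= !(mulr1, mulr0, addr0, add0r) //.
  by rewrite normrM (ger0_norm s0) (le_trans _ ah) // ler_piMl.
have small1 (s b : R) : 0 <= s <= 1 -> `|b| <= `|h| -> `|s *: (b *: ev1)| < r.
  move=> /andP[s0 s1] bh; apply: le_lt_trans hr.
  apply: rV2_norm_le => //; rewrite !mxE /= !(mulr1, mulr0, addr0, add0r) ?normr0 //.
  by rewrite normrM (ger0_norm s0) (le_trans _ bh) // ler_piMl.
have der0 y : U y -> is_derive y (h 0 0 *: ev0) f (h 0 0 *: 'D_ev0 f y).
  by move=> Uy; apply: is_deriveZv; apply: d0; rewrite inE.
have der1 y : U y -> is_derive y (h 0 1 *: ev1) f (h 0 1 *: 'D_ev1 f y).
  by move=> Uy; apply: is_deriveZv; apply: d1; rewrite inE.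
have [|s s01] := @MVT_line R _ f (h 0 1 *: ev1 + x) (h 0 0 *: ev0).
  move=> s s01; rewrite addrA.
  have [Uy _ _] := B _ (small _ _ _ s01 (rV2_coord_le h 0) (rV2_coord_le h 1)).
  by have [] := der0 _ Uy.
have {}s01 : 0 <= s <= 1 by case/andP: s01 => *; rewrite !ltW.
rewrite !addrA -rV2_decomp.
have [Uy ey _] := B _ (small _ _ _ s01 (rV2_coord_le h 0) (rV2_coord_le h 1)).
have [_ ->] := der0 _ Uy => E0.
have [|t t01] := @MVT_line R _ f x (h 0 1 *: ev1).
  move=> t t01.
  have [Uz _ _] := B _ (small1 _ _ t01 (rV2_coord_le h 1)).
  by have [] := der1 _ Uz.
have {}t01 : 0 <= t <= 1 by case/andP: t01 => *; rewrite !ltW.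
have [Uz _ ez] := B _ (small1 _ _ t01 (rV2_coord_le h 1)).
have [_ ->] := der1 _ Uz => E1.
set A := 'D_ev0 f (_ + _ + _) in ey E0; set C := 'D_ev1 f (_ + x) in ez E1.
have -> : f (h + x) - f x - (h 0 0 * 'D_ev0 f x + h 0 1 * 'D_ev1 f x) =
    - (h 0 0 * ('D_ev0 f x - A) + h 0 1 * ('D_ev1 f x - C)).
  have -> : f (h + x) = h 0 0 * A + (h 0 1 * C + f x).
    by rewrite -[h 0 0 * A]E0 -[h 0 1 * C]E1 !subrK.
  by move: ('D_ev0 f x) ('D_ev1 f x) => p q; ring.
rewrite normrN (le_trans (ler_normD _ _)) // !normrM.
rewrite [e]splitr mulrDl lerD // mulrC ler_pM //; exact: rV2_coord_le.
Qed.

Definition lin2 (a b : R) : V -> R := fun h => h 0 0 * a + h 0 1 * b.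

Lemma lin2_is_linear a b : linear (lin2 a b).
Proof. by move=> k u v; rewrite /lin2 !mxE /GRing.scale /=; ring. Qed.
HB.instance Definition _ a b :=
  GRing.isLinear.Build R V R _ (lin2 a b) (lin2_is_linear a b).

Lemma C1_is_diff U f x : open U -> Ck_on 1 U f -> U x ->
  is_diff x f (lin2 ('D_ev0 f x) ('D_ev1 f x)).
Proof.
move=> oU Cf Ux; set L := lin2 _ _.
have cL : continuous L.
  move=> y.
  have ci i : {for y, continuous (fun h : 'rV[R]_2 => h 0 i)} by exact: coord_continuous.
  have ck c : {for y, continuous (fun h : 'rV[R]_2 => c : R)} by exact: cst_continuous.
  exact: (continuousD (continuousM (ci 0) (ck _)) (continuousM (ci 1) (ck _))).
have near0 (e : R) : 0 < e -> \forall h \near nbhs (0 : V),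
    `|(f \o shift x - (cst (f x) + L)) h| <= e * `|h|.
  move=> e0; have := C1_increment oU Cf Ux e0.
  apply: (@filterS _ _ (nbhs_filter _)) => h.
  suff -> : (f \o shift x - (cst (f x) + L)) h = f (h + x) - f x - L h by [].
  by rewrite -addrA -opprD.
have E : 'd f x = L :> (V -> R).
  apply: diff_unique => //; apply/eqaddoP => e e0.
  have := near0 e e0; exact.
apply: DiffDef => //; apply/diff_locallyP; rewrite E; split => //.
apply/eqaddoP => e e0.
by have := near0 e e0; exact.
Qed.

Lemma C1_deriveE U f x v : open U -> Ck_on 1 U f -> U x ->
  'D_v f x = v 0 0 * 'D_ev0 f x + v 0 1 * 'D_ev1 f x.
Proof.
move=> oU Cf Ux; have [dif e] := C1_is_diff oU Cf Ux.
by rewrite deriveE // e.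
Qed.

Lemma C1_derive_comp (V' : normedModType R) (T : V' -> V) U f y w : open U ->
  Ck_on 1 U f -> U (T y) -> (forall i, derivable (fun z => T z 0 i) y w) ->
  is_derive y w (f \o T) ('D_w (fun z => T z 0 0) y * 'D_ev0 f (T y)
     + 'D_w (fun z => T z 0 1) y * 'D_ev1 f (T y)).
Proof.
move=> oU Cf Uy dT.
pose g (h : R) := T (h *: w + y).
have E (F : V' -> R) dg : is_derive y w F dg = is_derive (0 : R) 1 (fun h : R => F (h *: w + y)) dg.
  by rewrite -is_derive_lineE scale0r add0r.
have dgi i : is_derive (0 : R) 1 (fun h => g h 0 i) ('D_w (fun z => T z 0 i) y).
  by rewrite -(E (fun z => T z 0 i)); exact: derivableP.
have dg : derivable g 0 1.
  by apply/derivable_mxP => i j; rewrite (ord1 i); have [] := dgi j.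
have dg' := (derivable1_diffP _ _).1 dg.
have g0 : g 0 = T y by rewrite /g scale0r add0r.
have [df ef] := C1_is_diff oU Cf Uy.
have df' : differentiable f (g 0) by rewrite g0.
rewrite E -[fun h => _]/(f \o g); apply: DeriveDef.
  by apply/derivable1_diffP; exact: differentiable_comp.
rewrite deriveE; last exact: differentiable_comp.
rewrite diff_comp //= -(deriveE _ dg') derive_mx // g0 ef /lin2 !mxE.
by have [_ ->] := dgi 0; have [_ ->] := dgi 1.
Qed.

End plane.

Section Ck_coord.
Context {R : realType} {V : normedModType R} {m n : nat}.
Implicit Types (U : set V) (T : V -> 'M[R]_(m, n)).

Lemma continuous_mx_coord T x i j :
  {for x, continuous T} -> {for x, continuous (fun z => T z i j)}.
Proof.
move=> cT; apply: (@continuous_comp _ _ _ T (fun A : 'M[R]_(m, n) => A i j)) => //.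
exact: coord_continuous.
Qed.

Lemma Ck_on_coord k U T i j : open U ->
  Ck_on k U T -> Ck_on k U (fun z => T z i j).
Proof.
move=> oU; elim: k T => [|k IH] T /=.
  by move=> cT x xU; apply: continuous_mx_coord; exact: cT.
move=> [cT dT]; split.
  by move=> x xU; apply: continuous_mx_coord; exact: cT.
move=> v; have [dv ck] := dT v; split.
  by move=> x xU; exact: ((derivable_mxP _ _ _).1 (dv x xU)).
apply: eq_Ck_on (IH _ ck) => // x xU.
by rewrite derive_mx ?mxE //; exact: dv.
Qed.

Lemma derive_coord U T v x i j : Ck_on 1 U T -> U x ->
  'D_v (fun z => T z i j) x = ('D_v T x) i j.
Proof.
move=> [_ /(_ v)[dv _]] Ux; rewrite derive_mx ?mxE //.
by apply: dv; rewrite inE.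
Qed.

End Ck_coord.

(** By the chain rule a derivative of [f \o T] is a sum of products of derivatives of [T] with
    partial derivatives of [f] composed with [T], to which the induction applies. The maps [T] in
    view are the changes of charts. *)
Lemma Ck_on_comp {R : realType} {V : normedModType R} k (U : set 'rV[R]_2)
    (U' : set V) (f : 'rV[R]_2 -> R) (T : V -> 'rV[R]_2) :
  open U -> open U' -> (forall x, U' x -> U (T x)) ->
  Ck_on k U' T -> Ck_on k U f -> Ck_on k U' (f \o T).
Proof.
move=> oU oU' UT.
have cont g S : {in U', continuous S} -> (forall x, U' x -> U (S x)) ->
    {in U, continuous g} -> {in U', continuous (g \o S : V -> R)}.
  move=> cS US cg x xU'; apply: continuous_comp; first exact: cS.
  by apply: cg; rewrite inE; apply: US; rewrite inE in xU'.
elim: k f => [|k IH] f /=; first by move=> cT cf; exact: cont.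
move=> /[dup] HT [cT dT] /[dup] Hf [cf df]; split; first exact: cont.
have Hf1 : Ck_on 1 U f.
  split=> // v; have [dv /Ck_on_continuous cv] := df v; by split.
have HT1 : Ck_on 1 U' T.
  split=> // v; have [dv /Ck_on_continuous cv] := dT v; by split.
have der w x : U' x -> is_derive x w (f \o T)
    ('D_w (fun z => T z 0 0) x * 'D_ev0 f (T x)
     + 'D_w (fun z => T z 0 1) x * 'D_ev1 f (T x)).
  move=> Ux; apply: (C1_derive_comp oU Hf1 (UT _ Ux)) => i.
  have [dv _] := dT w; apply: ((derivable_mxP _ _ _).1 (dv x _)).
  by rewrite inE.
move=> w; split; first by move=> x /[!inE] Ux; have [] := der w x Ux.
have HTk : Ck_on k U' T by exact: Ck_on_le.
have Hc i : Ck_on k U' (fun x => ('D_w T x) 0 i).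
  by apply: Ck_on_coord => //; have [_] := dT w.
have H0 := IH _ HTk (df ev0).2; have H1 := IH _ HTk (df ev1).2.
apply: eq_Ck_on (Ck_onD oU' (Ck_onM oU' (Hc 0) H0) (Ck_onM oU' (Hc 1) H1)) => //.
move=> x /[!inE] Ux /=; have [_ ->] := der w x Ux.
by rewrite !(derive_coord _ _ _ HT1 Ux).
Qed.

Lemma ler_dist_half {R : realFieldType} (e A B C : R) :
  `|A - C| <= e / 2 -> `|B - C| <= e / 2 -> `|B - A| <= e.
Proof. by rewrite !ler_norml => /andP[? ?] /andP[? ?]; apply/andP; split; lra. Qed.

(** * Second derivatives: symmetry, and sign at a maximum *)

Section second_order.
Context {R : realType} {V : normedModType R}.
Implicit Types (U : set V) (f : V -> R) (x a b v : V).

Lemma derive_translate f c v x : 'D_v (fun y => f (y + c)) x = 'D_v f (x + c).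
Proof.
rewrite /derive; set g1 := fun h => h^-1 *: _; set g2 := fun h => h^-1 *: _.
suff -> : g1 = g2 by [].
by apply/funext => h; rewrite /g1 /g2 /= addrA.
Qed.

Lemma derivable_translate f c v x :
  derivable (fun y => f (y + c)) x v = derivable f (x + c) v.
Proof.
rewrite /derivable; set g1 := fun h => h^-1 *: _; set g2 := fun h => h^-1 *: _.
suff -> : g1 = g2 by [].
by apply/funext => h; rewrite /g1 /g2 /= addrA.
Qed.

Lemma nbhs0_ballP (P : set V) x : nbhs x P ->
  exists2 r : R, 0 < r & forall h, `|h| < r -> P (h + x).
Proof.
move=> /nbhs_ballP[r /= r0 Br]; exists r => // h hr; apply: Br.
by rewrite -ball_normE /= opprD addrCA subrr addr0 normrN.
Qed.

(* The second difference of [f] along [t a] and [t b] is [t^2] times a value of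
   the mixed derivative near [x]; it is symmetric in [a] and [b]. *)
Lemma second_difference U f x a b (r t : R) : Ck_on 2 U f ->
  (forall h, `|h| < r -> U (h + x)) -> 0 < t -> t * (`|a| + `|b|) < r ->
  exists2 h, `|h| < r & (f (t *: a + (t *: b + x)) - f (t *: b + x))
    - (f (t *: a + x) - f x) = t ^+ 2 * 'D_b ('D_a f) (h + x).
Proof.
move=> [_ df] Br t0 tr.
have [da [_ dda]] := df a; have [dab _] := dda b.
have small (s s' : R) : 0 <= s <= 1 -> 0 <= s' <= 1 ->
    `|s *: (t *: a) + s' *: (t *: b)| < r.
  move=> /andP[s0 s1] /andP[s'0 s'1]; apply: le_lt_trans tr.
  rewrite (le_trans (ler_normD _ _)) // !normrZ mulrDr (gtr0_norm t0).
  by rewrite (ger0_norm s0) (ger0_norm s'0) lerD // ler_piMl // mulr_ge0 // ltW.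
have z01 : 0 <= (0 : R) <= 1 by rewrite lexx ler01.
have o01 : 0 <= (1 : R) <= 1 by rewrite lexx ler01.
have small0 (s : R) : 0 <= s <= 1 -> `|s *: (t *: a)| < r.
  by move=> s01; rewrite -[X in `|X|]addr0 -(scale0r (t *: b)) small.
pose phi y := f (y + t *: b) - f y.
have dU y v : U y -> derivable f y a by move=> Uy; apply: da; rewrite inE.
have Da y : U y -> is_derive y (t *: a) f (t *: 'D_a f y).
  by move=> Uy; apply: is_deriveZv; exact: dU.
have Db y : U y -> is_derive y (t *: b) ('D_a f) (t *: 'D_b ('D_a f) y).
  by move=> Uy; apply: is_deriveZv; apply: dab; rewrite inE.
have dphi (s : R) : 0 <= s <= 1 -> is_derive (s *: (t *: a) + x) (t *: a) phi
   (t *: 'D_a f (s *: (t *: a) + x + t *: b) - t *: 'D_a f (s *: (t *: a) + x)).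
  move=> s01.
  have U1 : U (s *: (t *: a) + x + t *: b).
    by rewrite addrAC; apply: Br; rewrite -[X in _ + X]scale1r small.
  have U2 : U (s *: (t *: a) + x) by apply: Br; exact: small0.
  have [d1 e1] := Da _ U1.
  have d3 : is_derive (s *: (t *: a) + x) (t *: a) (fun y => f (y + t *: b))
      (t *: 'D_a f (s *: (t *: a) + x + t *: b)).
    by apply: DeriveDef; rewrite ?derivable_translate ?derive_translate.
  exact: (is_deriveB d3 (Da _ U2)).
have [|s s01] := @MVT_line R _ phi x (t *: a).
  by move=> s s01; have [] := dphi s s01.
have {}s01 : 0 <= s <= 1 by case/andP: s01 => *; rewrite !ltW.
have [_ ->] := dphi s s01 => E1.
have [|s' s'01] := @MVT_line R _ ('D_a f) (s *: (t *: a) + x) (t *: b).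
  move=> s' s'01.
  have U3 : U (s' *: (t *: b) + (s *: (t *: a) + x)).
    by rewrite addrA [X in X + _]addrC; apply: Br; exact: small.
  by have [] := Db _ U3.
have {}s'01 : 0 <= s' <= 1 by case/andP: s'01 => *; rewrite !ltW.
have U3 : U (s' *: (t *: b) + (s *: (t *: a) + x)).
  by rewrite addrA [X in X + _]addrC; apply: Br; exact: small.
have [_ ->] := Db _ U3 => E2.
exists (s *: (t *: a) + s' *: (t *: b)); first exact: small.
have -> : f (t *: a + (t *: b + x)) - f (t *: b + x) - (f (t *: a + x) - f x)
    = phi (t *: a + x) - phi x.
  rewrite /phi -[t *: a + x + _]addrA [x + _]addrC.
  by move: (f _) (f _) (f _) (f _) => p1 p2 p3 p4; ring.
have sc (u w : R) : t *: u - t *: w = t * (u - w) by rewrite mulrBr.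
have sc1 (u : R) : t *: u = t * u by [].
rewrite E1 sc [_ + t *: b]addrC E2 sc1 mulrA -expr2.
apply: (congr1 (fun y => t ^+ 2 * 'D_b ('D_a f) y)).
by rewrite addrCA addrA.
Qed.

(** Exchanging the two increments does not change the second difference, so the mixed derivatives in
    the two orders agree at two points close to [x]; continuity carries the equality to [x]. *)
Lemma derive_swap U f x a b : open U -> Ck_on 2 U f -> U x ->
  'D_a ('D_b f) x = 'D_b ('D_a f) x.
Proof.
move=> oU Hf Ux.
have [_ df] := Hf.
have [_ [_ dda]] := df a; have [_ cab] := dda b.
have [_ [_ ddb]] := df b; have [_ cba] := ddb a.
have xU : x \in U by rewrite inE.
apply/eqP; rewrite -subr_eq0 -normr_eq0 eq_le normr_ge0 andbT.
apply/ler_addgt0Pl => e e0; rewrite addr0.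
have e20 : 0 < e / 2 by rewrite divr_gt0.
have [r1 r10 B1] := nbhs0_ballP ((cvgrPdist_le _ _).1 (cab x xU) _ e20).
have [r2 r20 B2] := nbhs0_ballP ((cvgrPdist_le _ _).1 (cba x xU) _ e20).
have [r3 r30 B3] := nbhs0_ballP (open_nbhs_nbhs (conj oU Ux)).
pose r := Num.min r1 (Num.min r2 r3).
have r0 : 0 < r by rewrite !lt_min r10 r20 r30.
(* This makes [t (|a| + |b|)] less than [r / 2]; the summand 1 covers the case [a = b = 0]. *)
pose t := r / (2 * (`|a| + `|b| + 1)).
have d0 : 0 < `|a| + `|b| + 1 by rewrite ltr_wpDl // addr_ge0.
have t0 : 0 < t by rewrite divr_gt0 // mulr_gt0.
have tr : t * (`|a| + `|b|) < r.
  rewrite /t mulrAC ltr_pdivrMr ?mulr_gt0 // ltr_pM2l //.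
  rewrite mulr2n mulrDl mul1r; have : 0 <= `|a| + `|b| by rewrite addr_ge0.
  by move: d0; lra.
have Br h : `|h| < r -> U (h + x).
  by rewrite !lt_min => /and3P[_ _ h3]; exact: B3.
have [p pr Ep] := second_difference Hf Br t0 tr.
have [q qr Eq] := @second_difference U f x b a r t Hf Br t0 (eq_ind _ (fun z => t * z < r) tr _ (addrC _ _)).
have PQ : 'D_b ('D_a f) (p + x) = 'D_a ('D_b f) (q + x).
  apply: (@mulfI _ (t ^+ 2)); first by rewrite expf_neq0 // gt_eqF.
  have Eh : f (t *: b + (t *: a + x)) = f (t *: a + (t *: b + x)).
    by congr f; exact: addrCA.
  apply: (etrans (esym Ep)); apply: (etrans _ Eq); rewrite Eh.
  by move: (f _) (f _) (f _) (f _) => p1 p2 p3 p4; ring.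
move: pr qr; rewrite !lt_min => /and3P[p1 _ _] /and3P[_ q2 _].
have := B1 p p1; rewrite PQ => h1.
exact: (ler_dist_half h1 (B2 q q2)).
Qed.

(** If the second derivative along [v] were positive, ['D_v f], which vanishes at [x], would be
    positive shortly after [x], and by the mean value theorem [f] would exceed its maximum. *)
Lemma local_max_derive2 U f x v : open U -> Ck_on 2 U f -> U x ->
  (\forall y \near x, f y <= f x) -> 'D_v f x = 0 /\ 'D_v ('D_v f) x <= 0.
Proof.
move=> oU [cf df] Ux fmax.
have [dv [_ ddv]] := df v; have [dvv _] := ddv v.
have xU : x \in U by rewrite inE.
have [r1 r10 B1] := nbhs0_ballP fmax.
have [r2 r20 B2] := nbhs0_ballP (open_nbhs_nbhs (conj oU Ux)).
pose r := Num.min r1 r2 / (`|v| + 1).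
have d0 : 0 < `|v| + 1 by rewrite ltr_wpDl.
have r0 : 0 < r by rewrite divr_gt0 // lt_min r10 r20.
have B (h : R) : `|h| < r -> U (h *: v + x) /\ f (h *: v + x) <= f x.
  move=> hr; have : `|h *: v| < Num.min r1 r2.
    rewrite normrZ; apply: le_lt_trans (_ : `|h| * (`|v| + 1) < _).
      by rewrite ler_wpM2l // lerDl.
    by rewrite -ltr_pdivlMr.
  by rewrite lt_min => /andP[h1 h2]; split; [exact: B2|exact: B1].
have B' (h : R) : h \in `]- r, r[ -> U (h *: v + x) /\ f (h *: v + x) <= f x.
  by rewrite in_itv /= => hr; apply: B; rewrite ltr_norml.
have dg (h : R) : h \in `]- r, r[ ->
    is_derive h 1 (fun h : R => f (h *: v + x)) ('D_v f (h *: v + x)).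
  move=> /B'[Uh _]; rewrite -is_derive_lineE; apply: derivableP.
  by apply: dv; rewrite inE.
have D0 : 'D_v f x = 0.
  have rr : - r <= r by apply: ltW; rewrite -subr_gt0 opprK addr_gt0.
  have zr : (0 : R) \in `]- r, r[ by rewrite in_itv /= oppr_lt0 r0.
  have := @derive1_at_max R (fun h : R => f (h *: v + x)) (- r) r 0 rr.
  move=> /(_ _ zr); have [dg0 e0] := dg 0 zr.
  rewrite scale0r add0r in e0.
  case.
  - by move=> h hr; have [] := dg h hr.
  - by move=> h /B'[]; rewrite scale0r add0r.
  - by rewrite e0.
split => //; rewrite leNgt; apply/negP => c0.
have N : \forall t \near 0^', 0 < t^-1 *: (('D_v f \o shift x) (t *: v) - 'D_v f x).
  by apply: (cvgr_gt _ (dvv x xU)); exact: c0.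
have [e /= e0 Be] := N.
pose h := Num.min e r / 2.
have m0 : 0 < Num.min e r by rewrite lt_min e0 r0.
have h0 : 0 < h by rewrite divr_gt0.
have hm : h < Num.min e r by rewrite gtr_pMr // invf_lt1 ?ltr1n.
move: (hm); rewrite lt_min => /andP[he hr].
have sh (s : R) : 0 <= s <= 1 -> `|s * h| < r.
  move=> /andP[s0 s1]; rewrite ger0_norm; last by rewrite mulr_ge0 // ltW.
  by apply: le_lt_trans hr; rewrite ler_piMl // ltW.
have Dh : forall s : R, 0 <= s <= 1 ->
    is_derive (s *: (h *: v) + x) (h *: v) f (h *: 'D_v f ((s * h) *: v + x)).
  move=> s s01; rewrite scalerA; apply: is_deriveZv; apply: dv; rewrite inE.
  by have [] := B _ (sh s s01).
have [|s s01] := @MVT_line R _ f x (h *: v).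
  by move=> s s01; have [] := Dh s s01.
have s01' : 0 <= s <= 1 by case/andP: s01 => *; rewrite !ltW.
have [_ ->] := Dh s s01' => E.
have [s0 s1] := andP s01.
have sh0 : 0 < s * h by rewrite mulr_gt0.
have : 0 < (s * h)^-1 *: ('D_v f ((s * h) *: v + x) - 'D_v f x).
  apply: (Be (s * h)); last by rewrite gt_eqF.
  rewrite /= sub0r normrN gtr0_norm //; apply: le_lt_trans he.
  by rewrite ler_piMl // ltW.
rewrite D0 subr0 [_ *: _]/(_ * _) pmulr_rgt0 ?invr_gt0 // => Dpos.
have hr' : `|h| < r by rewrite gtr0_norm.
have [_] := B h hr'; rewrite -subr_le0; rewrite E [_ *: _]/(_ * _).
by rewrite leNgt mulr_gt0.
Qed.

End second_order.

(** * Null frames on minimal surfaces *)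

Section bilinear_dot.
Context {A : comPzRingType} {m : nat}.
Implicit Types (X Y Z : 'rV[A]_m) (a : A).

(** Bilinear, without conjugation; the hermitian product is written [dot X Y^c]. *)
Definition dot X Y : A := \sum_i X 0 i * Y 0 i.

Lemma dotC X Y : dot X Y = dot Y X.
Proof. by apply: eq_bigr => i _; rewrite mulrC. Qed.

Lemma dotDl X Y Z : dot (X + Y) Z = dot X Z + dot Y Z.
Proof. by rewrite -big_split /=; apply: eq_bigr => i _; rewrite !mxE mulrDl. Qed.

Lemma dotZl a X Y : dot (a *: X) Y = a * dot X Y.
Proof. by rewrite mulr_sumr; apply: eq_bigr => i _; rewrite !mxE mulrA. Qed.

Lemma dotNl X Y : dot (- X) Y = - dot X Y.
Proof. by rewrite -scaleN1r dotZl mulN1r. Qed.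

Lemma dotDr X Y Z : dot Z (X + Y) = dot Z X + dot Z Y.
Proof. by rewrite dotC dotDl !(dotC _ Z). Qed.

Lemma dotZr a X Y : dot Y (a *: X) = a * dot Y X.
Proof. by rewrite dotC dotZl (dotC X). Qed.

Lemma dotNr X Y : dot Y (- X) = - dot Y X.
Proof. by rewrite dotC dotNl (dotC X). Qed.

Lemma dot0l X : dot 0 X = 0.
Proof. by rewrite -(scale0r 0) dotZl mul0r. Qed.

Definition dotE := (dotDl, dotZl, dotNl, dotDr, dotZr, dotNr).
End bilinear_dot.

Section null_frame.
Context {A : comPzRingType} {m : nat}.
Variables (D : A -> A) (cj : {rmorphism A -> A}) (rho : A) (f : 'rV[A]_m).

(** The derivation along the conjugate of the vector field [D]. *)
Definition cjder a := cj (D (cj a)).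
Definition lap a := cjder (D a) - cj rho * D a.

Hypothesis cjK : involutive cj.
Hypothesis derD : forall a b, D (a + b) = D a + D b.
Hypothesis derM : forall a b, D (a * b) = D a * b + a * D b.
(** Absence of torsion for the connection with coefficient [rho]. *)
Hypothesis der_comm : forall a,
  D (cjder a) = cjder (D a) + rho * cjder a - cj rho * D a.
Hypothesis two_reg : forall a : A, a + a = 0 -> a = 0.

Local Notation E := cjder.
Local Notation rb := (cj rho).
Local Notation "X ^c" := (map_mx cj X).

Lemma der0 : D 0 = 0.
Proof. by apply: (addrI (D 0)); rewrite -derD !addr0. Qed.

Lemma derN a : D (- a) = - D a.
Proof. by apply: (addrI (D a)); rewrite -derD !subrr der0. Qed.

Lemma der1 : D 1 = 0.
Proof.
have h := derM 1 1; rewrite !(mul1r, mulr1) in h.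
by apply: (addrI (D 1)); rewrite addr0 -h.
Qed.

Lemma der_nat n : D n%:R = 0.
Proof. by elim: n => [|n IH]; rewrite ?der0 // -natr1 derD IH der1 addr0. Qed.

Lemma cjderD a b : E (a + b) = E a + E b.
Proof. by rewrite /cjder rmorphD derD rmorphD. Qed.

Lemma cjder_nat n : E n%:R = 0.
Proof. by rewrite /cjder rmorph_nat der_nat rmorph0. Qed.

Lemma cjderM a b : E (a * b) = E a * b + a * E b.
Proof. by rewrite /cjder rmorphM derM rmorphD !rmorphM !cjK. Qed.

Lemma cjderN a : E (- a) = - E a.
Proof. by rewrite /cjder rmorphN derN rmorphN. Qed.

Lemma cj_der a : cj (D a) = E (cj a).
Proof. by rewrite /cjder cjK. Qed.

Lemma cj_cjder a : cj (E a) = D (cj a).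
Proof. by rewrite /cjder cjK. Qed.

(* [nab k] and [nbar k] are the (1,0) and (0,1) covariant derivatives of the
   component, in the null frame, of a section of the k-th power of the
   canonical bundle; negative [k] stands for conjugates. *)
Definition nab (k : int) a := D a + k%:~R * rho * a.
Definition nbar (k : int) a := E a - k%:~R * rb * a.
Definition nabv k (X : 'rV[A]_m) := map_mx (nab k) X.
Definition nbarv k (X : 'rV[A]_m) := map_mx (nbar k) X.
(** The Gauss curvature, by the structure equation of the connection; [gauss] evaluates it. *)
Definition curv := E rho + D rb - 2 * rho * rb.

Lemma nab0 a : nab 0 a = D a. Proof. by rewrite /nab !mul0r addr0. Qed.
Lemma nbar0 a : nbar 0 a = E a. Proof. by rewrite /nbar !mul0r subr0. Qed.
Lemma nabv0 X : nabv 0 X = map_mx D X.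
Proof. by apply/rowP => i; rewrite !mxE nab0. Qed.

Lemma lapE a : lap a = nbar 1 (D a).
Proof. by rewrite /lap /nbar mulr1z mul1r. Qed.

Lemma nabD k a b : nab k (a + b) = nab k a + nab k b.
Proof. by rewrite /nab derD; ring. Qed.
Lemma nbarD k a b : nbar k (a + b) = nbar k a + nbar k b.
Proof. by rewrite /nbar cjderD; ring. Qed.
Lemma nabN k a : nab k (- a) = - nab k a.
Proof. by rewrite /nab derN; ring. Qed.
Lemma nbarN k a : nbar k (- a) = - nbar k a.
Proof. by rewrite /nbar cjderN; ring. Qed.
Lemma nab_0 k : nab k 0 = 0. Proof. by rewrite /nab der0 mulr0 addr0. Qed.
Lemma nbar_0 k : nbar k 0 = 0.
Proof. by rewrite /nbar /cjder rmorph0 der0 rmorph0 mulr0 subr0. Qed.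
Lemma nabvD k X Y : nabv k (X + Y) = nabv k X + nabv k Y.
Proof. by apply/rowP => i; rewrite !mxE nabD. Qed.
Lemma nabvN k X : nabv k (- X) = - nabv k X.
Proof. by apply/rowP => i; rewrite !mxE nabN. Qed.

(** Covariant derivatives obey the Leibniz rule when weights add. The weight [l] is tied by an
    equation, so that sums such as [2 + (-2)] may be given in reduced form. *)
Lemma nabM i k l a b : l = i + k ->
  nab l (a * b) = nab i a * b + a * nab k b.
Proof. by move=> ->; rewrite /nab derM intrD; ring. Qed.
Lemma nbarM i k l a b : l = i + k ->
  nbar l (a * b) = nbar i a * b + a * nbar k b.
Proof. by move=> ->; rewrite /nbar cjderM intrD; ring. Qed.
Lemma nabvZ i k l a X : l = i + k ->
  nabv l (a *: X) = nab i a *: X + a *: nabv k X.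
Proof. by move=> e; apply/rowP => h; rewrite !mxE; exact: nabM. Qed.
Lemma nbarvZ i k l a X : l = i + k ->
  nbarv l (a *: X) = nbar i a *: X + a *: nbarv k X.
Proof. by move=> e; apply/rowP => h; rewrite !mxE; exact: nbarM. Qed.

Lemma nab_sum k n (F : 'I_n -> A) : nab k (\sum_i F i) = \sum_i nab k (F i).
Proof. exact: (big_morph _ (nabD k) (nab_0 k)). Qed.
Lemma nbar_sum k n (F : 'I_n -> A) : nbar k (\sum_i F i) = \sum_i nbar k (F i).
Proof. exact: (big_morph _ (nbarD k) (nbar_0 k)). Qed.

Lemma nab_dot i k l X Y : l = i + k ->
  nab l (dot X Y) = dot (nabv i X) Y + dot X (nabv k Y).
Proof.
move=> e; rewrite nab_sum -big_split /=; apply: eq_bigr => h _.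
by rewrite !mxE; exact: nabM.
Qed.
Lemma nbar_dot i k l X Y : l = i + k ->
  nbar l (dot X Y) = dot (nbarv i X) Y + dot X (nbarv k Y).
Proof.
move=> e; rewrite nbar_sum -big_split /=; apply: eq_bigr => h _.
by rewrite !mxE; exact: nbarM.
Qed.

Lemma cj_nab k a : cj (nab k a) = nbar (- k) (cj a).
Proof. by rewrite /nab /nbar rmorphD cj_der !rmorphM rmorph_int mulrNz; ring. Qed.
Lemma cj_nbar k a : cj (nbar k a) = nab (- k) (cj a).
Proof.
by rewrite /nab /nbar rmorphB cj_cjder !rmorphM rmorph_int cjK mulrNz; ring.
Qed.
Lemma cj_nabv k X : (nabv k X)^c = nbarv (- k) X^c.
Proof. by apply/rowP => i; rewrite !mxE cj_nab. Qed.
Lemma cj_nbarv k X : (nbarv k X)^c = nabv (- k) X^c.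
Proof. by apply/rowP => i; rewrite !mxE cj_nbar. Qed.
Lemma cj_dot (X Y : 'rV[A]_m) : cj (dot X Y) = dot X^c Y^c.
Proof. by rewrite rmorph_sum; apply: eq_bigr => i _; rewrite rmorphM !mxE. Qed.
Lemma cjvK (X : 'rV[A]_m) : X^c^c = X.
Proof. by apply/rowP => i; rewrite !mxE cjK. Qed.
Lemma cjvD (X Y : 'rV[A]_m) : (X + Y)^c = X^c + Y^c.
Proof. exact: map_mxD. Qed.
Lemma cjvZ a (X : 'rV[A]_m) : (a *: X)^c = cj a *: X^c.
Proof. exact: map_mxZ. Qed.
Lemma cjvN (X : 'rV[A]_m) : (- X)^c = - X^c.
Proof. exact: map_mxN. Qed.

(** The Ricci identity: commuting the two covariant derivatives on weight [k] costs [k] times the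
    curvature. The inner derivatives move the weight to [k + 1] and [k - 1], hence [l] and [l']. *)
Lemma nbar_nab k l l' a : l = k + 1 -> l' = k - 1 ->
  nbar l (nab k a) = nab l' (nbar k a) + k%:~R * curv * a.
Proof.
move=> -> ->; rewrite /nab /nbar /curv.
have Dint h : D (h%:~R) = 0.
  by case: h => n; rewrite ?NegzE ?mulrNz ?derN der_nat ?oppr0.
have Eint h : E (h%:~R) = 0 by rewrite /cjder rmorph_int Dint rmorph0.
rewrite !(derD, derN, derM, cjderD, cjderN, cjderM) der_comm Dint Eint.
rewrite !intrD mulrNz mulr1z; ring.
Qed.
Lemma nbarv_nabv k l l' X : l = k + 1 -> l' = k - 1 ->
  nbarv l (nabv k X) = nabv l' (nbarv k X) + (k%:~R * curv) *: X.
Proof. by move=> e e'; apply/rowP => i; rewrite !mxE; exact: nbar_nab. Qed.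

Local Notation z := (map_mx D f).
(* [z] is a (1,0)-vector of the surface, and [hess] is the (2,0)-part of its
   second fundamental form, so that [hsq] is S/2. *)
Definition hess := nabv 1 z.
Local Notation H := hess.
Definition hsq := dot H H^c.
Local Notation u := hsq.

Hypothesis f_real : f^c = f.
Hypothesis ff : dot f f = 1.
Hypothesis zz : dot z z = 0.
Hypothesis zzb : dot z z^c = 1.
(** Minimality: [E z] has no normal part. The component [- f] is due to the sphere. *)
Hypothesis f_minimal : map_mx E z = - f + rb *: z.

Lemma nbar_z : nbarv 1 z = - f.
Proof.
have -> : nbarv 1 z = map_mx E z - rb *: z.
  by apply/rowP => i; rewrite !mxE /nbar mulr1z mul1r.
by rewrite f_minimal addrK.
Qed.

Lemma nab_zb : nabv (-1) z^c = - f.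
Proof. by rewrite -cj_nbarv nbar_z cjvN f_real. Qed.

Lemma fz : dot f z = 0.
Proof.
have := @nab_dot 0 0 0 f f erefl; rewrite ff nab0 der1 nabv0 (dotC z f) => h.
by apply: two_reg; rewrite -h.
Qed.

Lemma Hf : dot H f = 0.
Proof.
have := @nab_dot 1 0 1 z f erefl.
by rewrite (dotC z f) fz nab_0 nabv0 zz addr0 => <-.
Qed.

Lemma Hz : dot H z = 0.
Proof.
have := @nab_dot 1 1 2 z z erefl; rewrite zz nab_0 (dotC z) => h.
by apply: two_reg; rewrite -h.
Qed.

Lemma Hzb : dot H z^c = 0.
Proof.
have := @nab_dot 1 (-1) 0 z z^c erefl.
by rewrite zzb nab0 der1 nab_zb dotNr (dotC z f) fz oppr0 addr0 => <-.
Qed.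

Lemma cj_hsq : cj u = u.
Proof. by rewrite cj_dot cjvK dotC. Qed.

Lemma nbarH_curv : nbarv 2 H = (curv - 1) *: z.
Proof.
rewrite (@nbarv_nabv 1 2 0) // nbar_z nabvN nabv0 mulr1z mul1r.
by rewrite [RHS]scalerBl scale1r addrC.
Qed.

(** Differentiating [dot H z^c = 0] compares the curvature in [nbarH_curv] with [dot H H^c]. *)
Lemma gauss : curv = 1 - u.
Proof.
have := @nbar_dot 2 (-1) 1 H z^c erefl.
rewrite Hzb nbar_0 nbarH_curv dotZl zzb mulr1 -(cj_nabv 1) => h.
by rewrite -[LHS]subr0 h /hsq /hess; ring.
Qed.

(** The Codazzi equation: as a normal section [H] is holomorphic, and only a tangential term
    remains. *)
Lemma nbarH : nbarv 2 H = - (u *: z).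
Proof. by rewrite nbarH_curv gauss addrAC subrr add0r scaleNr. Qed.

Lemma nab_Hb : nabv (-2) H^c = - (u *: z^c).
Proof. by rewrite -cj_nbarv nbarH cjvN cjvZ cj_hsq. Qed.

Lemma nab_u : D u = dot (nabv 2 H) H^c.
Proof.
by rewrite -nab0 (@nab_dot 2 (-2) 0) // nab_Hb dotNr dotZr Hzb mulr0 subr0.
Qed.

Variable j : A.
Hypothesis uj : u * j = 1.

Definition dlogu := j * D u.
Local Notation y := dlogu.
(** Division by [u] makes [dot eta H^c] constant. Since the derivative of [H^c] in [nab_Hb] is
    tangential, the derivative [xi] of [eta] is orthogonal to [H], which is [xi_Hb]. *)
Definition eta := j *: H.
Definition xi := nabv 2 eta.
Definition zeta := nabv 3 xi.
Definition chi := nabv 4 zeta.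
Definition xsq := dot xi xi^c.
Definition vv := u * xsq.
Definition gg := u * dot zeta zeta^c.
Local Notation v := vv.
Local Notation g := gg.

Lemma cj_j : cj j = j.
Proof.
have h : u * cj j = 1 by rewrite -cj_hsq -rmorphM uj rmorph1.
by rewrite -[LHS]mul1r -uj (mulrC u) -mulrA h mulr1.
Qed.

Lemma der_u : D u = u * y. Proof. by rewrite /dlogu mulrA uj mul1r. Qed.

Lemma der_j : D j = - (j * y).
Proof.
have : D (u * j) = 0 by rewrite uj der1.
rewrite derM => /(congr1 ( *%R j)); rewrite mulr0 mulrDr [j * (u * _)]mulrA.
rewrite (mulrC j u) uj mul1r => /eqP; rewrite addrC addr_eq0 => /eqP ->.
by rewrite /dlogu; ring.
Qed.

Lemma cj_y : cj y = j * E u.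
Proof. by rewrite rmorphM cj_j cj_der cj_hsq. Qed.

Lemma cjder_u : E u = u * cj y.
Proof. by rewrite -[E u]mul1r -uj cj_y mulrA. Qed.

Lemma cjder_j : E j = - (j * cj y).
Proof. by rewrite -[j in LHS]cj_j -cj_der der_j rmorphN rmorphM cj_j. Qed.

Lemma xiE : xi = j *: nabv 2 H - (j * y) *: H.
Proof. by rewrite /xi (@nabvZ 0 2) // nab0 der_j scaleNr addrC. Qed.

Lemma sigmaE : nabv 2 H = u *: xi + y *: H.
Proof.
rewrite xiE scalerBr !scalerA uj scale1r.
by rewrite [u * _]mulrA uj mul1r subrK.
Qed.

Lemma xi_Hb : dot xi H^c = 0.
Proof. by rewrite xiE !dotE -nab_u der_u -/hsq; ring. Qed.

Lemma xi_etab : dot xi eta^c = 0.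
Proof. by rewrite cjvZ dotZr xi_Hb mulr0. Qed.

Lemma sigma_zb : dot (nabv 2 H) z^c = 0.
Proof.
have := @nab_dot 2 (-1) 1 H z^c erefl.
by rewrite Hzb nab_0 nab_zb dotNr Hf oppr0 addr0 => <-.
Qed.

Lemma xi_zb : dot xi z^c = 0.
Proof. by rewrite xiE !dotE sigma_zb Hzb !mulr0 subrr. Qed.

Lemma nbar_eta : nbarv 2 eta = - (j * cj y) *: H - z.
Proof.
by rewrite (@nbarvZ 0 2) // nbar0 cjder_j nbarH scalerN scalerA (mulrC j u) uj scale1r.
Qed.

(** The Ricci identity for [eta] yields the [xi] component at once. The coefficient of [H] contains
    the unknown derivative of [cj y]; it is kept as [c] and computed a second time in [nbar_xi]. *)
Lemma nbar_xi_subproof : exists c, nbarv 3 xi = c *: H - cj y *: xi /\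
  c = - nab (-1) (j * cj y) - j * y * cj y - 1 + 2 * j * (1 - u).
Proof.
exists (- nab (-1) (j * cj y) - j * y * cj y - 1 + 2 * j * (1 - u)); split=> //.
rewrite [in LHS]/xi (@nbarv_nabv 2 3 1) // nbar_eta nabvD nabvN -/hess.
rewrite (@nabvZ (-1) 2 1) // nabN sigmaE gauss /eta.
move: (nab (-1) (j * cj y)) => w; rewrite -/hess.
have E1 : - (j * cj y) * u = - cj y by rewrite -[RHS]mulr1 -uj; ring.
rewrite scalerDr !scalerA E1.
move: xi H => a b; apply/rowP => i; rewrite !mxE; ring.
Qed.

(** Differentiating [dot xi H^c = 0] shows that the coefficient of [H] left open before is
    [- v j]. *)
Lemma nbar_xi : nbarv 3 xi = - (cj y *: xi) - v *: eta.
Proof.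
have [c [E _]] := nbar_xi_subproof.
have := @nbar_dot 3 (-2) 1 xi H^c erefl; rewrite xi_Hb nbar_0.
rewrite E -(cj_nabv 2) sigmaE cjvD !cjvZ cj_hsq !dotE xi_Hb !mulr0 addr0 subr0.
rewrite -/hsq -/xsq => h.
have ce : c = - (v * j).
  transitivity (c * (u * j)); first by rewrite uj mulr1.
  transitivity (j * (c * u + u * xsq) - v * j); first by rewrite /vv; ring.
  by rewrite -h mulr0 sub0r.
by rewrite ce /eta scalerA scaleNr addrC.
Qed.

(** Obtained by equating the two values of the coefficient of [H]. As [y] is [D log u], this is the
    conjugate of the formula for [L log u]. *)
Lemma nab_cj_y : nab (-1) (cj y) = v - 3 * u + 2.
Proof.
have [c [E ce]] := nbar_xi_subproof.
have : (c + v * j) *: H = 0.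
  move: E; rewrite nbar_xi /eta scalerA scalerDl => E.
  by rewrite -[c *: H](subrK (cj y *: xi)) -E -addrA -opprD addNr.
move=> /(congr1 (fun X => dot X H^c)); rewrite dotZl dot0l -/hsq.
rewrite ce (@nabM 0 (-1)) // nab0 der_j => h.
have -> : nab (-1) (cj y) = u * j * nab (-1) (cj y) by rewrite uj mul1r.
rewrite -[RHS]subr0 -h.
have -> : v - 3 * u + 2 = v * (u * j) - u - 2 * u * (u * j) + 2 * (u * j).
  by rewrite uj; ring.
by ring.
Qed.

Lemma cj_v : cj v = v.
Proof. by rewrite rmorphM cj_hsq cj_dot cjvK dotC. Qed.

Lemma nbar_y : nbar 1 y = v - 3 * u + 2.
Proof.
rewrite -[LHS]cjK cj_nbar nab_cj_y.
by rewrite rmorphD rmorphB cj_v rmorphM cj_hsq !rmorph_nat.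
Qed.

Theorem lap_hsq : lap u = u * (y * cj y + v - 3 * u + 2).
Proof.
by rewrite lapE der_u (@nbarM 0 1) // nbar0 cjder_u nbar_y; ring.
Qed.

Lemma nab_xib : nabv (-3) xi^c = - (y *: xi^c) - v *: eta^c.
Proof. by rewrite -cj_nbarv nbar_xi cjvD !cjvN !cjvZ cjK cj_v. Qed.

Lemma nbar_xib : nbarv (-3) xi^c = zeta^c.
Proof. by rewrite -cj_nabv. Qed.

Lemma zeta_Hb : dot zeta H^c = 0.
Proof.
have := @nab_dot 3 (-2) 1 xi H^c erefl.
by rewrite xi_Hb nab_0 nab_Hb dotNr dotZr xi_zb mulr0 subr0 => <-.
Qed.

Lemma zeta_etab : dot zeta eta^c = 0.
Proof. by rewrite cjvZ dotZr zeta_Hb mulr0. Qed.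

Lemma H_xib : dot H xi^c = 0.
Proof. by rewrite -[LHS]cjK cj_dot cjvK dotC xi_Hb rmorph0. Qed.

Lemma H_zetab : dot H zeta^c = 0.
Proof. by rewrite -[LHS]cjK cj_dot cjvK dotC zeta_Hb rmorph0. Qed.

Lemma cj_xsq : cj xsq = xsq.
Proof. by rewrite cj_dot cjvK dotC. Qed.

Lemma der_xsq : D xsq = dot zeta xi^c - y * xsq.
Proof.
by rewrite -nab0 (@nab_dot 3 (-3) 0) // nab_xib !dotE xi_etab mulr0 subr0.
Qed.

(** The factor [u] in [v] is there to cancel the term in [y] of [der_xsq]. *)
Lemma der_v : D v = u * dot zeta xi^c.
Proof. by rewrite derM der_u der_xsq /xsq; ring. Qed.

Lemma cjder_v : E v = u * dot xi zeta^c.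
Proof. by rewrite -[in LHS]cj_v -cj_der der_v rmorphM cj_hsq cj_dot cjvK dotC. Qed.

(** The Ricci identity at weight 3: [1 - 2 v] is [3 (1 - u)] from the curvature, minus [v - 3 u + 2]
    from the derivative of [cj y], minus [v] from the term in [eta]. *)
Lemma nbar_zeta :
  nbarv 4 zeta = (1 - 2 * v) *: xi - cj y *: zeta - D v *: eta.
Proof.
rewrite [in LHS]/zeta (@nbarv_nabv 3 4 2) // nbar_xi nabvD !nabvN.
rewrite (@nabvZ (-1) 3 2) // (@nabvZ 0 2 2) // nab_cj_y nab0 -/zeta -/xi gauss.
by move: xi zeta eta => a b c; apply/rowP => i; rewrite !mxE; ring.
Qed.

Lemma nab_zetab :
  nabv (-4) zeta^c = (1 - 2 * v) *: xi^c - y *: zeta^c - E v *: eta^c.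
Proof.
rewrite -cj_nbarv nbar_zeta !cjvD !cjvN !cjvZ cjK cj_der cj_v.
by rewrite rmorphB rmorphM rmorph1 rmorph_nat cj_v.
Qed.

Theorem lap_v : lap v = (1 - 2 * v) * v + g.
Proof.
rewrite lapE der_v (@nbarM 0 1) // nbar0 cjder_u (@nbar_dot 4 (-3) 1) //.
by rewrite nbar_zeta nbar_xib !dotE H_xib -/xsq /gg /vv; ring.
Qed.

Lemma der_g : D g = u * dot chi zeta^c + (1 - 2 * v) * D v.
Proof.
rewrite der_v derM der_u -[D (dot _ _)]nab0 (@nab_dot 4 (-4) 0) //.
by rewrite nab_zetab !dotE zeta_etab -/chi; ring.
Qed.

(** The same commutation at weight 4: [3 - 3 v - u] is [4 (1 - u)] plus [1 - 2 v] minus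
    [v - 3 u + 2]. *)
Lemma nbar_chi : nbarv 5 chi = (3 - 3 * v - u) *: zeta - (3 * D v) *: xi
  - cj y *: chi - nab 1 (D v) *: eta.
Proof.
rewrite [in LHS]/chi (@nbarv_nabv 4 5 3) // nbar_zeta !nabvD !nabvN.
rewrite (@nabvZ 0 3 3) // (@nabvZ (-1) 4 3) // (@nabvZ 1 2 3) // nab_cj_y.
have -> : nab 0 (1 - 2 * v) = - 2 * D v.
  by rewrite nab0 derD derN derM (der_nat 1) (der_nat 2); ring.
rewrite -/zeta -/xi -/chi gauss.
by move: xi zeta eta chi (nab 1 (D v)) => a b c d e; apply/rowP => i; rewrite !mxE; ring.
Qed.

Theorem lap_g : lap g = u * dot chi chi^c + (4 - 5 * v - u) * g
  - 5 * (D v * E v) + v * (1 - 2 * v) ^+ 2.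
Proof.
rewrite lapE der_g nbarD (@nbarM 0 1) // nbar0 cjder_u (@nbar_dot 5 (-4) 1) //.
rewrite (@nbarM 0 1 1 _ (D v)) // -lapE lap_v nbar0 -(cj_nabv 4) -/chi nbar_chi.
have -> : E (1 - 2 * v) = - 2 * E v.
  by rewrite cjderD cjderN cjderM (cjder_nat 1) (cjder_nat 2); ring.
rewrite !dotE H_zetab cjder_v /gg; ring.
Qed.

(** [|xi|^2] times the hermitian product of the parts of [X] and [Y] orthogonal to [xi]; it vanishes
    if one argument is a multiple of [xi]. *)
Definition gramian X Y := xsq * dot X Y^c - dot X xi^c * dot xi Y^c.
(* The defect in the Cauchy-Schwarz inequality [|Dv|^2 <= g v]. *)
Definition wronsk := u ^+ 3 * (g * v - D v * E v).

Lemma wronskE : wronsk = u ^+ 5 * gramian zeta zeta.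
Proof. by rewrite /wronsk der_v cjder_v /gg /vv /gramian; ring. Qed.

Lemma der_exp a n : D (a ^+ n.+1) = n.+1%:R * a ^+ n * D a.
Proof.
elim: n => [|n IH]; first by rewrite expr1 expr0 mulr1 mul1r.
by rewrite exprS derM IH -[n.+2%:R]natr1 [a ^+ n.+1]exprS; ring.
Qed.

(** The factor [u^5] contributes [5 y], and the terms in [y] of [nab_xib] and [nab_zetab] take away
    [2 y]. The remaining terms, except that in [chi], cancel in the Gram form. *)
Lemma der_wronsk : D wronsk = 3 * y * wronsk + u ^+ 5 * gramian chi zeta.
Proof.
rewrite wronskE derM der_exp der_u /gramian.
have d1 : D (xsq * dot zeta zeta^c - dot zeta xi^c * dot xi zeta^c) =
    D xsq * dot zeta zeta^c + xsq * nab 0 (dot zeta zeta^c)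
    - (nab 1 (dot zeta xi^c) * dot xi zeta^c
       + dot zeta xi^c * nab (-1) (dot xi zeta^c)).
  by rewrite nab0 derD derN (derM xsq) -(@nabM 1 (-1) 0) // nab0.
rewrite d1 der_xsq (@nab_dot 4 (-4) 0) // (@nab_dot 4 (-3) 1) //.
rewrite (@nab_dot 3 (-4) (-1)) // nab_zetab nab_xib -/zeta -/chi.
by rewrite !dotE zeta_etab xi_etab -/xsq; ring.
Qed.

Lemma cj_wronsk : cj wronsk = wronsk.
Proof.
have cg : cj g = g by rewrite rmorphM cj_hsq cj_dot cjvK dotC.
rewrite /wronsk rmorphM rmorphXn cj_hsq rmorphB (rmorphM cj g) (rmorphM cj (D v)).
by rewrite cg cj_v cj_der cj_cjder cj_v (mulrC (E v)).
Qed.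

(** The exponent of [u] in [wronsk] is justified here: [3 (v - 3 u + 2)] from [nbar_y] and
    [3 - 3 v - u] from [nbar_chi] add up to [9 - 10 u], free of [v]. *)
Theorem lap_wronsk : lap wronsk = (9 - 10 * u) * wronsk
  + 3 * y * E wronsk + 3 * cj y * (u ^+ 5 * gramian chi zeta)
  + u ^+ 5 * gramian chi chi.
Proof.
rewrite lapE der_wronsk nbarD (@nbarM 1 0) // (@nbarM 0 1 1 3) //.
rewrite nbar_y !nbar0 (@nbarM 0 1 1 (u ^+ 5)) // nbar0.
have -> : E 3 = 0.
  exact: (cjder_nat 3).
have -> : E (u ^+ 5) = 5 * u ^+ 5 * cj y.
  by rewrite /cjder rmorphXn cj_hsq der_exp der_u !rmorphM cj_hsq rmorph_nat; ring.
have -> : nbar 1 (gramian chi zeta) =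
    nbar 0 xsq * dot chi zeta^c + xsq * nbar 1 (dot chi zeta^c)
    - (nbar 2 (dot chi xi^c) * dot xi zeta^c
       + dot chi xi^c * nbar (-1) (dot xi zeta^c)).
  by rewrite nbarD nbarN (@nbarM 0 1 1) // (@nbarM 2 (-1) 1).
rewrite (@nbar_dot 5 (-4) 1) // (@nbar_dot 5 (-3) 2) // (@nbar_dot 3 (-4) (-1)) //.
rewrite nbar_chi nbar_xi -!(cj_nabv 3) -!(cj_nabv 4) -/zeta -/chi.
have -> : nbar 0 xsq = dot xi zeta^c - cj y * xsq.
  rewrite nbar0 -cj_xsq -cj_der der_xsq rmorphB rmorphM cj_dot cjvK (dotC zeta^c).
  by rewrite cj_xsq dotC.
rewrite !dotE H_zetab H_xib -/xsq wronskE /gramian.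
ring.
Qed.
Lemma lapD a b : lap (a + b) = lap a + lap b.
Proof. by rewrite /lap derD cjderD; ring. Qed.

Lemma lapN a : lap (- a) = - lap a.
Proof. by rewrite /lap derN cjderN; ring. Qed.

Lemma lapM a b : lap (a * b) = a * lap b + lap a * b + D a * E b + E a * D b.
Proof. by rewrite /lap !(derD, derM, cjderD, cjderM); ring. Qed.

Lemma lap_natM n a : lap (n%:R * a) = n%:R * lap a.
Proof. by rewrite lapM /lap der_nat cjder_nat /cjder rmorph0 der0 rmorph0; ring. Qed.

Lemma der_uX n : D (u ^+ n.+1) = n.+1%:R * u ^+ n.+1 * y.
Proof. by rewrite der_exp der_u [u ^+ n.+1]exprS; ring. Qed.

Lemma cjder_uX n : E (u ^+ n.+1) = n.+1%:R * u ^+ n.+1 * cj y.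
Proof. by rewrite /cjder rmorphXn cj_hsq der_uX !rmorphM rmorphXn rmorph_nat cj_hsq. Qed.

Lemma lap_uX n :
  lap (u ^+ n.+1) = n.+1%:R * u ^+ n.+1 * (n.+1%:R * (y * cj y) + (v - 3 * u + 2)).
Proof.
rewrite lapE der_uX (@nbarM 0 1 1 _ y) // nbar0 nbar_y cjderM cjder_uX cjder_nat.
by ring.
Qed.

Lemma lap_v_uX n : lap (v * u ^+ n.+1) = u ^+ n.+1 * ((1 - 2 * v) * v + g
  + v * (n.+1%:R ^+ 2 * (y * cj y) + n.+1%:R * (v - 3 * u + 2))
  + n.+1%:R * (D v * cj y + E v * y)).
Proof. by rewrite lapM lap_uX lap_v der_uX cjder_uX; ring. Qed.

(** With the weights 2 and 5 the gradient terms [-10 |D v|^2] and [10 |D v|^2] cancel, and so do the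
    terms in [v g]. *)
Lemma lap_g_sqr_v : lap (2 * g + 5 * v ^+ 2) = 2 * (u * dot chi chi^c)
  + 2 * (4 - u) * g + 2 * v * (1 - 2 * v) ^+ 2 + 10 * v ^+ 2 * (1 - 2 * v).
Proof. by rewrite lapD !lap_natM lap_g expr2 lapM lap_v; ring. Qed.
End null_frame.

(** * The null frame axioms for a frame given in coordinates *)

Section coordinate_frame.
Context {A : comPzRingType} {m : nat}.
Variables (d0 d1 : A -> A) (cj : {rmorphism A -> A}) (A0 A1 dt : A) (f : 'rV[A]_m).
Hypothesis cjK : involutive cj.
Hypothesis d0D : forall a b, d0 (a + b) = d0 a + d0 b.
Hypothesis d0M : forall a b, d0 (a * b) = d0 a * b + a * d0 b.
Hypothesis d1D : forall a b, d1 (a + b) = d1 a + d1 b.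
Hypothesis d1M : forall a b, d1 (a * b) = d1 a * b + a * d1 b.
Hypothesis d01 : forall a, d0 (d1 a) = d1 (d0 a).
Hypothesis cj_d0 : forall a, cj (d0 a) = d0 (cj a).
Hypothesis cj_d1 : forall a, cj (d1 a) = d1 (cj a).
Hypothesis two_reg : forall a : A, a + a = 0 -> a = 0.
Hypothesis det_inv : (A0 * cj A1 - A1 * cj A0) * dt = 1.

Definition field_der a := A0 * d0 a + A1 * d1 a.
Local Notation D := field_der.
Local Notation E := (cjder D cj).
Local Notation "X ^c" := (map_mx cj X).
Local Notation z := (map_mx D f).

Lemma field_derD a b : D (a + b) = D a + D b.
Proof. by rewrite /field_der d0D d1D; ring. Qed.

Lemma field_derM a b : D (a * b) = D a * b + a * D b.
Proof. by rewrite /field_der d0M d1M; ring. Qed.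

Lemma cjfield_derE a : E a = cj A0 * d0 a + cj A1 * d1 a.
Proof. by rewrite /cjder /field_der rmorphD !rmorphM cj_d0 cj_d1 cjK. Qed.

Lemma field_der_row (F : 'rV[A]_m) :
  map_mx D F = A0 *: map_mx d0 F + A1 *: map_mx d1 F.
Proof. by apply/rowP => i; rewrite !mxE. Qed.

Lemma field_der_row_conj (F : 'rV[A]_m) : F^c = F ->
  (map_mx D F)^c = cj A0 *: map_mx d0 F + cj A1 *: map_mx d1 F.
Proof.
move=> Fr; apply/rowP => i; have := congr1 (fun X : 'rV[A]_m => X 0 i) Fr.
by rewrite !mxE => Fi; rewrite /field_der rmorphD !rmorphM cj_d0 cj_d1 Fi.
Qed.

(** [P] and [Q] are uniform in [a] and left unspecified, since the first order part is annihilated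
    by normal vectors. The next lemma is also used at critical points, where this part vanishes. *)
Lemma field_der2E : exists P Q, forall a, D (D a) =
  A0 * A0 * d0 (d0 a) + (A0 * A1 + A0 * A1) * d0 (d1 a) + A1 * A1 * d1 (d1 a)
  + P * d0 a + Q * d1 a.
Proof.
exists (D A0), (D A1) => a.
by rewrite /field_der !(d0D, d1D, d0M, d1M) -d01; ring.
Qed.

Lemma cjfield_der2E : exists P Q, forall a, E (D a) =
  cj A0 * A0 * d0 (d0 a) + (cj A0 * A1 + cj A1 * A0) * d0 (d1 a)
  + cj A1 * A1 * d1 (d1 a) + P * d0 a + Q * d1 a.
Proof.
exists (E A0), (E A1) => a.
by rewrite !cjfield_derE /field_der !(d0D, d1D, d0M, d1M) -d01; ring.
Qed.

(** Cramer's rule, with [dt] the inverse of the determinant of [D] and [E]. *)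
Lemma field_span x0 x1 : exists l n, forall a, x0 * d0 a + x1 * d1 a = l * D a + n * E a.
Proof.
exists ((x0 * cj A1 - x1 * cj A0) * dt), ((x1 * A0 - x0 * A1) * dt) => a.
rewrite cjfield_derE /field_der.
transitivity ((A0 * cj A1 - A1 * cj A0) * dt * (x0 * d0 a + x1 * d1 a)).
  by rewrite det_inv mul1r.
by ring.
Qed.

Hypothesis f_real : f^c = f.
Hypothesis ff : dot f f = 1.
Hypothesis zz : dot z z = 0.
Hypothesis zzb : dot z z^c = 1.
Hypothesis mean0 : exists x y w, map_mx E z = x *: f + y *: z + w *: z^c.

Definition frame_rho := cj (dot (map_mx E z) z^c).

(** By [mean0] there is no normal part. Differentiating [dot z f = 0] and [dot z z = 0] gives the
    components along [f] and [z^c]; the one along [z] defines [frame_rho]. *)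
Lemma coordinate_minimal : map_mx E z = - f + cj frame_rho *: z.
Proof.
have E1 : E 1 = 0 by rewrite /cjder rmorph1 (der1 field_derM) rmorph0.
have fzb : dot f z = 0 by apply: fz => //; [exact: field_derD|exact: field_derM].
have fzb' : dot f z^c = 0.
  by rewrite -[LHS]cjK (cj_dot cj) (cjvK cjK) f_real fzb rmorph0.
have E0 : E 0 = 0 by rewrite /cjder rmorph0 (der0 field_derD) rmorph0.
have Edot X Y : E (dot X Y) = dot (map_mx E X) Y + dot X (map_mx E Y).
  rewrite /dot (big_morph E (cjderD cj field_derD) E0) -big_split /=.
  by apply: eq_bigr => i _; rewrite !mxE (cjderM cjK field_derM).
have Ef : map_mx E f = z^c.
  by rewrite -{1}f_real; apply/rowP => i; rewrite !mxE /cjder cjK.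
have [x [y [w e]]] := mean0.
have h1 : dot (map_mx E z) f = -1.
  apply/eqP; rewrite -addr_eq0 -zzb -Ef -Edot dotC fzb; apply/eqP; exact: E0.
have h2 : dot (map_mx E z) z = 0.
  apply: two_reg; rewrite {2}dotC -Edot zz; exact: E0.
have wz : w = 0.
  by move: h2; rewrite e !dotE fzb zz (dotC z^c) zzb; rewrite !mulr0 !add0r mulr1.
have xz : x = -1.
  move: h1; rewrite e !dotE ff (dotC z) fzb (dotC z^c) fzb'.
  by rewrite !mulr0 !addr0 mulr1.
have yz : y = dot (map_mx E z) z^c.
  by rewrite e wz scale0r addr0 !dotE fzb' zzb mulr0 mulr1 add0r.
by rewrite /frame_rho cjK -yz {1}e wz xz scale0r addr0 scaleN1r.
Qed.

(** The bracket of [D] and [E] is of first order, hence of the form [l D + n E]. Its value on [f] is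
    known from [coordinate_minimal], and the independence of [z] and [z^c] determines [l] and
    [n]. *)
Lemma coordinate_comm a :
  D (E a) = E (D a) + frame_rho * E a - cj frame_rho * D a.
Proof.
have fzb : dot f z = 0 by apply: fz => //; [exact: field_derD|exact: field_derM].
have fzb' : dot f z^c = 0.
  by rewrite -[LHS]cjK (cj_dot cj) (cjvK cjK) f_real fzb rmorph0.
have zbz : dot z^c z = 1 by rewrite dotC.
have zbzb : dot z^c z^c = 0 by rewrite -(cj_dot cj) zz rmorph0.
pose x0 := D (cj A0) - E A0; pose x1 := D (cj A1) - E A1.
have comm b : D (E b) - E (D b) = x0 * d0 b + x1 * d1 b.
  rewrite /x0 /x1 !cjfield_derE /field_der !(d0D, d1D, d0M, d1M) !d01; ring.
have [l [n ln]] := field_span x0 x1.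
have Efb : map_mx E f = z^c.
  by rewrite -{1}f_real; apply/rowP => i; rewrite !mxE /cjder cjK.
have DEf : map_mx D (map_mx E f) = - f + frame_rho *: z^c.
  have := congr1 (map_mx cj) coordinate_minimal.
  rewrite cjvD cjvN cjvZ f_real cjK => <-.
  by rewrite Efb; apply/rowP => i; rewrite !mxE /cjder cjK.
have key : frame_rho *: z^c - cj frame_rho *: z = l *: z + n *: z^c.
  have -> : l *: z + n *: z^c = map_mx D (map_mx E f) - map_mx E (map_mx D f).
    rewrite -Efb; apply/rowP => i; rewrite !mxE.
    by rewrite comm ln.
  by rewrite DEf coordinate_minimal opprD opprK addrACA addNr add0r.
have le : l = - cj frame_rho.
  have := congr1 (fun X : 'rV[A]_m => dot X z^c) key.
  by rewrite !dotE zbzb zzb !mulr0 !mulr1 add0r addr0 => <-.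
have ne : n = frame_rho.
  have := congr1 (fun X : 'rV[A]_m => dot X z) key.
  by rewrite !dotE zz zbz !mulr0 !mulr1 oppr0 add0r addr0 => <-.
by have := ln a; rewrite -comm le ne => /eqP; rewrite subr_eq => /eqP ->; ring.
Qed.
End coordinate_frame.

(** * Change of null frame *)

Section frame_change.
Context {A : comPzRingType} {m : nat}.
Variables (D D' : A -> A) (cj : {rmorphism A -> A}) (r r' mu nu : A) (f : 'rV[A]_m).
Hypothesis cjK : involutive cj.
Hypothesis derD : forall a b, D (a + b) = D a + D b.
Hypothesis derM : forall a b, D (a * b) = D a * b + a * D b.
Hypothesis D'E : forall a, D' a = mu * D a + nu * cjder D cj a.
Hypothesis two_reg : forall a : A, a + a = 0 -> a = 0.
Hypothesis der_comm : forall a,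
  D (cjder D cj a) = cjder D cj (D a) + r * cjder D cj a - cj r * D a.
Local Notation E := (cjder D cj).
Local Notation E' := (cjder D' cj).
Local Notation "X ^c" := (map_mx cj X).
Local Notation z := (map_mx D f).
Local Notation z' := (map_mx D' f).
Hypothesis f_real : f^c = f.
Hypothesis ff : dot f f = 1.
Hypothesis zz : dot z z = 0.
Hypothesis zzb : dot z z^c = 1.
Hypothesis f_minimal : map_mx E z = - f + cj r *: z.
Hypothesis zz' : dot z' z' = 0.
Hypothesis zzb' : dot z' z'^c = 1.
Hypothesis f_minimal' : map_mx E' z' = - f + cj r' *: z'.

Let E'E a : E' a = cj mu * E a + cj nu * D a.
Proof. by rewrite /cjder D'E rmorphD !rmorphM /cjder !cjK. Qed.

Let z'E : z' = mu *: z + nu *: z^c.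
Proof.
have fi i : cj (f 0 i) = f 0 i by have := congr1 (fun X : 'rV[A]_m => X 0 i) f_real; rewrite mxE.
by apply/rowP => i; rewrite !mxE D'E /cjder fi.
Qed.

Let zbz : dot z^c z = 1. Proof. by rewrite dotC. Qed.
Let zbzb : dot z^c z^c = 0. Proof. by rewrite -(cj_dot cj) zz rmorph0. Qed.

(** On one component of an overlap the orientations may agree ([nu = 0]) and on another be opposite
    ([mu = 0]). With zero divisors around, only the product relations are available, and they treat
    both cases together. *)
Let munu : mu * nu = 0.
Proof.
apply: two_reg; rewrite -[RHS]zz' z'E !dotE zz zzb zbz zbzb; ring.
Qed.

Let munu1 : mu * cj mu + nu * cj nu = 1.
Proof.
by rewrite -[RHS]zzb' z'E cjvD !cjvZ (cjvK cjK) !dotE zz zzb zbz zbzb; ring.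
Qed.

Let munub : mu * cj nu = 0.
Proof.
have := congr1 cj munu; rewrite rmorphM rmorph0 => h.
transitivity (mu * cj nu * (mu * cj mu + nu * cj nu)); first by rewrite munu1 mulr1.
transitivity (mu ^+ 2 * (cj mu * cj nu) + cj nu ^+ 2 * (mu * nu)); first by ring.
by rewrite h munu; ring.
Qed.

Let munubc : cj mu * nu = 0.
Proof. by rewrite -[LHS]cjK rmorphM cjK munub rmorph0. Qed.

Lemma frame_change_grad a : D' a * E' a = D a * E a.
Proof.
transitivity ((mu * cj mu + nu * cj nu) * (D a * E a)
  + mu * cj nu * D a ^+ 2 + cj mu * nu * E a ^+ 2).
  by rewrite D'E E'E; ring.
by rewrite munu1 munub munubc; ring.
Qed.

(** The second order parts agree by the relations between [mu] and [nu]. The difference [x D + y E]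
    vanishes because both Laplacians send [f] to [- f] and [z], [z^c] are independent. *)
Lemma frame_change_lap a : lap D' cj r' a = lap D cj r a.
Proof.
have EM := cjderM cjK derM; have ED := cjderD cj derD.
pose x := E' mu + cj nu * nu * - cj r - cj r' * mu + cj r.
pose y := E' nu + cj nu * nu * r - cj r' * nu.
have key b : lap D' cj r' b = lap D cj r b + (x * D b + y * E b).
  rewrite /lap D'E E'E !(EM, ED, derM, derD) der_comm /x /y !E'E.
  transitivity ((mu * cj mu + nu * cj nu) * E (D b) + mu * cj nu * D (D b) + cj mu * nu * E (E b)
  + (cj mu * E mu + cj nu * D mu) * D b + (cj mu * E nu + cj nu * D nu) * E b +
   cj nu * nu * (r * E b - cj r * D b) - cj r' * (mu * D b + nu * E b)); last first.
    by rewrite munub munubc munu1; ring.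
  by ring.
have lapf (D1 : A -> A) r1 : map_mx (cjder D1 cj) (map_mx D1 f) = - f + cj r1 *: map_mx D1 f ->
    forall i, lap D1 cj r1 (f 0 i) = - f 0 i.
  move=> e i; have := congr1 (fun X : 'rV[A]_m => X 0 i) e; rewrite !mxE /lap => ->.
  by rewrite addrK.
have xy : x *: z + y *: z^c = 0.
  apply/rowP => i; have := key (f 0 i).
  rewrite (lapf _ _ f_minimal) (lapf _ _ f_minimal') => h.
  rewrite !mxE; apply: (addrI (- f 0 i)); rewrite addr0 [RHS]h.
  have fi : cj (f 0 i) = f 0 i by have := congr1 (fun X : 'rV[A]_m => X 0 i) f_real; rewrite mxE.
  by congr (_ + (_ + _ * _)); rewrite /cjder fi.
have x0 : x = 0.
  by have := congr1 (fun X : 'rV[A]_m => dot X z^c) xy; rewrite !dotE zzb zbzb dot0l mulr0 addr0 mulr1.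
have y0 : y = 0.
  by have := congr1 (fun X : 'rV[A]_m => dot X z) xy; rewrite !dotE zz zbz dot0l mulr0 add0r mulr1.
by rewrite key x0 y0 !mul0r !addr0.
Qed.

Hypothesis derD' : forall a b, D' (a + b) = D' a + D' b.
Hypothesis derM' : forall a b, D' (a * b) = D' a * b + a * D' b.

(** [H'] is a combination of [H], [H^c], [z] and [z^c]; orthogonality to [z'] and its conjugate
    removes the tangential part, and the product relations give equal norms. *)
Lemma frame_change_hsq : hsq D' cj r' f = hsq D cj r f.
Proof.
have Hz0 := Hz r derD derM two_reg zz.
have Hzb0 := Hzb cjK derD derM two_reg f_real ff zzb f_minimal.
have Hz0' := Hz r' derD' derM' two_reg zz'.
have Hzb0' := Hzb cjK derD' derM' two_reg f_real ff zzb' f_minimal'.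
rewrite /hsq; set H := hess D r f in Hz0 Hzb0 *; set H' := hess D' r' f in Hz0' Hzb0' *.
have Hcz : dot H^c z = 0 by rewrite -[LHS]cjK (cj_dot cj) (cjvK cjK) Hzb0 rmorph0.
have Hczc : dot H^c z^c = 0 by rewrite -(cj_dot cj) Hz0 rmorph0.
have [a [b H'E]] : exists a b, H' = mu ^+ 2 *: H + nu ^+ 2 *: H^c + a *: z + b *: z^c.
  exists (D' mu - r * mu ^+ 2 + r' * mu).
  exists (D' nu - cj r * nu ^+ 2 + r' * nu).
  apply/rowP => i.
  have fi : cj (f 0 i) = f 0 i by have := congr1 (fun X : 'rV[A]_m => X 0 i) f_real; rewrite mxE.
  rewrite /H' /hess !mxE /nab !mulr1z !mul1r.
  rewrite rmorphD rmorphM (D'E (f 0 i)).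
  rewrite derD' !derM' !D'E /cjder fi !cjK.
  set F := f 0 i.
  transitivity (D' mu * D F + D' nu * cj (D F) + mu ^+ 2 * D (D F)
     + nu ^+ 2 * cj (D (D F)) + mu * nu * (cj (D (cj (D F))) + D (cj (D F)))
     + r' * (mu * D F + nu * cj (D F))).
    by rewrite !D'E /cjder; ring.
  by rewrite munu !D'E /cjder; ring.
have e1 : a * nu + b * mu = 0.
  have := Hz0'; rewrite H'E z'E !dotE Hz0 Hzb0 Hcz Hczc zz zzb zbz zbzb => <-.
  by ring.
have e2 : a * cj mu + b * cj nu = 0.
  have := Hzb0'; rewrite H'E z'E cjvD !cjvZ (cjvK cjK) !dotE Hz0 Hzb0 Hcz Hczc.
  by rewrite zz zzb zbz zbzb => <-; ring.
have a0 : a = 0.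
  transitivity (a * (mu * cj mu + nu * cj nu)); first by rewrite munu1 mulr1.
  transitivity (mu * (a * cj mu + b * cj nu) + cj nu * (a * nu + b * mu)
     - (b + b) * (mu * cj nu)); first by ring.
  by rewrite e1 e2 munub; ring.
have b0 : b = 0.
  transitivity (b * (mu * cj mu + nu * cj nu)); first by rewrite munu1 mulr1.
  transitivity (nu * (a * cj mu + b * cj nu) + cj mu * (a * nu + b * mu)
     - (a + a) * (cj mu * nu)); first by ring.
  by rewrite e1 e2 munubc; ring.
rewrite H'E a0 b0 !scale0r !addr0 cjvD !cjvZ (cjvK cjK) !dotE (dotC H^c H).
transitivity ((mu * cj mu + nu * cj nu) ^+ 2 * dot H H^c - 2 * (mu * nu) * (cj mu * cj nu) * dot H H^c
  + (mu * cj nu) ^+ 2 * dot H H + (cj mu * nu) ^+ 2 * dot H^c H^c).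
  by rewrite !rmorphXn; ring.
by rewrite munu1 munu munub munubc; ring.
Qed.
End frame_change.

(** * Smooth functions on a surface *)

Section smooth_functions.
Context {R : realType} {M : riemannianManifold R 2}.
Implicit Types (W : set M) (a b : M -> R) (c d : chart R 2 M).

Definition smooth_map_on W a := forall c, atlas c ->
  smooth_on (Defs.coord c @` (dom c `&` W)) (a \o param c).

Lemma open_coord_image c W : open W -> open (Defs.coord c @` (dom c `&` W)).
Proof.
move=> oW; rewrite openE => x [p [dp Wp] <-].
have px : (Defs.coord c @` dom c) (Defs.coord c p) by exists p.
have n1 := open_nbhs_nbhs (conj (@codom_open _ _ _ c) px).
have pK : param c (Defs.coord c p) = p by rewrite coordK // inE.
have n2 : nbhs (Defs.coord c p) (param c @^-1` W).
  apply: param_continuous; first by rewrite inE.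
  by rewrite pK; exact: open_nbhs_nbhs.
apply: (@filterS _ _ (nbhs_filter _) _ _ _ (@filterI _ _ (nbhs_filter _) _ _ n1 n2)).
move=> y [[q dq <-]] /=; rewrite coordK ?inE // => Wq.
by exists q.
Qed.

Lemma paramK c p : dom c p -> param c (Defs.coord c p) = p.
Proof. by move=> dp; rewrite coordK // inE. Qed.

Lemma smooth_map_on_subset W W' a : W' `<=` W ->
  smooth_map_on W a -> smooth_map_on W' a.
Proof.
move=> sub sa c ac k; apply: Ck_on_subset (sa c ac k).
by move=> _ [p [dp Wp] <-]; exists p => //; split => //; exact: sub.
Qed.

Lemma eq_smooth_map_on W a b : open W -> (forall p, W p -> a p = b p) ->
  smooth_map_on W a -> smooth_map_on W b.
Proof.
move=> oW ab sa c ac k; apply: eq_Ck_on (sa c ac k); first exact: open_coord_image.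
by move=> x /[!inE] -[p [dp Wp] <-] /=; rewrite paramK // ab.
Qed.

Lemma smooth_map_on_cst W (k : R) : smooth_map_on W (cst k).
Proof. by move=> c ac n; exact: Ck_on_cst. Qed.

Lemma smooth_map_onD W a b : open W -> smooth_map_on W a ->
  smooth_map_on W b -> smooth_map_on W (fun p => a p + b p).
Proof.
by move=> oW sa sb c ac k; apply: Ck_onD (sa c ac k) (sb c ac k); exact: open_coord_image.
Qed.

Lemma smooth_map_onN W a : open W -> smooth_map_on W a ->
  smooth_map_on W (fun p => - a p).
Proof.
by move=> oW sa c ac k; apply: Ck_onN (sa c ac k); exact: open_coord_image.
Qed.

Lemma smooth_map_onM W a b : open W -> smooth_map_on W a ->
  smooth_map_on W b -> smooth_map_on W (fun p => a p * b p).
Proof.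
by move=> oW sa sb c ac k; apply: Ck_onM (sa c ac k) (sb c ac k); exact: open_coord_image.
Qed.

Lemma smooth_map_onV W a : open W -> (forall p, W p -> a p != 0) ->
  smooth_map_on W a -> smooth_map_on W (fun p => (a p)^-1).
Proof.
move=> oW a0 sa c ac k; apply: Ck_onV (sa c ac k); first exact: open_coord_image.
by move=> _ [p [dp Wp] <-] /=; rewrite paramK // a0.
Qed.

Lemma smooth_map_on_sqrt W a : open W -> (forall p, W p -> 0 < a p) ->
  smooth_map_on W a -> smooth_map_on W (fun p => Num.sqrt (a p)).
Proof.
move=> oW a0 sa c ac k; apply: Ck_on_sqrt (sa c ac k); first exact: open_coord_image.
by move=> _ [p [dp Wp] <-] /=; rewrite paramK // a0.
Qed.

(** The smooth changes of charts carry smoothness from one chart containing [W] to all the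
    others. *)
Lemma smooth_map_on_chart W c a : open W -> atlas c -> W `<=` dom c ->
  smooth_on (Defs.coord c @` W) (a \o param c) -> smooth_map_on W a.
Proof.
move=> oW ac Wc sa d ad k.
have IWc := setIidr Wc.
have oU : open (Defs.coord c @` W) by rewrite -IWc; exact: open_coord_image.
have oU' : open (Defs.coord d @` (dom d `&` W)) by exact: open_coord_image.
have H : Ck_on k (Defs.coord d @` (dom d `&` W)) ((a \o param c) \o (Defs.coord c \o param d)).
  apply: (Ck_on_comp oU oU' _ _ (sa k)).
    by move=> _ [p [dp Wp] <-] /=; rewrite paramK //; exists p.
  apply: Ck_on_subset (atlas_compatible ad ac k).
  by move=> _ [p [dp Wp] <-]; exists p => //; split => //; exact: Wc.
apply: eq_Ck_on H => // x /[!inE] -[p [dp Wp] <-] /=.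
by rewrite !paramK //; exact: Wc.
Qed.

Lemma smooth_map_on_continuous W a p : open W -> smooth_map_on W a -> W p ->
  {for p, continuous a}.
Proof.
move=> oW sa Wp; have [c ac dp] := atlas_cover p.
have cont : {for p, continuous ((a \o param c) \o Defs.coord c)}.
  apply: continuous_comp; first by apply: Defs.coord_continuous; rewrite inE.
  by apply: (sa c ac 0%N); rewrite inE; exists p.
rewrite /prop_for /continuous_at.
have E : (a \o param c \o Defs.coord c) p = a p by rewrite /= paramK.
rewrite -E; apply: cvg_trans cont; apply: near_eq_cvg.
have N := open_nbhs_nbhs (conj (@dom_open _ _ _ c) dp).
by apply: filterS N => q dq; rewrite /= paramK.
Qed.

(** With the value 0 off [W], and [W] open, the result depends only on the restriction of [a] to
    [W]. *)
Definition pderR W c (v : 'rV[R]_2) a p : R :=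
  if p \in W then 'D_v (a \o param c) (Defs.coord c p) else 0.

Lemma smooth_pderR W c v a : open W -> atlas c -> W `<=` dom c ->
  smooth_map_on W a -> smooth_map_on W (pderR W c v a).
Proof.
move=> oW ac Wc sa; apply: (smooth_map_on_chart oW ac Wc) => k.
have IWc := setIidr Wc.
have oU : open (Defs.coord c @` W) by rewrite -IWc; exact: open_coord_image.
have := sa c ac k.+1; rewrite IWc => -[_ /(_ v)[_]]; apply: eq_Ck_on => //.
move=> x /[!inE] -[p Wp <-] /=; rewrite /pderR paramK ?mem_set //; exact: Wc.
Qed.

Lemma pderRE W c v a p : W p -> pderR W c v a p = 'D_v (a \o param c) (Defs.coord c p).
Proof. by move=> Wp; rewrite /pderR mem_set. Qed.

Lemma pderR_out W c v a p : ~ W p -> pderR W c v a p = 0.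
Proof. by move=> nWp; rewrite /pderR memNset. Qed.

Lemma smooth_derivable W c v a p : open W -> atlas c -> W `<=` dom c ->
  smooth_map_on W a -> W p -> derivable (a \o param c) (Defs.coord c p) v.
Proof.
move=> oW ac Wc sa Wp; have [_ /(_ v)[+ _]] := sa c ac 1%N.
by apply; rewrite inE; exists p => //; split => //; exact: Wc.
Qed.

Lemma pderR_eq W c v a b p : open W -> W `<=` dom c -> (forall q, W q -> a q = b q) ->
  pderR W c v a p = pderR W c v b p.
Proof.
move=> oW Wc ab; rewrite /pderR; case: ifPn => // /set_mem Wp.
have IWc := setIidr Wc.
apply: (@eq_on_derive _ _ _ (Defs.coord c @` W)).
- by rewrite -IWc; exact: open_coord_image.
- by move=> x /[!inE] -[q Wq <-] /=; rewrite paramK ?ab //; exact: Wc.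
- by rewrite inE; exists p.
Qed.

Lemma pderRD W c v a b : open W -> atlas c -> W `<=` dom c ->
  smooth_map_on W a -> smooth_map_on W b ->
  pderR W c v (fun p => a p + b p) = fun p => pderR W c v a p + pderR W c v b p.
Proof.
move=> oW ac Wc sa sb; apply/funext => p; rewrite /pderR.
case: ifPn => [/set_mem Wp|_]; last by rewrite addr0.
by rewrite -deriveD //; exact: smooth_derivable Wp.
Qed.

Lemma pderRN W c v a : open W -> atlas c -> W `<=` dom c ->
  smooth_map_on W a ->
  pderR W c v (fun p => - a p) = fun p => - pderR W c v a p.
Proof.
move=> oW ac Wc sa; apply/funext => p; rewrite /pderR.
case: ifPn => [/set_mem Wp|_]; last by rewrite oppr0.
by rewrite -deriveN //; exact: smooth_derivable Wp.
Qed.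

Lemma pderRM W c v a b : open W -> atlas c -> W `<=` dom c ->
  smooth_map_on W a -> smooth_map_on W b ->
  pderR W c v (fun p => a p * b p) =
  fun p => pderR W c v a p * b p + a p * pderR W c v b p.
Proof.
move=> oW ac Wc sa sb; apply/funext => p; rewrite /pderR.
case: ifPn => [/set_mem Wp|_]; last by rewrite mul0r mulr0 addr0.
transitivity ('D_v ((a \o param c) * (b \o param c)) (Defs.coord c p)) => //.
rewrite deriveM; try exact: smooth_derivable Wp.
have pp : param c (Defs.coord c p) = p by apply: paramK; exact: Wc.
by rewrite /= pp addrC [X in _ + X]mulrC; congr (_ + _); rewrite mulrC.
Qed.

Lemma pderRC W c v w a : open W -> atlas c -> W `<=` dom c ->
  smooth_map_on W a ->
  pderR W c v (pderR W c w a) = pderR W c w (pderR W c v a).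
Proof.
move=> oW ac Wc sa; apply/funext => p.
have [Wp|nWp] := pselect (W p); last by rewrite !pderR_out.
have IWc := setIidr Wc.
have oU : open (Defs.coord c @` W) by rewrite -IWc; exact: open_coord_image.
have xU : Defs.coord c p \in Defs.coord c @` W by rewrite inE; exists p.
have E u u' : pderR W c u (pderR W c u' a) p =
    'D_u ('D_u' (a \o param c)) (Defs.coord c p).
  rewrite (pderRE _ _ _ Wp); apply: (eq_on_derive _ oU) => // x.
  by rewrite inE => -[q Wq <-]; rewrite /= (paramK (Wc _ Wq)) (pderRE _ _ _ Wq).
rewrite !E; apply: (derive_swap _ _ oU); last by exists p.
by have := sa c ac 2%N; rewrite IWc.
Qed.

Lemma pderR_change W c d v a p : open W -> atlas c -> atlas d ->
  W `<=` dom c -> W `<=` dom d -> smooth_map_on W a ->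
  pderR W d v a p =
    pderR W d v (fun q => Defs.coord c q 0 0) p * pderR W c ev0 a p +
    pderR W d v (fun q => Defs.coord c q 0 1) p * pderR W c ev1 a p.
Proof.
move=> oW ac ad Wc Wd sa; rewrite /pderR.
case: ifPn => [/set_mem Wp|_]; last by rewrite !mul0r addr0.
have IWc := setIidr Wc.
have IWd := setIidr Wd.
have oU : open (Defs.coord c @` W) by rewrite -IWc; exact: open_coord_image.
have oU' : open (Defs.coord d @` W) by rewrite -IWd; exact: open_coord_image.
pose T := Defs.coord c \o param d.
have Tp : T (Defs.coord d p) = Defs.coord c p by rewrite /T /= paramK //; exact: Wd.
have CT : Ck_on 1 (Defs.coord d @` W) T.
  apply: Ck_on_subset (atlas_compatible ad ac 1%N).
  by move=> _ [q Wq <-]; exists q => //; split; [exact: Wd|exact: Wc].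
have Ca : Ck_on 1 (Defs.coord c @` W) (a \o param c) by have := sa c ac 1%N; rewrite IWc.
have UT : (Defs.coord c @` W) (T (Defs.coord d p)) by rewrite Tp; exists p.
have dT i : derivable (fun z => T z 0 i) (Defs.coord d p) v.
  have [_ /(_ v)[+ _]] := CT => dCT.
  by apply: ((derivable_mxP _ _ _).1 (dCT _ _)); rewrite inE; exists p.
have [_] := C1_derive_comp oU Ca UT dT; rewrite Tp => <-.
apply: (@eq_on_derive _ _ _ (Defs.coord d @` W)) => //; last by rewrite inE; exists p.
move=> x /[!inE] -[q Wq <-] /=.
by rewrite /T /= (paramK (Wd _ Wq)) (paramK (Wc _ Wq)).
Qed.

Lemma smooth_coord W c i : open W -> atlas c -> W `<=` dom c ->
  smooth_map_on W (fun q => Defs.coord c q 0 i).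
Proof.
move=> oW ac Wc d ad k.
have oU' : open (Defs.coord d @` (dom d `&` W)) by exact: open_coord_image.
apply: (@Ck_on_coord _ _ _ _ k _ (Defs.coord c \o param d)) => //.
apply: Ck_on_subset (atlas_compatible ad ac k).
by move=> _ [q [dq Wq] <-]; exists q => //; split => //; exact: Wc.
Qed.

End smooth_functions.

(** Openness is bundled with the set, so that the ring structure on [sfun] depends on a single
    parameter. *)
Record opens (T : topologicalType) := Opens { oset :> set T; osetP : open oset }.

(** * The ring of smooth complex functions on an open set, with its conjugation and derivations *)

Section smooth_ring.
Context {R : realType} {M : riemannianManifold R 2}.
Variable W0 : opens M.
Local Notation W := (oset W0).
Local Notation C := R[i].
Local Open Scope complex_scope.

(* Extension by zero makes equality in [sfun] the same as equality on [W]. *)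
Record sfun := Sfun {
  sfun_val :> M -> C;
  sfun_re : smooth_map_on W (fun p => complex.Re (sfun_val p));
  sfun_im : smooth_map_on W (fun p => complex.Im (sfun_val p));
  sfun_out : forall p, ~ W p -> sfun_val p = 0 }.

Lemma sfunP (a b : sfun) : (forall p, W p -> a p = b p) -> a = b.
Proof.
move=> ab; have e : sfun_val a = sfun_val b.
  apply/funext => p; have [Wp|nWp] := pselect (W p); first exact: ab.
  by rewrite !sfun_out.
case: a b e {ab} => [a ? ? ?] [b ? ? ?] /= e; subst b.
by congr Sfun; exact: Prop_irrelevance.
Qed.

HB.instance Definition _ := gen_eqMixin sfun.
HB.instance Definition _ := gen_choiceMixin sfun.

Definition sfun_of (a b : M -> R) (sa : smooth_map_on W a) (sb : smooth_map_on W b) :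
  sfun.
Proof.
apply: (@Sfun (fun p => if p \in W then a p +i* b p else 0)) => [||p nWp]; last 1 first.
- by rewrite memNset.
- by apply: eq_smooth_map_on (osetP W0) _ sa => p Wp; rewrite mem_set.
- by apply: eq_smooth_map_on (osetP W0) _ sb => p Wp; rewrite mem_set.
Defined.

Lemma sfun_ofE a b (sa : smooth_map_on W a) (sb : smooth_map_on W b) p :
  W p -> sfun_of sa sb p = a p +i* b p.
Proof. by move=> Wp; rewrite /= mem_set. Qed.

Definition sfun_zero := sfun_of (smooth_map_on_cst W 0) (smooth_map_on_cst W 0).
Definition sfun_one := sfun_of (smooth_map_on_cst W 1) (smooth_map_on_cst W 0).
Definition sfun_opp (a : sfun) := sfun_of
  (smooth_map_onN (osetP W0) (sfun_re a)) (smooth_map_onN (osetP W0) (sfun_im a)).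
Definition sfun_conj (a : sfun) := sfun_of
  (sfun_re a) (smooth_map_onN (osetP W0) (sfun_im a)).
Definition sfun_add (a b : sfun) := sfun_of
  (smooth_map_onD (osetP W0) (sfun_re a) (sfun_re b))
  (smooth_map_onD (osetP W0) (sfun_im a) (sfun_im b)).
Definition sfun_mul (a b : sfun) := sfun_of
  (smooth_map_onD (osetP W0)
    (smooth_map_onM (osetP W0) (sfun_re a) (sfun_re b))
    (smooth_map_onN (osetP W0) (smooth_map_onM (osetP W0) (sfun_im a) (sfun_im b))))
  (smooth_map_onD (osetP W0)
    (smooth_map_onM (osetP W0) (sfun_re a) (sfun_im b))
    (smooth_map_onM (osetP W0) (sfun_im a) (sfun_re b))).

Lemma sfun_zeroE p : W p -> sfun_zero p = 0.
Proof. exact: sfun_ofE. Qed.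
Lemma sfun_oneE p : W p -> sfun_one p = 1.
Proof. exact: sfun_ofE. Qed.
Lemma sfun_oppE a p : W p -> sfun_opp a p = - a p.
Proof. by move=> Wp; rewrite sfun_ofE //; case: (a p). Qed.
Lemma sfun_addE a b p : W p -> sfun_add a b p = a p + b p.
Proof. by move=> Wp; rewrite sfun_ofE //; case: (a p); case: (b p). Qed.
Lemma sfun_mulE a b p : W p -> sfun_mul a b p = a p * b p.
Proof. by move=> Wp; rewrite sfun_ofE //; case: (a p); case: (b p). Qed.
Lemma sfun_conjE a p : W p -> sfun_conj a p = conjc (a p).
Proof. by move=> Wp; rewrite sfun_ofE //; case: (a p). Qed.

Fact sfun_addA : associative sfun_add.
Proof. by move=> a b c; apply: sfunP => p Wp; rewrite !sfun_addE // addrA. Qed.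
Fact sfun_addC : commutative sfun_add.
Proof. by move=> a b; apply: sfunP => p Wp; rewrite !sfun_addE // addrC. Qed.
Fact sfun_add0 : left_id sfun_zero sfun_add.
Proof. by move=> a; apply: sfunP => p Wp; rewrite sfun_addE // sfun_zeroE // add0r. Qed.
Fact sfun_addN : left_inverse sfun_zero sfun_opp sfun_add.
Proof.
by move=> a; apply: sfunP => p Wp; rewrite sfun_addE // sfun_oppE // sfun_zeroE // addNr.
Qed.
HB.instance Definition _ :=
  GRing.isZmodule.Build sfun sfun_addA sfun_addC sfun_add0 sfun_addN.

Fact sfun_mulA : associative sfun_mul.
Proof. by move=> a b c; apply: sfunP => p Wp; rewrite !sfun_mulE // mulrA. Qed.
Fact sfun_mulC : commutative sfun_mul.
Proof. by move=> a b; apply: sfunP => p Wp; rewrite !sfun_mulE // mulrC. Qed.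
Fact sfun_mul1 : left_id sfun_one sfun_mul.
Proof. by move=> a; apply: sfunP => p Wp; rewrite sfun_mulE // sfun_oneE // mul1r. Qed.
Fact sfun_mulD : left_distributive sfun_mul sfun_add.
Proof.
move=> a b c; apply: sfunP => p Wp.
by rewrite !(sfun_mulE, sfun_addE) // mulrDl.
Qed.
HB.instance Definition _ :=
  GRing.Zmodule_isComPzRing.Build sfun sfun_mulA sfun_mulC sfun_mul1 sfun_mulD.

Lemma svalD (a b : sfun) p : W p -> (a + b) p = a p + b p.
Proof. exact: sfun_addE. Qed.
Lemma svalN (a : sfun) p : W p -> (- a) p = - a p.
Proof. exact: sfun_oppE. Qed.
Lemma svalB (a b : sfun) p : W p -> (a - b) p = a p - b p.
Proof. by move=> Wp; rewrite svalD // svalN. Qed.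
Lemma svalM (a b : sfun) p : W p -> (a * b) p = a p * b p.
Proof. exact: sfun_mulE. Qed.
Lemma sval0 p : W p -> (0 : sfun) p = 0.
Proof. exact: sfun_zeroE. Qed.
Lemma sval1 p : W p -> (1 : sfun) p = 1.
Proof. exact: sfun_oneE. Qed.
Lemma svalX (a : sfun) n p : W p -> (a ^+ n) p = a p ^+ n.
Proof. by move=> Wp; elim: n => [|n IH]; rewrite ?sval1 // !exprS svalM // IH. Qed.
Lemma sval_nat n p : W p -> (n%:R : sfun) p = n%:R.
Proof. by move=> Wp; elim: n => [|n IH]; rewrite ?sval0 // -!natr1 svalD // IH sval1. Qed.
Lemma sval_sum n (F : 'I_n -> sfun) p : W p -> (\sum_i F i) p = \sum_i F i p.
Proof.
move=> Wp; apply: (big_ind2 (fun (a : sfun) (b : C) => a p = b)) => //.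
- exact: sval0.
- by move=> a b a' b' <- <-; exact: svalD.
Qed.
Lemma sval_dot n (X Y : 'rV[sfun]_n) p : W p ->
  dot X Y p = \sum_i X 0 i p * Y 0 i p.
Proof. by move=> Wp; rewrite sval_sum //; apply: eq_bigr => i _; exact: svalM. Qed.

Fact sfun_conjD : additive sfun_conj.
Proof.
move=> a b; apply: sfunP => p Wp.
by rewrite svalB // !sfun_conjE // svalB // rmorphB.
Qed.
Fact sfun_conjM : multiplicative sfun_conj.
Proof.
split=> [a b|]; apply: sfunP => p Wp.
  by rewrite svalM // !sfun_conjE // svalM // rmorphM.
by rewrite sfun_conjE // sval1 // rmorph1.
Qed.
HB.instance Definition _ := GRing.isAdditive.Build sfun sfun sfun_conj sfun_conjD.
HB.instance Definition _ := GRing.isMultiplicative.Build sfun sfun sfun_conj sfun_conjM.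

Lemma sfun_conjK : involutive sfun_conj.
Proof. by move=> a; apply: sfunP => p Wp; rewrite !sfun_conjE // conjcK. Qed.

Lemma sfun_two_reg (a : sfun) : a + a = 0 -> a = 0.
Proof.
move=> aa; apply: sfunP => p Wp; rewrite sval0 //.
have := congr1 (fun b : sfun => b p) aa; rewrite svalD // sval0 //.
by move/eqP; rewrite -mulr2n mulrn_eq0 /= => /eqP.
Qed.

Definition sreal (a : M -> R) (sa : smooth_map_on W a) :=
  sfun_of sa (smooth_map_on_cst W 0).

Lemma srealE a (sa : smooth_map_on W a) p : W p -> sreal sa p = (a p)%:C%C.
Proof. by move=> Wp; rewrite sfun_ofE. Qed.

Lemma sreal_conj a (sa : smooth_map_on W a) : sfun_conj (sreal sa) = sreal sa.
Proof.
by apply: sfunP => p Wp; rewrite sfun_conjE // srealE // conjc_real.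
Qed.

Lemma sreal_re (a : sfun) : sfun_conj a = a -> a = sreal (sfun_re a).
Proof.
move=> ca; apply: sfunP => p Wp; rewrite srealE //.
have := congr1 (fun b : sfun => b p) ca; rewrite sfun_conjE //.
case: (a p) => x y /= [] /eqP; rewrite eq_sym -subr_eq0 opprK -mulr2n mulrn_eq0 /=.
by move=> /eqP ->.
Qed.

Section partial.
Variables (c : chart R 2 M) (ac : atlas c) (Wc : W `<=` dom c).

Definition pder v (a : sfun) := sfun_of
  (smooth_pderR v (osetP W0) ac Wc (sfun_re a))
  (smooth_pderR v (osetP W0) ac Wc (sfun_im a)).

Lemma pder_pderR v a p : W p -> pder v a p =
  pderR W c v (fun q => complex.Re (a q)) p +i*
  pderR W c v (fun q => complex.Im (a q)) p.
Proof. exact: sfun_ofE. Qed.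

Let Re_eq (a : sfun) (F : M -> C) v p : (forall q, W q -> a q = F q) ->
  pderR W c v (fun q => complex.Re (a q)) p = pderR W c v (fun q => complex.Re (F q)) p.
Proof. by move=> aF; apply: pderR_eq (osetP W0) Wc _ => q Wq; rewrite aF. Qed.
Let Im_eq (a : sfun) (F : M -> C) v p : (forall q, W q -> a q = F q) ->
  pderR W c v (fun q => complex.Im (a q)) p = pderR W c v (fun q => complex.Im (F q)) p.
Proof. by move=> aF; apply: pderR_eq (osetP W0) Wc _ => q Wq; rewrite aF. Qed.

Let Wo := osetP W0.

Lemma pderD v a b : pder v (a + b) = pder v a + pder v b.
Proof.
apply: sfunP => p Wp; rewrite svalD // !sfun_ofE //.
have E q : W q -> (a + b) q = (complex.Re (a q) + complex.Re (b q)) +i*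
    (complex.Im (a q) + complex.Im (b q)).
  by move=> Wq; rewrite svalD //; case: (a q); case: (b q).
rewrite (Re_eq v p E) (Im_eq v p E) /=.
by rewrite (pderRD v Wo ac Wc (sfun_re a) (sfun_re b))
  (pderRD v Wo ac Wc (sfun_im a) (sfun_im b)).
Qed.

Lemma pderM v a b : pder v (a * b) = pder v a * b + a * pder v b.
Proof.
apply: sfunP => p Wp; rewrite svalD // !svalM // !sfun_ofE //.
have E q : W q -> (a * b) q =
    (complex.Re (a q) * complex.Re (b q) + - (complex.Im (a q) * complex.Im (b q))) +i*
    (complex.Re (a q) * complex.Im (b q) + complex.Im (a q) * complex.Re (b q)).
  by move=> Wq; rewrite svalM //; case: (a q); case: (b q).
rewrite (Re_eq v p E) (Im_eq v p E) /=.
have [ra ia rb ib] := And4 (sfun_re a) (sfun_im a) (sfun_re b) (sfun_im b).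
have ii := smooth_map_onM Wo ia ib.
rewrite (pderRD v Wo ac Wc (smooth_map_onM Wo ra rb) (smooth_map_onN Wo ii)).
rewrite (pderRN v Wo ac Wc ii).
rewrite (pderRD v Wo ac Wc (smooth_map_onM Wo ra ib) (smooth_map_onM Wo ia rb)).
rewrite (pderRM v Wo ac Wc ra rb) (pderRM v Wo ac Wc ia ib).
rewrite (pderRM v Wo ac Wc ra ib) (pderRM v Wo ac Wc ia rb).
move: (pderR _ _ _ _ _) (pderR _ _ _ _ _) (pderR _ _ _ _ _) (pderR _ _ _ _ _) => x y z t.
by case: (a p) => a1 a2; case: (b p) => b1 b2 /=; congr (_ +i* _); rewrite /=; ring.
Qed.

Lemma pderC v w a : pder v (pder w a) = pder w (pder v a).
Proof.
apply: sfunP => p Wp.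
have E v1 w1 : pder v1 (pder w1 a) p =
    pderR W c v1 (pderR W c w1 (fun q => complex.Re (a q))) p +i*
    pderR W c v1 (pderR W c w1 (fun q => complex.Im (a q))) p.
  rewrite [LHS]sfun_ofE //; congr (_ +i* _).
    by apply: pderR_eq Wo Wc _ => q Wq; rewrite sfun_ofE.
  by apply: pderR_eq Wo Wc _ => q Wq; rewrite sfun_ofE.
apply: (etrans (E v w)); apply: (etrans _ (esym (E w v))).
have e1 := congr1 (@^~ p) (pderRC v w Wo ac Wc (sfun_re a)).
have e2 := congr1 (@^~ p) (pderRC v w Wo ac Wc (sfun_im a)).
exact: (f_equal2 (@Complex R) e1 e2).
Qed.

Lemma conj_pder v a : sfun_conj (pder v a) = pder v (sfun_conj a).
Proof.
apply: sfunP => p Wp; rewrite sfun_conjE // !sfun_ofE //.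
have E q : W q -> (sfun_conj a) q = complex.Re (a q) +i* - complex.Im (a q).
  by move=> Wq; rewrite sfun_conjE //; case: (a q).
rewrite (Re_eq v p E) (Im_eq v p E) /=.
by rewrite (pderRN v Wo ac Wc (sfun_im a)).
Qed.

End partial.

Section change.
Variables (c d : chart R 2 M) (ac : atlas c) (ad : atlas d).
Hypotheses (Wc : W `<=` dom c) (Wd : W `<=` dom d).

Definition chart_coord i := sreal (smooth_coord i (osetP W0) ac Wc).

Lemma pder_change v a : pder ad Wd v a =
  pder ad Wd v (chart_coord 0) * pder ac Wc ev0 a +
  pder ad Wd v (chart_coord 1) * pder ac Wc ev1 a.
Proof.
apply: sfunP => p Wp; rewrite [RHS]svalD // [X in X + _]svalM // [X in _ + X]svalM //.
rewrite !(pder_pderR _ _ _ _ Wp).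
rewrite (pderR_change v p (osetP W0) ac ad Wc Wd (sfun_re a)).
rewrite (pderR_change v p (osetP W0) ac ad Wc Wd (sfun_im a)).
have Ere i : pderR W d v (fun q => complex.Re (chart_coord i q)) p =
    pderR W d v (fun q => Defs.coord c q 0 i) p.
  by apply: pderR_eq (osetP W0) Wd _ => q Wq; rewrite srealE.
have Eim i : pderR W d v (fun q => complex.Im (chart_coord i q)) p = 0.
  transitivity (pderR W d v (cst (0 : R)) p).
    by apply: pderR_eq (osetP W0) Wd _ => q Wq; rewrite srealE.
  by rewrite pderRE // (_ : cst 0 \o param d = cst 0) // derive_cst.
rewrite !Ere !Eim; move: (pderR _ d _ _ _) (pderR _ d _ _ _) => x y.
move: (pderR _ _ _ _ _) (pderR _ _ _ _ _) (pderR _ _ _ _ _) (pderR _ _ _ _ _).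
by clear=> z1 z2 z3 z4; congr (_ +i* _); ring.
Qed.

End change.

End smooth_ring.
#[global] Opaque pder sfun_of.

(** * Orthonormal systems in Euclidean space *)

Section orthonormal_completion.
Context {R : rcfType}.

Lemma mul_trmx_gt0 n (v : 'rV[R]_n) : v != 0 -> 0 < (v *m v^T) 0 0.
Proof.
move=> /rV0Pn[i vi]; rewrite mxE (bigD1 i) //= mxE.
rewrite ltr_wpDr //; last by rewrite -expr2 exprn_even_gt0.
by apply: sumr_ge0 => k _; rewrite mxE -expr2 sqr_ge0.
Qed.

(** For reasons of rank the kernel of [A^T] is not zero; a nonzero row of its matrix is
    normalized. *)
Lemma orthonormal_extend m n (A : 'M[R]_(m, n)) : (m < n)%N -> A *m A^T = 1%:M ->
  exists v : 'rV[R]_n, v *m v^T = 1%:M /\ v *m A^T = 0.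
Proof.
move=> mn AA.
have rk : kermx A^T != 0.
  rewrite -mxrank_eq0 mxrank_ker -lt0n subn_gt0 mxrank_tr.
  exact: leq_ltn_trans (rank_leq_row _) mn.
have [i vi] : exists i, row i (kermx A^T) != 0.
  apply/existsP; apply: contraNT rk; rewrite negb_exists => /forallP h.
  by apply/eqP/row_matrixP => i; rewrite row0; apply/eqP; have := h i; rewrite negbK.
set v := row i _ in vi; have v0 := mul_trmx_gt0 vi.
have vA : v *m A^T = 0 by rewrite -row_mul mulmx_ker row0.
exists ((Num.sqrt ((v *m v^T) 0 0))^-1 *: v); split; last first.
  by rewrite -scalemxAl vA scaler0.
rewrite linearZ /= -scalemxAl -scalemxAr scalerA -invfM -expr2 sqr_sqrtr ?ltW //.
by rewrite [X in _ *: X]mx11_scalar scale_scalar_mx mulVf // gt_eqF.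
Qed.

Lemma orthonormal_leq m n (A : 'M[R]_(m, n)) : A *m A^T = 1%:M -> (m <= n)%N.
Proof.
move=> AA; have : \rank (A *m A^T) = m by rewrite AA mxrank1.
by move=> <-; apply: leq_trans (mxrankM_maxl _ _) (rank_leq_col _).
Qed.

Lemma orthonormal_completion m n k (A : 'M[R]_(m, n)) : A *m A^T = 1%:M ->
  (m + k <= n)%N -> exists nu : 'M[R]_(k, n), nu *m nu^T = 1%:M /\ nu *m A^T = 0.
Proof.
move=> AA; elim: k => [|k IH] mk; first by exists 0; split; apply/matrixP => -[].
have [|nu [nn nA]] := IH; first by apply: leq_trans mk; rewrite leq_add2l.
have [||v [vv vB]] := @orthonormal_extend (k + m) n (col_mx nu A).
- by apply: leq_trans mk; rewrite addnS addnC.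
- rewrite tr_col_mx mul_col_row nn AA nA scalar_mx_block.
  by rewrite -[A *m nu^T]trmxK trmx_mul trmxK nA trmx0.
move: vB; rewrite tr_col_mx mul_mx_row -row_mx0 => /eq_row_mx[vnu vA].
suff : exists w : 'M[R]_(1 + k, n), w *m w^T = 1%:M /\ w *m A^T = 0 by [].
exists (col_mx v nu); split; last by rewrite mul_col_mx vA nA col_mx0.
rewrite tr_col_mx mul_col_row vv nn vnu (@scalar_mx_block _ 1 k).
by rewrite -[nu *m v^T]trmxK trmx_mul trmxK vnu trmx0.
Qed.

(** The stacked matrix is square, so its right inverse is also a left inverse. *)
Lemma orthonormal_parseval m n k (A : 'M[R]_(m, n)) (nu : 'M[R]_(k, n)) :
  (m + k)%N = n -> A *m A^T = 1%:M -> nu *m nu^T = 1%:M -> nu *m A^T = 0 ->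
  A^T *m A + nu^T *m nu = 1%:M.
Proof.
move=> e; subst n => AA nn nA.
have : col_mx A nu *m (col_mx A nu)^T = 1%:M.
  rewrite tr_col_mx mul_col_row AA nn nA scalar_mx_block.
  by rewrite -[A *m nu^T]trmxK trmx_mul trmxK nA trmx0.
by move/mulmx1C; rewrite tr_col_mx mul_row_col.
Qed.

(* Orthonormal bases for the same Gram matrix [G] satisfy [e^T e = G^-1]. *)
Lemma gram_orthonormal_eq n (G e e' : 'M[R]_n) :
  e *m G *m e^T = 1%:M -> e' *m G *m e'^T = 1%:M -> e^T *m e = e'^T *m e'.
Proof.
move=> h h'.
have k : G *m (e^T *m e) = 1%:M by rewrite mulmxA; apply: mulmx1C; rewrite mulmxA.
have k' : G *m (e'^T *m e') = 1%:M by rewrite mulmxA; apply: mulmx1C; rewrite mulmxA.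
have [uG _] := mulmx1_unit k.
by rewrite -[LHS]mul1mx -(mulVmx uG) -mulmxA k -k' mulmxA mulVmx // mul1mx.
Qed.

Lemma sqnorm_mx n (B : 'M[R]_n) : \sum_i \sum_j B i j ^+ 2 = \tr (B *m B^T).
Proof.
by apply: eq_bigr => i _; rewrite mxE; apply: eq_bigr => j _; rewrite mxE expr2.
Qed.

(** By cyclicity of the trace the sum is [tr (h G h^T G)] with [G = e^T e]. Together with
    [gram_orthonormal_eq] this makes [S] independent of the tangent frame. *)
Lemma sqnorm_gram_eq n (h e e' : 'M[R]_n) : e^T *m e = e'^T *m e' ->
  \sum_i \sum_j (e *m h *m e^T) i j ^+ 2 = \sum_i \sum_j (e' *m h *m e'^T) i j ^+ 2.
Proof.
move=> E; rewrite !sqnorm_mx.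
have F (f : 'M[R]_n) : \tr (f *m h *m f^T *m (f *m h *m f^T)^T) =
    \tr (h *m (f^T *m f) *m h^T *m (f^T *m f)).
  rewrite !trmx_mul trmxK !mulmxA mxtrace_mulC !mulmxA.
  by rewrite -!mulmxA [in LHS]mxtrace_mulC !mulmxA -!mulmxA mxtrace_mulC !mulmxA.
by rewrite !F E.
Qed.

End orthonormal_completion.

Lemma sum2_scale {R : pzRingType} {V : lmodType R} (B : 'I_2 -> 'I_2 -> V) (a b : 'I_2 -> R) :
  \sum_k \sum_l (a k * b l) *: B k l =
  a 0 *: (b 0 *: B 0 0 + b 1 *: B 0 1) + a 1 *: (b 0 *: B 1 0 + b 1 *: B 1 1).
Proof.
rewrite !big_ord_recl !big_ord0 !addr0 !scalerDr !scalerA.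
by have -> : lift ord0 ord0 = 1 :> 'I_2 by exact: val_inj.
Qed.

Lemma C1_derive_rVE {R : realType} n (T : 'rV[R]_2 -> 'rV[R]_n) U x v :
  open U -> Ck_on 1 U T -> U x ->
  'D_v T x = v 0 0 *: 'D_ev0 T x + v 0 1 *: 'D_ev1 T x.
Proof.
move=> oU CT Ux; apply/rowP => i.
have E w : ('D_w T x) 0 i = 'D_w (fun z => T z 0 i) x.
  by rewrite (derive_coord _ _ _ CT Ux).
apply: (etrans (E v)); rewrite mxE [X in _ = X + _]mxE [X in _ = _ + X]mxE (E ev0) (E ev1).
exact: (C1_deriveE _ oU (Ck_on_coord _ _ oU CT) Ux).
Qed.

Section pder_of_real.
Context {R : realType} {M : riemannianManifold R 2}.
Variables (W0 : opens M) (c : chart R 2 M).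
Local Notation W := (oset W0).
Hypotheses (ac : atlas c) (Wc : W `<=` dom c).
Local Notation x_ p := (Defs.coord c p).
Let Wo : open W := osetP W0.

Lemma pder_sreal v (a : M -> R) (sa : smooth_map_on W a) p : W p ->
  pder ac Wc v (sreal sa) p = ('D_v (a \o param c) (x_ p))%:C%C.
Proof.
move=> Wp; rewrite pder_pderR // -(pderRE c v a Wp); congr (_ +i* _)%C.
  by apply: pderR_eq Wo Wc _ => q Wq; rewrite srealE.
transitivity (pderR W c v (cst (0 : R)) p).
  by apply: pderR_eq Wo Wc _ => q Wq; rewrite srealE.
by rewrite pderRE // (_ : cst 0 \o param c = cst 0) // derive_cst.
Qed.

Let U := Defs.coord c @` W.
Let oU : open U.
Proof. by rewrite /U -(setIidr Wc); apply: open_coord_image; exact: osetP. Qed.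

Lemma pder2_sreal v w (a : M -> R) (sa : smooth_map_on W a) p : W p ->
  pder ac Wc v (pder ac Wc w (sreal sa)) p = ('D_v ('D_w (a \o param c)) (x_ p))%:C%C.
Proof.
move=> Wp; have sa' := smooth_pderR w Wo ac Wc sa.
have -> : pder ac Wc w (sreal sa) = sreal sa'.
  by apply: sfunP => q Wq; rewrite srealE // pder_sreal // pderRE.
rewrite pder_sreal //; congr (_%:C)%C; apply: (eq_on_derive _ oU); last by rewrite inE; exists p.
by move=> x /[!inE] -[q Wq <-] /=; rewrite (paramK (Wc Wq)) pderRE.
Qed.
End pder_of_real.

(** * The null frame of an immersed surface *)

Section immersed_frame.
Context {R : realType} {M : riemannianManifold R 2} {N : nat}.
Variable Phi : M -> 'rV[R]_N.+1.
Hypothesis Phi_immersion : immersion Phi.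
Hypothesis Phi_isometric : isometric Phi.

Variables (W0 : opens M) (c : chart R 2 M).
Local Notation W := (oset W0).
Hypotheses (ac : atlas c) (Wc : W `<=` dom c).
Local Notation A := (sfun W0).
Local Notation "''d_' v" := (pder ac Wc v) (at level 8, v at level 2).
Local Notation x_ p := (Defs.coord c p).

Let Wo : open W := osetP W0.

Lemma smooth_immersion i : smooth_map_on W (fun p => Phi p 0 i).
Proof.
move=> d ad k; have [sm _] := Phi_immersion.
apply: (@Ck_on_coord _ _ _ _ k _ (Phi \o param d)); first exact: open_coord_image.
apply: Ck_on_subset (sm d ad k).
by move=> _ [q [dq Wq] <-]; exists q.
Qed.

Definition position : 'rV[A]_N.+1 := \row_i sreal (smooth_immersion i).
Local Notation f := position.

Let U := Defs.coord c @` W.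

Let oU : open U.
Proof. by rewrite /U -(setIidr Wc); apply: open_coord_image; exact: osetP. Qed.

Let Ux p : W p -> U (x_ p). Proof. by exists p. Qed.

Let CPhi k : Ck_on k U (Phi \o param c).
Proof.
have [sm _] := Phi_immersion; apply: Ck_on_subset (sm c ac k).
by move=> _ [q Wq <-]; exists q => //; exact: Wc.
Qed.

Let CPhi1 v : Ck_on 1 U ('D_v (Phi \o param c)).
Proof. by have [_ /(_ v)[]] := CPhi 2. Qed.

Lemma pder_positionE v i p : W p ->
  'd_v (f 0 i) p = (differential Phi c p v 0 i)%:C%C.
Proof.
move=> Wp; rewrite mxE pder_sreal //; congr (_%:C%C).
exact: (derive_coord _ _ _ (CPhi 1) (Ux Wp)).
Qed.

Lemma positionE i p : W p -> f 0 i p = (Phi p 0 i)%:C%C.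
Proof. by move=> Wp; rewrite mxE srealE. Qed.

Definition differential2 p v w : 'rV[R]_N.+1 :=
  'D_v ('D_w (Phi \o param c)) (x_ p).

Lemma pder2_positionE v w i p : W p ->
  'd_v ('d_w (f 0 i)) p = (differential2 p v w 0 i)%:C%C.
Proof.
move=> Wp.
have sa := smooth_pderR w Wo ac Wc (smooth_immersion i).
have -> : 'd_w (f 0 i) = sreal sa.
  apply: sfunP => q Wq; rewrite srealE // mxE pder_sreal // pderRE //.
rewrite pder_sreal //; congr (_%:C%C).
rewrite -(derive_coord _ _ _ (CPhi1 w) (Ux Wp)).
apply: (eq_on_derive _ oU); last by rewrite inE; exists p.
move=> x /[!inE] -[q Wq <-] /=; rewrite (paramK (Wc Wq)) pderRE //.
exact: (derive_coord _ _ _ (CPhi 1) (Ux Wq)).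
Qed.

Let ev k : 'rV[R]_2 := delta_mx 0 k.

Lemma differentialE p (v : 'rV[R]_2) : W p ->
  differential Phi c p v =
  v 0 0 *: differential Phi c p ev0 + v 0 1 *: differential Phi c p ev1.
Proof. by move=> Wp; exact: (C1_derive_rVE _ oU (CPhi 1) (Ux Wp)). Qed.

Lemma differential2_sym p v w : W p -> differential2 p v w = differential2 p w v.
Proof.
move=> Wp; apply/rowP => i.
have e1 := pder2_positionE v w i Wp; have e2 := pder2_positionE w v i Wp.
have e3 := congr1 (fun a : A => sfun_val a p) (pderC ac Wc v w (f 0 i)).
have e4 := etrans (esym e1) (etrans e3 e2).
exact: (congr1 (@complex.Re R) e4).
Qed.

(** Linearity in the outer direction comes from [C1_derive_rVE], and symmetry transfers it to the
    inner one. *)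
Lemma differential2E p (v w : 'rV[R]_2) : W p ->
  differential2 p v w = \sum_k \sum_l (v 0 k * w 0 l) *: differential2 p (ev k) (ev l).
Proof.
move=> Wp.
have lin1 y : differential2 p v y = v 0 0 *: differential2 p ev0 y + v 0 1 *: differential2 p ev1 y.
  exact: (C1_derive_rVE _ oU (CPhi1 y) (Ux Wp)).
have lin2 y : differential2 p y w = w 0 0 *: differential2 p y ev0 + w 0 1 *: differential2 p y ev1.
  rewrite !(differential2_sym y _ Wp).
  exact: (C1_derive_rVE _ oU (CPhi1 y) (Ux Wp)).
apply: (etrans (lin1 w)); rewrite (lin2 ev0) (lin2 ev1); symmetry.
exact: (sum2_scale (fun k l => differential2 p (ev k) (ev l)) (v 0) (w 0)).
Qed.

Lemma sff_differential2 p (e : 'M[R]_2) (nu : 'M[R]_(N - 2, N.+1)) i j a :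
  sff Phi c p e nu i j a = dotp (differential2 p (row i e) (row j e)) (row a nu).
Proof. by []. Qed.

Lemma isometric_gram p (e : 'M[R]_2) i j : W p ->
  (e *m metric c (x_ p) *m e^T) i j =
  dotp (differential Phi c p (row i e)) (differential Phi c p (row j e)).
Proof.
move=> Wp; rewrite (Phi_isometric ac (Wc Wp)) /dotp !mxE.
by apply: eq_bigr => k _; rewrite -row_mul !mxE.
Qed.

End immersed_frame.

Section dotp_theory.
Context {R : realType}.
Lemma dotpDl n (u v w : 'rV[R]_n) : dotp (u + v) w = dotp u w + dotp v w.
Proof. by rewrite /dotp mulmxDl mxE. Qed.
Lemma dotpZl n (a : R) (u w : 'rV[R]_n) : dotp (a *: u) w = a * dotp u w.
Proof. by rewrite /dotp -scalemxAl mxE. Qed.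
Lemma dotpC n (u w : 'rV[R]_n) : dotp u w = dotp w u.
Proof. by rewrite /dotp -[u *m w^T]trmxK trmx_mul trmxK mxE. Qed.
Lemma dotpDr n (u v w : 'rV[R]_n) : dotp w (u + v) = dotp w u + dotp w v.
Proof. by rewrite dotpC dotpDl !(dotpC _ w). Qed.
Lemma dotpZr n (a : R) (u w : 'rV[R]_n) : dotp w (a *: u) = a * dotp w u.
Proof. by rewrite dotpC dotpZl (dotpC w). Qed.
Lemma dotpE n (u w : 'rV[R]_n) : dotp u w = \sum_k u 0 k * w 0 k.
Proof. by rewrite /dotp mxE; apply: eq_bigr => k _; rewrite mxE. Qed.

Lemma mul_rV_dotp n (u w : 'rV[R]_n) : u *m w^T = (dotp u w)%:M.
Proof. exact: mx11_scalar. Qed.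
Lemma mul_mx_dotp m n (A : 'M[R]_(m, n)) (w : 'rV[R]_n) a :
  (A *m w^T) a 0 = dotp (row a A) w.
Proof. by rewrite dotpE mxE; apply: eq_bigr => k _; rewrite !mxE. Qed.
Lemma dotp_suml n (I : finType) (u : I -> 'rV[R]_n) (w : 'rV[R]_n) :
  dotp (\sum_i u i) w = \sum_i dotp (u i) w.
Proof. by rewrite /dotp mulmx_suml summxE. Qed.
Lemma dotp_shear n (a : R) (u w : 'rV[R]_n) : dotp (- a *: u + w) (- a *: u + w) =
  - a * (- a * dotp u u + dotp u w) + (- a * dotp u w + dotp w w).
Proof. by rewrite !(dotpDl, dotpDr, dotpZl, dotpZr) (dotpC w u); ring. Qed.
End dotp_theory.
#[local] Opaque dotp differential differential2 position.

Section sfun_quadratic.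
Context {R : realType} {M : riemannianManifold R 2} {W0 : opens M}.
Local Notation cj := (@sfun_conj R M W0).
Local Open Scope complex_scope.

(** The shape of [a0] and [a1] is that of [fr0] and [fr1] below, the second of which is purely
    imaginary. *)
Lemma sval_quadratic (a0 a1 g0 g1 g2 : sfun W0) p (x y t r0 r1 r2 : R) : oset W0 p ->
  a0 p = x +i* y -> a1 p = 0 +i* t ->
  g0 p = r0%:C -> g1 p = r1%:C -> g2 p = r2%:C ->
  (a0 * a0 * g0 + (a0 * a1 + a0 * a1) * g1 + a1 * a1 * g2) p =
  ((x ^+ 2 - y ^+ 2) * r0 - 2 * (y * t * r1) - t ^+ 2 * r2) +i*
  (2 * (x * y * r0 + x * t * r1)).
Proof.
move=> Wp ex et e0 e1 e2; rewrite !(svalD, svalM) // ex et e0 e1 e2.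
by apply/eqP; rewrite eq_complex /=; apply/andP; split; apply/eqP; ring.
Qed.

Lemma sval_hermitian (a0 a1 g0 g1 g2 : sfun W0) p (x y t r0 r1 r2 : R) : oset W0 p ->
  a0 p = x +i* y -> a1 p = 0 +i* t ->
  g0 p = r0%:C -> g1 p = r1%:C -> g2 p = r2%:C ->
  (cj a0 * a0 * g0 + (cj a0 * a1 + cj a1 * a0) * g1 + cj a1 * a1 * g2) p =
  ((x ^+ 2 + y ^+ 2) * r0 + 2 * (y * t * r1) + t ^+ 2 * r2)%:C.
Proof.
move=> Wp ex et e0 e1 e2; rewrite !(svalD, svalM, sfun_conjE) // ex et e0 e1 e2.
by apply/eqP; rewrite eq_complex /=; apply/andP; split; apply/eqP; ring.
Qed.
End sfun_quadratic.

Section null_frame_of_immersion.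
Context {R : realType} {M : riemannianManifold R 2} {N : nat}.
Variable Phi : M -> 'rV[R]_N.+1.
Hypothesis Phi_spherical : spherical Phi.
Hypothesis Phi_immersion : immersion Phi.

Variables (W0 : opens M) (c : chart R 2 M).
Local Notation W := (oset W0).
Hypotheses (ac : atlas c) (Wc : W `<=` dom c).
Local Notation A := (sfun W0).
Local Notation cj := (@sfun_conj R M W0).
Local Notation f := (position Phi_immersion W0).
Local Notation del k := (pder ac Wc (delta_mx 0 k)).
Local Notation dPhi := (differential Phi c).
Let Wo : open W := osetP W0.
Local Notation e_ k := (delta_mx 0 k : 'rV[R]_2).

Definition gram k l p := dotp (dPhi p (e_ k)) (dPhi p (e_ l)).

Lemma gram_sfun k l p : W p ->
  dot (map_mx (del k) f) (map_mx (del l) f) p = (gram k l p)%:C%C.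
Proof.
move=> Wp; rewrite sval_dot // /gram dotpE rmorph_sum /=; apply: eq_bigr => i _.
have e j : sfun_val (map_mx (del j) f 0 i) p = (dPhi p (e_ j) 0 i)%:C%C.
  by rewrite mxE; exact: pder_positionE.
by apply: (etrans (f_equal2 *%R (e k) (e l))); rewrite -rmorphM.
Qed.

Lemma smooth_gram k l : smooth_map_on W (gram k l).
Proof.
apply: eq_smooth_map_on Wo _ (sfun_re (dot (map_mx (del k) f) (map_mx (del l) f))).
by move=> p Wp; rewrite gram_sfun.
Qed.

Lemma differential_gt0 p v : W p -> v != 0 -> 0 < dotp (dPhi p v) (dPhi p v).
Proof.
move=> Wp v0; apply: mul_trmx_gt0; apply: contra_neq v0 => d0.
have [_ inj] := Phi_immersion; apply: (inj c p ac (Wc Wp)); rewrite d0.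
by rewrite (differentialE Phi_immersion ac Wc _ Wp) !mxE !scale0r addr0.
Qed.

Lemma gram00_gt0 p : W p -> 0 < gram 0 0 p.
Proof.
move=> Wp; apply: differential_gt0 => //; apply/eqP => /rowP /(_ 0).
by rewrite !mxE /= => /eqP; rewrite oner_eq0.
Qed.

(** Gram-Schmidt data: [slope] is the coefficient of the projection of the second coordinate field
    on the first, [height] the squared length of what remains. *)
Definition slope p := gram 0 1 p / gram 0 0 p.
Definition height p := gram 1 1 p - slope p * gram 0 1 p.

Lemma slopeE p : W p -> slope p * gram 0 0 p = gram 0 1 p.
Proof. by move=> Wp; rewrite divfK // gt_eqF // gram00_gt0. Qed.

Lemma height_gt0 p : W p -> 0 < height p.
Proof.
move=> Wp; have e0 : - slope p *: ev0 + ev1 != 0.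
  apply/eqP => /rowP /(_ 1); rewrite !mxE /= mulr0 add0r => /eqP.
  by rewrite oner_eq0.
have := differential_gt0 Wp e0; rewrite (differentialE Phi_immersion ac Wc _ Wp).
have -> : (- slope p *: ev0 + ev1) 0 0 = - slope p by rewrite !mxE /= mulr1 addr0.
have -> : (- slope p *: ev0 + ev1) 0 1 = 1 by rewrite !mxE /= mulr0 add0r.
have key : dotp (- slope p *: dPhi p ev0 + dPhi p ev1) (- slope p *: dPhi p ev0 + dPhi p ev1) =
    - slope p * (- slope p * gram 0 0 p + gram 0 1 p) + (- slope p * gram 0 1 p + gram 1 1 p).
  exact: dotp_shear.
rewrite scale1r key; have := slopeE Wp; rewrite /height.
move: (gram 0 0 p) (gram 0 1 p) (gram 1 1 p) (slope p) => x y w s <-.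
by congr (0 < _); ring.
Qed.

Definition len0 p := (Num.sqrt (gram 0 0 p))^-1.
Definition len1 p := (Num.sqrt (height p))^-1.

Lemma smooth_slope : smooth_map_on W slope.
Proof.
apply: (smooth_map_onM Wo (smooth_gram 0 1)).
apply: (smooth_map_onV Wo _ (smooth_gram 0 0)) => p Wp.
by rewrite gt_eqF // gram00_gt0.
Qed.

Lemma smooth_len0 : smooth_map_on W len0.
Proof.
apply: (smooth_map_onV Wo).
  by move=> p Wp; rewrite gt_eqF // sqrtr_gt0 gram00_gt0.
exact: (smooth_map_on_sqrt Wo gram00_gt0 (smooth_gram 0 0)).
Qed.

Lemma smooth_len1 : smooth_map_on W len1.
Proof.
apply: (smooth_map_onV Wo).
  by move=> p Wp; rewrite gt_eqF // sqrtr_gt0 height_gt0.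
apply: (smooth_map_on_sqrt Wo height_gt0).
apply: (smooth_map_onD Wo (smooth_gram 1 1)).
exact: (smooth_map_onN Wo (smooth_map_onM Wo smooth_slope (smooth_gram 0 1))).
Qed.

Lemma len0_gt0 p : W p -> 0 < len0 p.
Proof. by move=> Wp; rewrite invr_gt0 sqrtr_gt0 gram00_gt0. Qed.
Lemma len1_gt0 p : W p -> 0 < len1 p.
Proof. by move=> Wp; rewrite invr_gt0 sqrtr_gt0 height_gt0. Qed.
Lemma len0E p : W p -> len0 p ^+ 2 * gram 0 0 p = 1.
Proof.
move=> Wp; have g0 := gram00_gt0 Wp.
by rewrite exprVn sqr_sqrtr ?ltW // mulVf // gt_eqF.
Qed.
Lemma len1E p : W p -> len1 p ^+ 2 * height p = 1.
Proof.
move=> Wp; have g0 := height_gt0 Wp.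
by rewrite exprVn sqr_sqrtr ?ltW // mulVf // gt_eqF.
Qed.

Definition isqrt2 : R := (Num.sqrt 2)^-1.
Lemma isqrt2E : isqrt2 ^+ 2 * 2 = 1.
Proof. by rewrite exprVn sqr_sqrtr // mulVf. Qed.

(* The frame [(E1 - i E2)/sqrt 2] where [E1], [E2] is obtained from the
   coordinate fields by the Gram-Schmidt process. *)
Definition fr_re0 p := isqrt2 * len0 p.
Definition fr_im0 p := isqrt2 * (len1 p * slope p).
Definition fr_im1 p := - (isqrt2 * len1 p).

Lemma smooth_re0 : smooth_map_on W fr_re0.
Proof. exact: (smooth_map_onM Wo (smooth_map_on_cst W isqrt2) smooth_len0). Qed.
Lemma smooth_im0 : smooth_map_on W fr_im0.
Proof.
apply: (smooth_map_onM Wo (smooth_map_on_cst W isqrt2)).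
exact: (smooth_map_onM Wo smooth_len1 smooth_slope).
Qed.
Lemma smooth_im1 : smooth_map_on W fr_im1.
Proof.
apply: (smooth_map_onN Wo).
exact: (smooth_map_onM Wo (smooth_map_on_cst W isqrt2) smooth_len1).
Qed.
(** The determinant of the frame and its conjugate is [i len0 len1]; the function here is the
    imaginary part of its inverse. *)
Lemma smooth_det : smooth_map_on W (fun p => - (len0 p * len1 p)^-1).
Proof.
apply: (smooth_map_onN Wo); apply: (smooth_map_onV Wo).
  by move=> p Wp; rewrite mulf_neq0 // gt_eqF ?len0_gt0 ?len1_gt0.
exact: (smooth_map_onM Wo smooth_len0 smooth_len1).
Qed.

Definition fr0 : A := sfun_of smooth_re0 smooth_im0.
Definition fr1 : A := sfun_of (smooth_map_on_cst W 0) smooth_im1.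
Definition fr_det : A := sfun_of (smooth_map_on_cst W 0) smooth_det.

Local Notation D := (field_der (del 0) (del 1) fr0 fr1).
Local Notation "X ^c" := (map_mx cj X).
Local Notation z := (map_mx D f).

Lemma fr_det_inv : (fr0 * cj fr1 - fr1 * cj fr0) * fr_det = 1.
Proof.
apply: sfunP => p Wp; rewrite sval1 //.
have e0 : fr0 p = (fr_re0 p +i* fr_im0 p)%C by exact: sfun_ofE.
have e1 : fr1 p = (0 +i* fr_im1 p)%C by exact: sfun_ofE.
have e2 : fr_det p = (0 +i* - (len0 p * len1 p)^-1)%C by exact: sfun_ofE.
move: fr0 fr1 fr_det e0 e1 e2 => u v w e0 e1 e2.
rewrite svalM // svalB // !svalM // !sfun_conjE // e0 e1 e2.
have := lt0r_neq0 (len1_gt0 Wp); have := lt0r_neq0 (len0_gt0 Wp).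
have := isqrt2E; rewrite /fr_re0 /fr_im0 /fr_im1.
move: (len0 p) (len1 p) (slope p) isqrt2; clear=> a b s r r2 a0 b0.
apply/eqP; rewrite eq_complex /=; apply/andP; split; apply/eqP; last by ring.
transitivity (r ^+ 2 * 2 * (a * b / (a * b))); first by ring.
by rewrite r2 mul1r mulfV // mulf_neq0.
Qed.

Lemma position_conj : f^c = f.
Proof. by apply/rowP => i; rewrite !mxE sreal_conj. Qed.

Lemma position_dot : dot f f = 1.
Proof.
apply: sfunP => p Wp; rewrite sval_dot // sval1 //.
have := Phi_spherical p; rewrite dotpE => /(congr1 (real_complex R)).
rewrite rmorph_sum rmorph1 => <-; apply: eq_bigr => i _.
by rewrite !mxE srealE // rmorphM.
Qed.

Let zE : z = fr0 *: map_mx (del 0) f + fr1 *: map_mx (del 1) f.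
Proof. exact: field_der_row. Qed.

Let zcE : z^c = cj fr0 *: map_mx (del 0) f + cj fr1 *: map_mx (del 1) f.
Proof.
by apply: field_der_row_conj position_conj => a; exact: conj_pder.
Qed.

Let fr0E p : W p -> fr0 p = (fr_re0 p +i* fr_im0 p)%C.
Proof. exact: sfun_ofE. Qed.

Let fr1E p : W p -> fr1 p = (0 +i* fr_im1 p)%C.
Proof. exact: sfun_ofE. Qed.

Let len_rel p : W p ->
  [/\ isqrt2 ^+ 2 * 2 = 1, len0 p ^+ 2 * gram 0 0 p = 1, slope p * gram 0 0 p = gram 0 1 p &
   len1 p ^+ 2 * (gram 1 1 p - slope p * gram 0 1 p) = 1].
Proof.
by move=> Wp; split; [exact: isqrt2E|exact: len0E|exact: slopeE|exact: len1E].
Qed.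

Lemma frame_null : dot z z = 0.
Proof.
have -> : dot z z = fr0 * fr0 * dot (map_mx (del 0) f) (map_mx (del 0) f)
    + (fr0 * fr1 + fr0 * fr1) * dot (map_mx (del 0) f) (map_mx (del 1) f)
    + fr1 * fr1 * dot (map_mx (del 1) f) (map_mx (del 1) f).
  rewrite zE; move: (map_mx _ _) (map_mx _ _) => X Y.
  by rewrite !dotE (dotC Y X); ring.
apply: sfunP => p Wp; rewrite sval0 //.
rewrite (sval_quadratic Wp (fr0E Wp) (fr1E Wp) (gram_sfun 0 0 Wp)
  (gram_sfun 0 1 Wp) (gram_sfun 1 1 Wp)).
have [] := len_rel Wp; rewrite /fr_re0 /fr_im0 /fr_im1.
move: (gram 0 0 p) (gram 0 1 p) (gram 1 1 p) (slope p) (len0 p) (len1 p) isqrt2.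
clear=> x y w s a b r r2 a2 sx b2.
apply/eqP; rewrite eq_complex /=; apply/andP; split; apply/eqP; last by rewrite -sx; ring.
rewrite -sx in b2 *.
transitivity (r ^+ 2 * (a ^+ 2 * x - b ^+ 2 * (w - s * (s * x)))); first by ring.
by rewrite a2 b2 subrr mulr0.
Qed.

Lemma frame_unit : dot z z^c = 1.
Proof.
have -> : dot z z^c = cj fr0 * fr0 * dot (map_mx (del 0) f) (map_mx (del 0) f)
    + (cj fr0 * fr1 + cj fr1 * fr0) * dot (map_mx (del 0) f) (map_mx (del 1) f)
    + cj fr1 * fr1 * dot (map_mx (del 1) f) (map_mx (del 1) f).
  rewrite zcE zE; move: (map_mx _ _) (map_mx _ _) => X Y.
  by rewrite !dotE (dotC Y X); ring.
apply: sfunP => p Wp; rewrite sval1 //.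
rewrite (sval_hermitian Wp (fr0E Wp) (fr1E Wp) (gram_sfun 0 0 Wp)
  (gram_sfun 0 1 Wp) (gram_sfun 1 1 Wp)).
have [] := len_rel Wp; rewrite /fr_re0 /fr_im0 /fr_im1.
move: (gram 0 0 p) (gram 0 1 p) (gram 1 1 p) (slope p) (len0 p) (len1 p) isqrt2.
clear=> x y w s a b r r2 a2 sx b2.
congr (_%:C)%C; rewrite -sx in b2 *.
transitivity (r ^+ 2 * (a ^+ 2 * x + b ^+ 2 * (w - s * (s * x)))); first by ring.
by rewrite a2 b2 r2.
Qed.

End null_frame_of_immersion.

Lemma row_comb3 {A : comPzRingType} n (w0 w1 w2 : A) (X Y Z : 'rV[A]_n) i :
  (w0 *: X + w1 *: Y + w2 *: Z) 0 i = w0 * X 0 i + w1 * Y 0 i + w2 * Z 0 i.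
Proof. by rewrite !mxE. Qed.

Lemma sum_ord2 {V : nmodType} (F : 'I_2 -> V) : \sum_i F i = F 0 + F 1.
Proof.
rewrite !big_ord_recl big_ord0 addr0.
by have -> : lift ord0 ord0 = 1 :> 'I_2 by exact: val_inj.
Qed.

(** * Complex vectors split along position, tangent plane and normal space *)

Section complex_expansion.
Context {R : realType} {n k : nat}.
Local Notation C := R[i].
Variables (F E1 E2 : 'rV[R]_n) (nu : 'M[R]_(k, n)) (s : R).
Local Open Scope complex_scope.

Definition frame3 : 'M[R]_(1 + (1 + 1), n) := col_mx F (col_mx E1 E2).

Hypothesis dim : (1 + (1 + 1) + k)%N = n.
Hypothesis ortho : frame3 *m frame3^T = 1%:M.
Hypothesis nu_ortho : nu *m nu^T = 1%:M.
Hypothesis nu_frame : nu *m frame3^T = 0.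
Hypothesis s2 : s ^+ 2 * 2 = 1.

Definition cvec l : C := (s * E1 0 l) +i* (- (s * E2 0 l)).
Definition nu_dot (X : 'I_n -> C) a := \sum_l X l * (nu a l)%:C.

Lemma frame3_complete l m : F 0 l * F 0 m + E1 0 l * E1 0 m + E2 0 l * E2 0 m
  + \sum_a nu a l * nu a m = (l == m)%:R.
Proof.
have := congr1 (fun X : 'M[R]_n => X l m) (orthonormal_parseval dim ortho nu_ortho nu_frame).
rewrite [in X in _ = X]mxE => <-; rewrite [RHS]mxE /frame3 !tr_col_mx !mul_row_col.
rewrite !addrA [RHS]addrC !mxE !big_ord1 !mxE addrC; congr (_ + _).
by apply: eq_bigr => a _; rewrite mxE.
Qed.

(** Completeness of the orthonormal basis [F], [E1], [E2], [nu], with [E1] and [E2] replaced by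
    [cvec] and its conjugate. These are null, so the coefficient of each is the bilinear product
    with the other. *)
Lemma complex_expand (X : 'I_n -> C) m :
  X m = (\sum_l X l * (F 0 l)%:C) * (F 0 m)%:C
    + (\sum_l X l * conjc (cvec l)) * cvec m + (\sum_l X l * cvec l) * conjc (cvec m)
    + \sum_a nu_dot X a * (nu a m)%:C.
Proof.
have delta l : (F 0 l)%:C * (F 0 m)%:C + conjc (cvec l) * cvec m + cvec l * conjc (cvec m)
    + \sum_a (nu a l)%:C * (nu a m)%:C = (l == m)%:R.
  have -> : \sum_a (nu a l)%:C * (nu a m)%:C = (\sum_a nu a l * nu a m)%:C.
    by rewrite rmorph_sum; apply: eq_bigr => a _; rewrite rmorphM.
  have := frame3_complete l m; rewrite /cvec.
  move: (\sum_a nu a l * nu a m) (F 0 l) (F 0 m) (E1 0 l) (E1 0 m) (E2 0 l) (E2 0 m).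
  move=> t f1 f2 a1 a2 b1 b2 h.
  have -> : (l == m)%:R = ((l == m)%:R : R)%:C by rewrite rmorph_nat.
  rewrite -h; apply/eqP; rewrite eq_complex /=; apply/andP; split; apply/eqP; last by ring.
  transitivity (f1 * f2 + s ^+ 2 * 2 * (a1 * a2 + b1 * b2) + t); first by ring.
  by rewrite s2; ring.
transitivity (\sum_l X l * (l == m)%:R).
  rewrite (bigD1 m) //= eqxx mulr1 big1 ?addr0 // => l /negPf ->.
  by rewrite mulr0.
have -> : \sum_a nu_dot X a * (nu a m)%:C = \sum_l X l * \sum_a (nu a l)%:C * (nu a m)%:C.
  under eq_bigr do rewrite mulr_suml.
  rewrite exchange_big /=; apply: eq_bigr => l _; rewrite mulr_sumr.
  by apply: eq_bigr => a _; rewrite mulrA.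
rewrite !mulr_suml -!big_split /=; apply: eq_bigr => l _.
by rewrite -delta !mulrDr !mulrA.
Qed.

Lemma complex_normal_sqnorm (X : 'I_n -> C) :
  \sum_l X l * (F 0 l)%:C = 0 -> \sum_l X l * cvec l = 0 ->
  \sum_l X l * conjc (cvec l) = 0 ->
  \sum_l X l * conjc (X l) = \sum_a nu_dot X a * conjc (nu_dot X a).
Proof.
move=> h0 h1 h2.
have e m : X m = \sum_a nu_dot X a * (nu a m)%:C.
  by rewrite [LHS]complex_expand h0 h1 h2 !mul0r !add0r.
transitivity (\sum_m X m * \sum_a conjc (nu_dot X a) * (nu a m)%:C).
  apply: eq_bigr => m _; congr (_ * _); rewrite [in LHS]e rmorph_sum.
  by apply: eq_bigr => a _; rewrite rmorphM; congr (_ * _); exact: conjc_real.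
under eq_bigr do rewrite mulr_sumr.
rewrite exchange_big /=; apply: eq_bigr => a _; rewrite mulr_suml.
by apply: eq_bigr => m _; ring.
Qed.

End complex_expansion.

Lemma gram_schmidt_orthonormal {R : realType} n (F X Y : 'rV[R]_n) (g0 g2 a b s : R) :
  dotp F F = 1 -> dotp F X = 0 -> dotp F Y = 0 -> dotp X X = g0 ->
  dotp X Y = s * g0 -> dotp Y Y = g2 -> a ^+ 2 * g0 = 1 ->
  b ^+ 2 * (g2 - s * (s * g0)) = 1 ->
  frame3 F (a *: X) (b *: (Y + - s *: X)) *m
    (frame3 F (a *: X) (b *: (Y + - s *: X)))^T = 1%:M.
Proof.
move=> FF FX FY XX XY YY a1 b1.
have Z0 : dotp F (b *: (Y + - s *: X)) = 0.
  by rewrite dotpZr dotpDr dotpZr FX FY !mulr0 addr0 mulr0.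
have A0 : dotp F (a *: X) = 0 by rewrite dotpZr FX mulr0.
have A1 : dotp (a *: X) (a *: X) = 1 by rewrite dotpZr dotpZl XX mulrA -expr2.
have AZ : dotp (a *: X) (b *: (Y + - s *: X)) = 0.
  by rewrite dotpZr dotpDr dotpZr !dotpZl XX XY; ring.
have Z1 : dotp (b *: (Y + - s *: X)) (b *: (Y + - s *: X)) = 1.
  rewrite -b1 dotpZr dotpZl dotpDr !dotpDl !dotpZr !dotpZl XX YY (dotpC Y X) XY.
  by ring.
move: (a *: X) (b *: _) Z0 A0 A1 AZ Z1 => P Q Z0 A0 A1 AZ Z1.
rewrite /frame3 !tr_col_mx !mul_col_row !mul_col_mx !mul_mx_row !mul_rV_dotp.
rewrite FF Z0 A0 A1 AZ Z1 (dotpC Q P) AZ (dotpC P F) A0 (dotpC Q F) Z0.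
by rewrite !raddf0 /= row_mx0 col_mx0 -!scalar_mx_block.
Qed.

Lemma nu_dot5 {R : realType} n k (nu : 'M[R]_(k, n)) (a0 a1 a2 a3 a4 : R[i])
    (X0 X1 X2 X3 X4 : 'I_n -> R[i]) a :
  nu_dot nu (fun m => a0 * X0 m + a1 * X1 m + a2 * X2 m + a3 * X3 m + a4 * X4 m) a =
  a0 * nu_dot nu X0 a + a1 * nu_dot nu X1 a + a2 * nu_dot nu X2 a
  + a3 * nu_dot nu X3 a + a4 * nu_dot nu X4 a.
Proof.
rewrite /nu_dot !mulr_sumr -!big_split /=; apply: eq_bigr => m _.
by rewrite !mulrDl !mulrA.
Qed.

Lemma frame3_tangent {R : realType} n (F X Y : 'rV[R]_n) :
  frame3 F X Y *m (frame3 F X Y)^T = 1%:M ->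
  [/\ dotp X X = 1, dotp X Y = 0 & dotp Y Y = 1].
Proof.
have scalar1_inj (a b : R) : (a%:M = b%:M :> 'M[R]_1) -> a = b.
  by move/(congr1 (fun Z : 'M[R]_1 => Z 0 0)); rewrite !mxE.
rewrite /frame3 !tr_col_mx !mul_col_row (scalar_mx_block 1 (1 + 1)).
move=> /eq_block_mx[_ _ _]; rewrite (scalar_mx_block 1 1).
move=> /eq_block_mx[]; rewrite !mul_rV_dotp => /scalar1_inj XX + _ /scalar1_inj YY.
by rewrite -(raddf0 (@scalar_mx R 1)) => /scalar1_inj XY; split.
Qed.

(** [n - 2] is a truncated difference; the hypothesis, which comes from the orthonormality of three
    vectors, excludes truncation. *)
Lemma dim3 n : (1 + (1 + 1) <= n.+1)%N -> (1 + (1 + 1) + (n - 2))%N = n.+1.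
Proof. by case: n => [|[|n]] // _; rewrite !subSS subn0. Qed.

(** * Adapted frames and the components of the second fundamental form *)

Section curvature_of_immersion.
Context {R : realType} {M : riemannianManifold R 2} {N : nat}.
Variable Phi : M -> 'rV[R]_N.+1.
Hypothesis Phi_spherical : spherical Phi.
Hypothesis Phi_immersion : immersion Phi.

Variables (W0 : opens M) (c : chart R 2 M).
Local Notation W := (oset W0).
Hypotheses (ac : atlas c) (Wc : W `<=` dom c).
Local Notation A := (sfun W0).
Local Notation cj := (@sfun_conj R M W0).
Local Notation f := (position Phi_immersion W0).
Local Notation del k := (pder ac Wc (delta_mx 0 k)).
Local Notation dPhi := (differential Phi c).
Local Notation e_ k := (delta_mx 0 k : 'rV[R]_2).
Local Notation fr0 := (fr0 Phi_immersion ac Wc).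
Local Notation fr1 := (fr1 Phi_immersion ac Wc).
Local Notation D := (field_der (del 0) (del 1) fr0 fr1).
Local Notation l0 := (len0 Phi c).
Local Notation l1 := (len1 Phi c).
Local Notation sl := (slope Phi c).

#[local] Opaque dotp differential differential2 position.

Definition tangent0 p := l0 p *: dPhi p (e_ 0).
Definition tangent1 p := l1 p *: (dPhi p (e_ 1) + - sl p *: dPhi p (e_ 0)).
Local Notation B p := (frame3 (Phi p) (tangent0 p) (tangent1 p)).

Lemma position_tangent k p : W p -> dotp (Phi p) (dPhi p (e_ k)) = 0.
Proof.
move=> Wp.
have h : dot f (map_mx (del k) f) = 0.
  exact: (fz 0 (pderD ac Wc (e_ k)) (pderM ac Wc (e_ k)) (@sfun_two_reg _ _ W0)
    (position_dot Phi_spherical Phi_immersion W0)).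
have := congr1 (fun a : A => sfun_val a p) h.
rewrite sval_dot // sval0 // => h'; apply: complexI; rewrite dotpE rmorph_sum /=.
rewrite -[RHS]h'; apply: eq_bigr => i _; rewrite rmorphM; symmetry.
apply: f_equal2; first by rewrite mxE srealE.
by rewrite mxE; exact: pder_positionE.
Qed.

Lemma frame3_orthonormal p : W p -> B p *m (B p)^T = 1%:M.
Proof.
move=> Wp; have g := slopeE Phi_immersion ac Wc Wp.
apply: (@gram_schmidt_orthonormal _ _ _ _ _ (gram Phi c 0 0 p) (gram Phi c 1 1 p)).
- exact: Phi_spherical.
- exact: position_tangent.
- exact: position_tangent.
- exact: erefl.
- by rewrite g.
- exact: erefl.
- exact: (len0E Phi_immersion ac Wc Wp).
- by rewrite g; exact: (len1E Phi_immersion ac Wc Wp).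
Qed.

Lemma frame3_dim p : W p -> (1 + (1 + 1) + (N - 2))%N = N.+1.
Proof.
by move=> Wp; apply: dim3; exact: orthonormal_leq (frame3_orthonormal Wp).
Qed.

Lemma normal_frame_exists p : W p -> exists nu : 'M[R]_(N - 2, N.+1),
  nu *m nu^T = 1%:M /\ nu *m (B p)^T = 0.
Proof.
move=> Wp; apply: orthonormal_completion (frame3_orthonormal Wp) _.
by rewrite (frame3_dim Wp).
Qed.

Lemma differential_tangentE p v : W p -> exists a b, dPhi p v = a *: tangent0 p + b *: tangent1 p.
Proof.
move=> Wp; rewrite (differentialE Phi_immersion ac Wc v Wp) /tangent0 /tangent1.
have a0 := lt0r_neq0 (len0_gt0 Phi_immersion ac Wc Wp).
have b0 := lt0r_neq0 (len1_gt0 Phi_immersion ac Wc Wp).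
have -> : dPhi p ev0 = dPhi p (e_ 0) by [].
have -> : dPhi p ev1 = dPhi p (e_ 1) by [].
exists ((v 0 0 + v 0 1 * sl p) / l0 p), (v 0 1 / l1 p).
move: (dPhi p _) (dPhi p _) (v 0 0) (v 0 1) (l0 p) (l1 p) (sl p) a0 b0.
move=> X Y v0 v1 a b s a0 b0; apply/rowP => i; rewrite !mxE.
by field; rewrite a0 b0.
Qed.

Lemma normal_frameP p (nu : 'M[R]_(N - 2, N.+1)) : W p ->
  nu *m (B p)^T = 0 <-> (forall a, dotp (row a nu) (Phi p) = 0) /\
    (forall a v, dotp (row a nu) (dPhi p v) = 0).
Proof.
move=> Wp; rewrite /frame3 !tr_col_mx !mul_mx_row -!row_mx0; split.
  move=> /eq_row_mx[n0 /eq_row_mx[n1 n2]].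
  have r (w : 'rV[R]_N.+1) a : nu *m w^T = 0 -> dotp (row a nu) w = 0.
    by move=> h; rewrite -mul_mx_dotp h mxE.
  split=> [a|a v]; first exact: r.
  have [x [y ->]] := differential_tangentE v Wp.
  by rewrite dotpDr (dotpZr x) (dotpZr y) (r _ _ n1) (r _ _ n2) !mulr0 addr0.
move=> [n0 n1].
have r (w : 'rV[R]_N.+1) : (forall a, dotp (row a nu) w = 0) -> nu *m w^T = 0.
  by move=> h; apply/matrixP => a j; rewrite (ord1 j) mul_mx_dotp h mxE.
congr row_mx; first exact: r.
congr row_mx; apply: r => a.
  by rewrite /tangent0 dotpZr n1 mulr0.
by rewrite /tangent1 dotpZr dotpDr dotpZr !n1 mulr0 addr0 mulr0.
Qed.

Definition tangent_coords p : 'M[R]_2 := \matrix_(i, j)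
  (if i == 0 then (if j == 0 then l0 p else 0)
   else (if j == 0 then - (l1 p * sl p) else l1 p)).
Local Notation ec p := (tangent_coords p).

Lemma tangent_coords0 p : W p -> dPhi p (row 0 (ec p)) = tangent0 p.
Proof.
move=> Wp; rewrite (differentialE Phi_immersion ac Wc _ Wp) !mxE /=.
by rewrite scale0r addr0.
Qed.

Lemma tangent_coords1 p : W p -> dPhi p (row 1 (ec p)) = tangent1 p.
Proof.
move=> Wp; rewrite (differentialE Phi_immersion ac Wc _ Wp) !mxE /=.
rewrite /tangent1; move: (dPhi p ev0) (dPhi p ev1) => X Y.
by rewrite scalerDr scalerA mulrN addrC.
Qed.

End curvature_of_immersion.

Section second_fundamental_form.
Context {R : realType} {M : riemannianManifold R 2} {N : nat}.
Variable Phi : M -> 'rV[R]_N.+1.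
Hypothesis Phi_immersion : immersion Phi.

Variables (W0 : opens M) (c : chart R 2 M).
Local Notation W := (oset W0).
Hypotheses (ac : atlas c) (Wc : W `<=` dom c).
Local Notation cj := (@sfun_conj R M W0).
Local Notation f := (position Phi_immersion W0).
Local Notation del k := (pder ac Wc (delta_mx 0 k)).
Local Notation dPhi := (differential Phi c).
Local Notation ddPhi := (differential2 Phi c).
Local Notation e_ k := (delta_mx 0 k : 'rV[R]_2).
Local Notation fr0 := (fr0 Phi_immersion ac Wc).
Local Notation fr1 := (fr1 Phi_immersion ac Wc).
Local Notation "X ^c" := (map_mx cj X).
Local Notation D := (field_der (del 0) (del 1) fr0 fr1).
Local Notation E := (cjder D cj).
Local Notation z := (map_mx D f).
Local Notation l0 := (len0 Phi c).
Local Notation l1 := (len1 Phi c).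
Local Notation sl := (slope Phi c).

#[local] Opaque dotp differential differential2 position.

Local Notation t0 := (tangent0 Phi c).
Local Notation t1 := (tangent1 Phi c).
Local Notation B p := (frame3 (Phi p) (t0 p) (t1 p)).
Local Notation ec p := (tangent_coords Phi c p).
Local Notation cvec3 p := (cvec (t0 p) (t1 p) isqrt2).

Definition second_form p (nu : 'M[R]_(N - 2, N.+1)) a : 'M[R]_2 :=
  \matrix_(k, l) dotp (ddPhi p (e_ k) (e_ l)) (row a nu).

Lemma sffE p (e : 'M[R]_2) nu i j a : W p ->
  sff Phi c p e nu i j a = (e *m second_form p nu a *m e^T) i j.
Proof.
move=> Wp; rewrite sff_differential2.
rewrite (differential2E Phi_immersion ac Wc _ _ Wp) dotp_suml.
transitivity (\sum_k \sum_l e i k * e j l * second_form p nu a k l).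
  apply: eq_bigr => k _; rewrite dotp_suml; apply: eq_bigr => l _.
  rewrite dotpZl [second_form _ _ _ _ _]mxE.
  by rewrite [row i e 0 k]mxE [row j e 0 l]mxE.
rewrite exchange_big [RHS]mxE /=; apply: eq_bigr => l _.
rewrite mxE mulr_suml; apply: eq_bigr => k _; rewrite [e^T l j]mxE.
by rewrite mulrAC.
Qed.

Lemma second_form_sym p nu a : W p -> (second_form p nu a)^T = second_form p nu a.
Proof.
move=> Wp; apply/matrixP => k l; rewrite mxE [LHS]mxE [RHS]mxE.
by rewrite (differential2_sym Phi_immersion ac Wc (e_ l) (e_ k) Wp).
Qed.

Lemma sval_frame l p : W p -> sfun_val (z 0 l) p = cvec3 p l.
Proof.
move=> Wp; have -> : z 0 l = fr0 * del 0 (f 0 l) + fr1 * del 1 (f 0 l) by rewrite mxE.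
have e0 := pder_positionE Phi_immersion ac Wc (e_ 0) l Wp.
have e1 := pder_positionE Phi_immersion ac Wc (e_ 1) l Wp.
have f0E : fr0 p = Complex (fr_re0 Phi c p) (fr_im0 Phi c p) by exact: sfun_ofE.
have f1E : fr1 p = Complex 0 (fr_im1 Phi c p) by exact: sfun_ofE.
have t0E : t0 p 0 l = l0 p * dPhi p (e_ 0) 0 l by rewrite mxE.
have t1E : t1 p 0 l = l1 p * (dPhi p (e_ 1) 0 l + - sl p * dPhi p (e_ 0) 0 l) by rewrite !mxE.
rewrite /cvec t0E t1E.
have -> : sfun_val (fr0 * del 0 (f 0 l) + fr1 * del 1 (f 0 l)) p =
    fr0 p * sfun_val (del 0 (f 0 l)) p + fr1 p * sfun_val (del 1 (f 0 l)) p.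
  by apply: (etrans (svalD _ _ Wp)); apply: f_equal2; exact: svalM.
rewrite e0 e1 f0E f1E /fr_re0 /fr_im0 /fr_im1.
move: (dPhi p (e_ 0) 0 l) (dPhi p (e_ 1) 0 l) (l0 p) (l1 p) (sl p) isqrt2.
clear=> x y a b s r; apply/eqP; rewrite eq_complex /=.
by apply/andP; split; apply/eqP; ring.
Qed.

Section normal_components.
Variables (p : M) (nu : 'M[R]_(N - 2, N.+1)).
Hypothesis Wp : W p.
Hypothesis nuB : nu *m (B p)^T = 0.

Lemma normal_first k a : nu_dot nu (fun l => sfun_val (del k (f 0 l)) p) a = 0.
Proof.
have [_ h] := (normal_frameP Phi_immersion ac Wc nu Wp).1 nuB.
have := congr1 (real_complex R) (h a (e_ k)); rewrite dotpE rmorph_sum rmorph0 => <-.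
apply: eq_bigr => l _; rewrite [RHS]rmorphM mulrC; apply: f_equal2; first by rewrite mxE.
exact: pder_positionE.
Qed.

Lemma normal_second k l a :
  nu_dot nu (fun m => sfun_val (del k (del l (f 0 m))) p) a =
  (second_form p nu a k l)%:C%C.
Proof.
rewrite mxE dotpE rmorph_sum; apply: eq_bigr => m _; rewrite [RHS]rmorphM.
apply: f_equal2; last by rewrite mxE.
exact: pder2_positionE.
Qed.

Lemma nu_dot_comb (a00 a01 a11 b0 b1 : R[i]) a :
  nu_dot nu (fun m => a00 * sfun_val (del 0 (del 0 (f 0 m))) p
    + a01 * sfun_val (del 0 (del 1 (f 0 m))) p
    + a11 * sfun_val (del 1 (del 1 (f 0 m))) p
    + b0 * sfun_val (del 0 (f 0 m)) p + b1 * sfun_val (del 1 (f 0 m)) p) a =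
  a00 * (second_form p nu a 0 0)%:C%C + a01 * (second_form p nu a 0 1)%:C%C
  + a11 * (second_form p nu a 1 1)%:C%C.
Proof.
rewrite nu_dot5 (normal_first 0 a) (normal_first 1 a) !mulr0 !addr0.
have n0 := normal_second 0 0 a; have n1 := normal_second 0 1 a.
have n2 := normal_second 1 1 a.
exact: (f_equal2 +%R (f_equal2 +%R (congr1 ( *%R a00) n0) (congr1 ( *%R a01) n1))
  (congr1 ( *%R a11) n2)).
Qed.

Definition frame_form a := ec p *m second_form p nu a *m (ec p)^T.

Lemma frame_formE a :
  [/\ frame_form a 0 0 = l0 p ^+ 2 * second_form p nu a 0 0,
   frame_form a 0 1 = l0 p * l1 p * (second_form p nu a 0 1 - sl p * second_form p nu a 0 0),
   frame_form a 1 0 = frame_form a 0 1 &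
   frame_form a 1 1 = l1 p ^+ 2 * (sl p ^+ 2 * second_form p nu a 0 0
     - 2 * sl p * second_form p nu a 0 1 + second_form p nu a 1 1)].
Proof.
have sym : second_form p nu a 1 0 = second_form p nu a 0 1.
  have := congr1 (fun X : 'M[R]_2 => X 1 0) (second_form_sym nu a Wp).
  by rewrite [X in X = _ -> _]mxE => ->.
have e2 : lift ord0 ord0 = 1 :> 'I_2 by exact: val_inj.
have H (X e : 'M[R]_2) i j : (e *m X *m e^T) i j =
    e i 0 * X 0 0 * e j 0 + e i 1 * X 1 0 * e j 0 + (e i 0 * X 0 1 * e j 1 + e i 1 * X 1 1 * e j 1).
  rewrite !mxE !big_ord_recl !big_ord0 !mxE !big_ord_recl !big_ord0 e2.
  by rewrite !addr0 !mulrDl.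
have [c00 c01 c10 c11] : [/\ ec p 0 0 = l0 p, ec p 0 1 = 0, ec p 1 0 = - (l1 p * sl p) & ec p 1 1 = l1 p].
  by split; rewrite mxE.
rewrite /frame_form !H c00 c01 c10 c11 sym.
move: (second_form p nu a 0 0) (second_form p nu a 0 1) (second_form p nu a 1 1) => x y w.
by split; ring.
Qed.

Let f0E : fr0 p = Complex (fr_re0 Phi c p) (fr_im0 Phi c p).
Proof. exact: sfun_ofE. Qed.
Let f1E : fr1 p = Complex 0 (fr_im1 Phi c p).
Proof. exact: sfun_ofE. Qed.

(** [nu] annihilates the first order part of [E D f]. What is left is half the trace of the second
    fundamental form in an orthonormal basis, that is, the mean curvature. *)
Lemma normal_mean a : nu_dot nu (fun m => sfun_val (E (D (f 0 m))) p) a =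
  (isqrt2 ^+ 2 * (frame_form a 0 0 + frame_form a 1 1))%:C%C.
Proof.
have [P [Q h]] := @cjfield_der2E _ (del 0) (del 1) cj fr0 fr1 (@sfun_conjK _ _ W0)
  (pderD ac Wc _) (pderM ac Wc _) (pderD ac Wc _) (pderM ac Wc _) (pderC ac Wc _ _)
  (conj_pder ac Wc _) (conj_pder ac Wc _).
transitivity (nu_dot nu (fun m =>
    (conjc (fr0 p) * fr0 p) * sfun_val (del 0 (del 0 (f 0 m))) p
    + (conjc (fr0 p) * fr1 p + conjc (fr1 p) * fr0 p) * sfun_val (del 0 (del 1 (f 0 m))) p
    + (conjc (fr1 p) * fr1 p) * sfun_val (del 1 (del 1 (f 0 m))) p
    + P p * sfun_val (del 0 (f 0 m)) p + Q p * sfun_val (del 1 (f 0 m)) p) a).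
  apply: eq_bigr => m _; congr (_ * _); rewrite h.
  move: (del 0 (del 0 (f 0 m))) (del 0 (del 1 (f 0 m))) (del 1 (del 1 (f 0 m))).
  move: (del 0 (f 0 m)) (del 1 (f 0 m)) fr0 fr1 => x0 x1 a0 a1 x00 x01 x11.
  by rewrite !(svalD _ _ Wp) !(svalM _ _ Wp) !(svalD _ _ Wp) !(svalM _ _ Wp) !(sfun_conjE _ Wp).
rewrite nu_dot_comb f0E f1E.
have [-> _ _ ->] := frame_formE a; rewrite /fr_re0 /fr_im0 /fr_im1.
move: (second_form p nu a 0 0) (second_form p nu a 0 1) (second_form p nu a 1 1).
move: (l0 p) (l1 p) (sl p) isqrt2; clear=> b0 b1 s r x y w.
by apply/eqP; rewrite eq_complex /=; apply/andP; split; apply/eqP; ring.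
Qed.

(** The formal square of [(E1 - i E2) / sqrt 2] is [(E1^2 - E2^2) / 2 - i E1 E2], so [hess] carries
    the trace-free part of the second fundamental form. The terms in [rho] are tangential. *)
Lemma normal_hess rho a : nu_dot nu (fun m => sfun_val (hess D rho f 0 m) p) a =
  Complex (isqrt2 ^+ 2 * (frame_form a 0 0 - frame_form a 1 1))
    (- (isqrt2 ^+ 2 * 2 * frame_form a 0 1)).
Proof.
have [P [Q h]] := @field_der2E _ (del 0) (del 1) fr0 fr1
  (pderD ac Wc _) (pderM ac Wc _) (pderD ac Wc _) (pderM ac Wc _) (pderC ac Wc _ _).
transitivity (nu_dot nu (fun m =>
    (fr0 p * fr0 p) * sfun_val (del 0 (del 0 (f 0 m))) p
    + (fr0 p * fr1 p + fr0 p * fr1 p) * sfun_val (del 0 (del 1 (f 0 m))) p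
    + (fr1 p * fr1 p) * sfun_val (del 1 (del 1 (f 0 m))) p
    + (P p + rho p * fr0 p) * sfun_val (del 0 (f 0 m)) p
    + (Q p + rho p * fr1 p) * sfun_val (del 1 (f 0 m)) p) a).
  apply: eq_bigr => m _; congr (_ * _).
  have -> : hess D rho f 0 m = D (D (f 0 m)) + rho * D (f 0 m).
    by rewrite /hess mxE /nab mulr1z mul1r mxE.
  rewrite h /field_der.
  move: (del 0 (del 0 (f 0 m))) (del 0 (del 1 (f 0 m))) (del 1 (del 1 (f 0 m))).
  move: (del 0 (f 0 m)) (del 1 (f 0 m)) fr0 fr1 => x0 x1 a0 a1 x00 x01 x11.
  rewrite !(svalD _ _ Wp) !(svalM _ _ Wp) !(svalD _ _ Wp) !(svalM _ _ Wp).
  by ring.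
rewrite nu_dot_comb f0E f1E.
have [-> -> _ ->] := frame_formE a; rewrite /fr_re0 /fr_im0 /fr_im1.
move: (second_form p nu a 0 0) (second_form p nu a 0 1) (second_form p nu a 1 1).
move: (l0 p) (l1 p) (sl p) isqrt2; clear=> b0 b1 s r x y w.
by apply/eqP; rewrite eq_complex /=; apply/andP; split; apply/eqP; ring.
Qed.
End normal_components.

End second_fundamental_form.

(** * Minimality and the value of [S] in the null frame *)

Section shape_norm.
Context {R : realType} {M : riemannianManifold R 2} {N : nat}.
Variable Phi : M -> 'rV[R]_N.+1.
Hypothesis Phi_spherical : spherical Phi.
Hypothesis Phi_immersion : immersion Phi.
Hypothesis Phi_isometric : isometric Phi.
Hypothesis Phi_minimal : minimal Phi.

Variables (W0 : opens M) (c : chart R 2 M).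
Local Notation W := (oset W0).
Hypotheses (ac : atlas c) (Wc : W `<=` dom c).
Local Notation cj := (@sfun_conj R M W0).
Local Notation f := (position Phi_immersion W0).
Local Notation del k := (pder ac Wc (delta_mx 0 k)).
Local Notation fr0 := (fr0 Phi_immersion ac Wc).
Local Notation fr1 := (fr1 Phi_immersion ac Wc).
Local Notation "X ^c" := (map_mx cj X).
Local Notation D := (field_der (del 0) (del 1) fr0 fr1).
Local Notation E := (cjder D cj).
Local Notation z := (map_mx D f).

#[local] Opaque dotp differential differential2 position.

Local Notation t0 := (tangent0 Phi c).
Local Notation t1 := (tangent1 Phi c).
Local Notation B p := (frame3 (Phi p) (t0 p) (t1 p)).
Local Notation ec p := (tangent_coords Phi c p).
Local Notation cvec3 p := (cvec (t0 p) (t1 p) isqrt2).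

Local Notation sfm p nu := (second_form Phi c p nu).
Local Notation ff p nu := (frame_form Phi c p nu).

Lemma tangent_coords_orthonormal p : W p -> ec p *m metric c (Defs.coord c p) *m (ec p)^T = 1%:M.
Proof.
move=> Wp; have [xx xy yy] := frame3_tangent (frame3_orthonormal Phi_spherical Phi_immersion ac Wc Wp).
have yx : dotp (t1 p) (t0 p) = 0 by rewrite dotpC.
have E0 := tangent_coords0 Phi_immersion ac Wc Wp.
have E1 := tangent_coords1 Phi_immersion ac Wc Wp.
apply/matrixP => i j; rewrite (isometric_gram Phi_isometric ac Wc _ _ _ Wp) [RHS]mxE.
have cases (k : 'I_2) : k = 0 \/ k = 1.
  by case: k => [[|[|//]] Hk]; [left|right]; exact: val_inj.
have [-> | ->] := cases i; have [-> | ->] := cases j.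
- by rewrite E0.
- by rewrite E0 E1.
- by rewrite E0 E1.
- by rewrite E1.
Qed.

Lemma tangent_coords_adapted p nu : W p -> nu *m nu^T = 1%:M -> nu *m (B p)^T = 0 ->
  adapted_frame Phi c p (ec p) nu.
Proof.
move=> Wp nn nB; have [n0 n1] := (normal_frameP Phi_immersion ac Wc nu Wp).1 nB.
by split=> //; exact: tangent_coords_orthonormal.
Qed.

Lemma frame_form_trace p nu a : W p -> nu *m nu^T = 1%:M -> nu *m (B p)^T = 0 ->
  ff p nu a 0 0 + ff p nu a 1 1 = 0.
Proof.
move=> Wp nn nB; have h := Phi_minimal ac (Wc Wp) (tangent_coords_adapted Wp nn nB) a.
apply: (etrans _ h); apply: (etrans _ (esym (sum_ord2 _))).
by apply: f_equal2; symmetry; exact: (sffE Phi_immersion ac Wc).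
Qed.

(** By minimality the expansion of [E z] has no normal part. The normal frame is chosen point by
    point, without continuity, but the three coefficients are dot products of elements of the ring
    and hence smooth. *)
Lemma frame_mean0 : exists x y w, map_mx E z = x *: f + y *: z + w *: z^c.
Proof.
exists (dot (map_mx E z) f), (dot (map_mx E z) z^c), (dot (map_mx E z) z).
apply/rowP => i; rewrite [LHS]mxE [z 0 i]mxE; apply: sfunP => p Wp.
have [nu [nn nB]] := normal_frame_exists Phi_spherical Phi_immersion ac Wc Wp.
pose X l := sfun_val (E (D (f 0 l))) p.
have XE l : sfun_val (map_mx E z 0 l) p = X l by rewrite mxE [z 0 l]mxE.
have fE l : sfun_val (f 0 l) p = (Phi p 0 l)%:C%C by exact: positionE.
have zE l : sfun_val (z 0 l) p = cvec3 p l by exact: sval_frame.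
have zcE l : sfun_val (z^c 0 l) p = conjc (cvec3 p l).
  by rewrite mxE; apply: (etrans (sfun_conjE _ Wp)); rewrite zE.
have d0 : dot (map_mx E z) f p = \sum_l X l * (Phi p 0 l)%:C%C.
  by rewrite (sval_dot _ _ Wp); apply: eq_bigr => l _; rewrite XE fE.
have d1 : dot (map_mx E z) z^c p = \sum_l X l * conjc (cvec3 p l).
  by rewrite (sval_dot _ _ Wp); apply: eq_bigr => l _; rewrite XE zcE.
have d2 : dot (map_mx E z) z p = \sum_l X l * cvec3 p l.
  by rewrite (sval_dot _ _ Wp); apply: eq_bigr => l _; rewrite XE zE.
have n0 a : nu_dot nu X a = 0.
  apply: (etrans (normal_mean Phi_immersion ac Wc Wp nB a)).
  by rewrite frame_form_trace // mulr0.
apply: (etrans (complex_expand (frame3_dim Phi_spherical Phi_immersion ac Wc Wp)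
  (frame3_orthonormal Phi_spherical Phi_immersion ac Wc Wp) nn nB isqrt2E X i)).
rewrite -d0 -d1 -d2.
rewrite -fE -zcE -zE big1 => [|a _]; last by rewrite n0 mul0r.
rewrite addr0; move: (dot _ f) (dot _ z^c) (dot _ z) => w0 w1 w2.
have -> : (w0 *: f + w1 *: z + w2 *: z^c) 0 i = w0 * f 0 i + w1 * z 0 i + w2 * z^c 0 i.
  exact: row_comb3.
move: (f 0 i) (z 0 i) (z^c 0 i) => y0 y1 y2.
by rewrite !(svalD _ _ Wp) !(svalM _ _ Wp).
Qed.

Definition connection := frame_rho (del 0) (del 1) cj fr0 fr1 f.

Lemma frame_derD a b : D (a + b) = D a + D b.
Proof. exact: (field_derD _ _ (pderD ac Wc _) (pderD ac Wc _)). Qed.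

Lemma frame_derM a b : D (a * b) = D a * b + a * D b.
Proof. exact: (field_derM _ _ (pderM ac Wc _) (pderM ac Wc _)). Qed.

Lemma frame_minimal : map_mx E z = - f + cj connection *: z.
Proof.
exact: (coordinate_minimal 0 (@sfun_conjK _ _ W0) (pderD ac Wc _) (pderM ac Wc _)
  (pderD ac Wc _) (pderM ac Wc _) (@sfun_two_reg _ _ W0) (position_conj Phi_immersion W0)
  (position_dot Phi_spherical Phi_immersion W0) (frame_null Phi_immersion ac Wc)
  (frame_unit Phi_immersion ac Wc) frame_mean0).
Qed.

Lemma frame_comm a : D (E a) = E (D a) + connection * E a - cj connection * D a.
Proof.
exact: (coordinate_comm (@sfun_conjK _ _ W0) (pderD ac Wc _) (pderM ac Wc _)
  (pderD ac Wc _) (pderM ac Wc _) (pderC ac Wc _ _) (conj_pder ac Wc _)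
  (conj_pder ac Wc _) (@sfun_two_reg _ _ W0) (fr_det_inv Phi_immersion ac Wc)
  (position_conj Phi_immersion W0)
  (position_dot Phi_spherical Phi_immersion W0) (frame_null Phi_immersion ac Wc)
  (frame_unit Phi_immersion ac Wc) frame_mean0).
Qed.

Local Notation H := (hess D connection f).

(** [H] is purely normal, so [u] is the sum over the normal directions of [|x - i y|^2], where [x]
    and [y] are the entries of the symmetric trace-free matrix [ff], whose squared norm is twice
    that. Passing to the frame [e] is [sqnorm_gram_eq]. *)
Lemma sff_sum p e nu : W p -> adapted_frame Phi c p e nu ->
  \sum_i \sum_j \sum_a sff Phi c p e nu i j a ^+ 2 =
  2 * complex.Re (sfun_val (hsq D cj connection f) p).
Proof.
move=> Wp [eG nn n0 n1].
have nB : nu *m (B p)^T = 0 by apply: (normal_frameP Phi_immersion ac Wc nu Wp).2.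
have ee := gram_orthonormal_eq eG (tangent_coords_orthonormal Wp).
have dD := frame_derD; have dM := frame_derM.
have zz := frame_null Phi_immersion ac Wc; have zzb := frame_unit Phi_immersion ac Wc.
have fr := position_conj Phi_immersion W0.
have f1 := position_dot Phi_spherical Phi_immersion W0.
have h0 := Hf connection dD dM (@sfun_two_reg _ _ W0) f1 zz.
have h1 := Hz connection dD dM (@sfun_two_reg _ _ W0) zz.
have h2 := Hzb (@sfun_conjK _ _ W0) dD dM (@sfun_two_reg _ _ W0) fr f1 zzb frame_minimal.
pose X l := sfun_val (H 0 l) p.
have fE l : sfun_val (f 0 l) p = (Phi p 0 l)%:C%C by exact: positionE.
have zE l : sfun_val (z 0 l) p = cvec3 p l by exact: sval_frame.
have zcE l : sfun_val (z^c 0 l) p = conjc (cvec3 p l).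
  by rewrite mxE; apply: (etrans (sfun_conjE _ Wp)); rewrite zE.
have HcE l : sfun_val (H^c 0 l) p = conjc (X l).
  by rewrite mxE; exact: (sfun_conjE _ Wp).
have d0 : \sum_l X l * (Phi p 0 l)%:C%C = 0.
  transitivity (sfun_val (dot H f) p); last by rewrite h0; exact: sval0.
  by rewrite (sval_dot _ _ Wp); apply: eq_bigr => l _; rewrite fE.
have d1 : \sum_l X l * cvec3 p l = 0.
  transitivity (sfun_val (dot H z) p); last by rewrite h1; exact: sval0.
  by rewrite (sval_dot _ _ Wp); apply: eq_bigr => l _; rewrite zE.
have d2 : \sum_l X l * conjc (cvec3 p l) = 0.
  transitivity (sfun_val (dot H z^c) p); last by rewrite h2; exact: sval0.
  by rewrite (sval_dot _ _ Wp); apply: eq_bigr => l _; rewrite zcE.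
have -> : sfun_val (hsq D cj connection f) p = \sum_l X l * conjc (X l).
  by rewrite /hsq (sval_dot _ _ Wp); apply: eq_bigr => l _; rewrite HcE.
rewrite (complex_normal_sqnorm (frame3_dim Phi_spherical Phi_immersion ac Wc Wp)
  (frame3_orthonormal Phi_spherical Phi_immersion ac Wc Wp) nn nB isqrt2E d0 d1 d2).
rewrite (raddf_sum (@complex.Re R : {additive _ -> _})) mulr_sumr.
transitivity (\sum_a \sum_i \sum_j sff Phi c p e nu i j a ^+ 2).
  under eq_bigr do rewrite exchange_big /=.
  by rewrite exchange_big.
apply: eq_bigr => a _.
transitivity (\sum_i \sum_j ff p nu a i j ^+ 2).
  rewrite -(sqnorm_gram_eq (sfm p nu a) ee); apply: eq_bigr => i _.
  by apply: eq_bigr => j _; rewrite (sffE Phi_immersion ac Wc _ _ _ _ _ Wp).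
rewrite (sum_ord2 (fun i => \sum_j ff p nu a i j ^+ 2)) !sum_ord2.
have tr0 := frame_form_trace a Wp nn nB.
have s2 : (isqrt2 : R) ^+ 2 * 2 = 1 := isqrt2E.
have nd : nu_dot nu X a = Complex (isqrt2 ^+ 2 * (ff p nu a 0 0 - ff p nu a 1 1))
    (- (isqrt2 ^+ 2 * 2 * ff p nu a 0 1)).
  exact: (normal_hess Phi_immersion ac Wc Wp nB connection a).
have [_ _ f10 _] := frame_formE Phi_immersion ac Wc nu Wp a.
rewrite nd f10 s2; move: (ff p nu a 0 0) (ff p nu a 0 1) (ff p nu a 1 1) isqrt2 tr0 s2.
clear=> x y w r xw r2 /=.
have -> : w = - x by apply/eqP; rewrite -addr_eq0 addrC xw.
have -> : r ^+ 2 * (x - - x) = x by rewrite opprK -mulr2n -mulr_natr mulrA mulrAC r2 mul1r.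
by ring.
Qed.

End shape_norm.

Lemma quadratic_expansion {A : comPzRingType} (a b0 b1 c00 c01 c10 c11 v0 v1 : A) :
  a = v0 * b0 + v1 * b1 -> b0 = v0 * c00 + v1 * c10 -> b1 = v0 * c01 + v1 * c11 ->
  c10 = c01 -> a = v0 ^+ 2 * c00 + 2 * (v0 * v1 * c01) + v1 ^+ 2 * c11.
Proof. by move=> -> -> -> ->; ring. Qed.

Lemma derive2_quadratic {R : realType} (U : set 'rV[R]_2) (F : 'rV[R]_2 -> R) x v :
  open U -> Ck_on 2 U F -> U x ->
  'D_v ('D_v F) x = v 0 0 ^+ 2 * 'D_ev0 ('D_ev0 F) x
    + 2 * (v 0 0 * v 0 1 * 'D_ev0 ('D_ev1 F) x) + v 0 1 ^+ 2 * 'D_ev1 ('D_ev1 F) x.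
Proof.
move=> oU CF Ux; have C1 w : Ck_on 1 U ('D_w F) by have [_ /(_ w)[]] := CF.
have s w w' : 'D_w ('D_w' F) x = 'D_w' ('D_w F) x by exact: (derive_swap w w' oU CF Ux).
have e v' w := C1_deriveE v' oU (C1 w) Ux.
exact: (quadratic_expansion (e v v) (etrans (s _ _) (e v ev0))
  (etrans (s _ _) (e v ev1)) (s ev1 ev0)).
Qed.

Lemma quadratic_le0 {R : realType} (a v0 v1 s t h00 h01 h11 : R) :
  a = v0 ^+ 2 * h00 + 2 * (v0 * v1 * h01) + v1 ^+ 2 * h11 -> v0 = s -> v1 = t ->
  a <= 0 -> s ^+ 2 * h00 + 2 * (s * t * h01) + t ^+ 2 * h11 <= 0.
Proof. by move=> -> -> ->. Qed.

(** The left-hand side is the value of the form at [(x, 0)] plus its value at [(y, t)]: these are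
    the real and imaginary parts of the null frame. *)
Lemma hermitian_le0 {R : realType} (x y t h0 h1 h2 : R) :
  (forall s t : R, s ^+ 2 * h0 + 2 * (s * t * h1) + t ^+ 2 * h2 <= 0) ->
  (x ^+ 2 + y ^+ 2) * h0 + 2 * (y * t * h1) + t ^+ 2 * h2 <= 0.
Proof. by move=> hq; have h := hq x 0; have h' := hq y t; lra. Qed.

(** * The maximum principle *)

Section maximum_principle.
Context {R : realType} {M : riemannianManifold R 2}.
Variables (W0 : opens M) (c : chart R 2 M).
Local Notation W := (oset W0).
Hypotheses (ac : atlas c) (Wc : W `<=` dom c).
Local Notation x_ p := (Defs.coord c p).
Let U := Defs.coord c @` W.

Let oU : open U.
Proof. by rewrite /U -(setIidr Wc); apply: open_coord_image; exact: osetP. Qed.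

(** The triple [h] is the Hessian in the chart. The sign is stated for the whole quadratic form
    because [L] involves it in two directions at once. *)
Lemma local_max_pder (a : M -> R) (sa : smooth_map_on W a) p : W p ->
  (\forall q \near p, a q <= a p) ->
  exists h : R * R * R,
  [/\ pder ac Wc ev0 (sreal sa) p = 0 /\ pder ac Wc ev1 (sreal sa) p = 0,
      pder ac Wc ev0 (pder ac Wc ev0 (sreal sa)) p = (h.1.1)%:C%C,
      pder ac Wc ev0 (pder ac Wc ev1 (sreal sa)) p = (h.1.2)%:C%C,
      pder ac Wc ev1 (pder ac Wc ev1 (sreal sa)) p = (h.2)%:C%C &
      forall s t : R, s ^+ 2 * h.1.1 + 2 * (s * t * h.1.2) + t ^+ 2 * h.2 <= 0].
Proof.
move=> Wp amax; pose F := a \o param c.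
have CF : Ck_on 2 U F.
  by have := sa c ac 2%N; rewrite (setIidr Wc).
have Ux : U (x_ p) by exists p.
have Fmax : \forall y \near x_ p, F y <= F (x_ p).
  have cp : {for x_ p, continuous (param c)}.
    by apply: param_continuous; rewrite inE; exists p => //; exact: Wc.
  have := cp [set q | a q <= a p]; rewrite (paramK (Wc Wp)) => /(_ amax).
  by rewrite /F /= (paramK (Wc Wp)).
have H v := local_max_derive2 v oU CF Ux Fmax.
exists ('D_ev0 ('D_ev0 F) (x_ p), 'D_ev0 ('D_ev1 F) (x_ p), 'D_ev1 ('D_ev1 F) (x_ p)).
split; try exact: pder2_sreal.
  by split; rewrite pder_sreal // (H _).1.
move=> s t; apply: (quadratic_le0 (derive2_quadratic (s *: ev0 + t *: ev1) oU CF Ux) _ _ (H _).2).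
  by rewrite !mxE /= mulr1 mulr0 addr0.
by rewrite !mxE /= mulr1 mulr0 add0r.
Qed.

End maximum_principle.

Lemma sval_lin2 {R : realType} {M : riemannianManifold R 2} (W0 : opens M)
  (x y a b : sfun W0) p : oset W0 p ->
  (x * a + y * b) p = x p * a p + y p * b p.
Proof. by move=> Wp; rewrite svalD // !svalM. Qed.

Lemma sval_critical {R : realType} {M : riemannianManifold R 2} (W0 : opens M)
  (w x y r a b b' : sfun W0) p : oset W0 p -> a p = 0 -> b p = 0 -> b' p = 0 ->
  (w + x * a + y * b - r * b') p = w p.
Proof.
by move=> Wp a0 b0 c0; rewrite !(svalD, svalN, svalM) // a0 b0 c0 !mulr0 subr0 !addr0.
Qed.

Section frame_maximum_principle.
Context {R : realType} {M : riemannianManifold R 2} {N : nat}.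
Variable Phi : M -> 'rV[R]_N.+1.
Hypothesis Phi_immersion : immersion Phi.
Variables (W0 : opens M) (c : chart R 2 M).
Local Notation W := (oset W0).
Hypotheses (ac : atlas c) (Wc : W `<=` dom c).
Local Notation A := (sfun W0).
Local Notation cj := (@sfun_conj R M W0).
Local Notation del k := (pder ac Wc (delta_mx 0 k)).
Local Notation fr0 := (fr0 Phi_immersion ac Wc).
Local Notation fr1 := (fr1 Phi_immersion ac Wc).
Local Notation D := (field_der (del 0) (del 1) fr0 fr1).

(** At a critical point the first order part of [lap] vanishes, whatever [r] is, and the rest is the
    sum in [hermitian_le0]. *)
Lemma frame_local_max (r a : A) p : W p -> cj a = a ->
  (\forall q \near p, complex.Re (a q) <= complex.Re (a p)) ->
  D a p = 0 /\ complex.Re (lap D cj r a p) <= 0.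
Proof.
move=> Wp ca amax.
have [[[h0 h1] h2] [[d0 d1] d00 d01 d11 hq]] := local_max_pder ac Wc (sfun_re a) Wp amax.
rewrite -(sreal_re ca) in d0 d1 d00 d01 d11.
have e0 : fr0 p = (fr_re0 Phi c p +i* fr_im0 Phi c p)%C by exact: sfun_ofE.
have e1 : fr1 p = (0 +i* fr_im1 Phi c p)%C by exact: sfun_ofE.
have Da : D a p = 0.
  apply: (etrans (sval_lin2 _ _ _ _ Wp)); apply: (etrans (f_equal2 _ _ _)).
  - exact: congr1 d0.
  - exact: congr1 d1.
  by rewrite !mulr0 addr0.
split=> //.
have [P [Q PQ]] := @cjfield_der2E A (del 0) (del 1) cj fr0 fr1 (@sfun_conjK _ _ W0) (pderD ac Wc _) (pderM ac Wc _)
  (pderD ac Wc _) (pderM ac Wc _) (pderC ac Wc _ _) (conj_pder ac Wc _) (conj_pder ac Wc _).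
have -> : lap D cj r a p = (((fr_re0 Phi c p) ^+ 2 + (fr_im0 Phi c p) ^+ 2) * h0
    + 2 * (fr_im0 Phi c p * fr_im1 Phi c p * h1) + (fr_im1 Phi c p) ^+ 2 * h2)%:C%C.
  have d0' : del 0 a p = 0 by exact: d0.
  have d1' : del 1 a p = 0 by exact: d1.
  apply: (etrans _ (sval_hermitian Wp e0 e1 d00 d01 d11)).
  apply: (etrans (congr1 (fun b : A => sfun_val (b - cj r * D a) p) (PQ a))).
  exact: (sval_critical _ _ _ _ Wp d0' d1' Da).
exact: (hermitian_le0 _ _ _ hq).
Qed.

End frame_maximum_principle.

(** * Inequalities at extremal points *)

Section hermitian_form.
Context {C : numClosedFieldType}.
Implicit Types a b d s t : C.

Lemma psd_form_ge0 a b d :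
  (forall s t, 0 <= s * s^* * a + s * t^* * b + t * s^* * b^* + t * t^* * d) ->
  0 <= a /\ 0 <= d.
Proof.
move=> H; split.
  by have := H 1 0; rewrite conjC1 conjC0 !(mulr0, mul0r, mulr1, mul1r, addr0).
by have := H 0 1; rewrite conjC1 conjC0 !(mulr0, mul0r, mulr1, mul1r, add0r).
Qed.

Lemma psd_cauchy_schwarz a b d :
  (forall s t, 0 <= s * s^* * a + s * t^* * b + t * s^* * b^* + t * t^* * d) ->
  b * b^* <= a * d.
Proof.
move=> H; have [a0 d0] := psd_form_ge0 H.
have dr : d^* = d by apply/CrealP; exact: ger0_real.
have := d0; rewrite le_eqVlt => /predU1P[dz|dp].
  rewrite -dz mulr0 in H *; have bb := mul_conjC_ge0 b.
  have [//|bp] := real_leP (ger0_real bb) (ger0_real (lexx 0)).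
  (* When [d = 0] the form at [(1, - k b)] is [a - 2 k |b|^2]; this [k] makes it [-1]. *)
  pose k := (a + 1) / (2 * (b * b^*)).
  have k0 : 0 <= k by rewrite divr_ge0 // ?addr_ge0 // mulr_ge0.
  have kr : k^* = k by apply/CrealP; exact: ger0_real.
  have := H 1 (- (k * b)).
  rewrite conjC1 rmorphN rmorphM /= kr !mul1r !mulr1 mulr0 addr0.
  have -> : a + - (k * b^*) * b + - (k * b) * b^* = -1.
    transitivity (a - k * (2 * (b * b^*))); first by ring.
    by rewrite /k divfK ?opprD ?addNKr ?addrA ?subrr ?sub0r // mulf_neq0 ?pnatr_eq0 // gt_eqF.
  by rewrite oppr_ge0 ler10.
(* At [(d, - b)] the form equals [d (a d - |b|^2)]. *)
have := H d (- b); rewrite dr rmorphN.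
have -> : d * d * a + d * - b^* * b + - b * d * b^* + - b * - b^* * d =
    d * (a * d - b * b^*) by ring.
by rewrite pmulr_rge0 // subr_ge0.
Qed.

Context {I : finType}.
Implicit Types x y z : I -> C.
Definition hdot x y := \sum_i x i * (y i)^*.
Definition comb s x t y i := s * x i + t * y i.

Lemma hdot_conj x y : (hdot x y)^* = hdot y x.
Proof.
by rewrite rmorph_sum; apply: eq_bigr => i _; rewrite rmorphM /= conjCK mulrC.
Qed.

Lemma hdot_combl s x t y z : hdot (comb s x t y) z = s * hdot x z + t * hdot y z.
Proof. by rewrite !mulr_sumr -big_split; apply: eq_bigr => i _; rewrite /comb /=; ring. Qed.

Lemma hdot_combr s x t y z : hdot z (comb s x t y) = s^* * hdot z x + t^* * hdot z y.
Proof. by rewrite -[LHS]conjCK hdot_conj hdot_combl rmorphD !rmorphM /= !hdot_conj. Qed.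

Lemma hdot_ge0 x : 0 <= hdot x x.
Proof. by apply: sumr_ge0 => i _; exact: mul_conjC_ge0. Qed.

Lemma hdot_cauchy_schwarz x y : hdot x y * hdot y x <= hdot x x * hdot y y.
Proof.
rewrite -(hdot_conj x y); apply: psd_cauchy_schwarz => s t.
have := hdot_ge0 (comb s x t y); rewrite !(hdot_combl, hdot_combr) hdot_conj.
by move: (hdot x x) (hdot x y) (hdot y x) (hdot y y) => a b c d; congr (0 <= _); ring.
Qed.

Definition hgram z x y := hdot z z * hdot x y - hdot x z * hdot z y.

Lemma hgram_conj z x y : (hgram z x y)^* = hgram z y x.
Proof. by rewrite rmorphB !rmorphM /= !hdot_conj; congr (_ - _); rewrite mulrC. Qed.

Lemma hgram_ge0 z x : 0 <= hgram z x x.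
Proof. by rewrite subr_ge0 [X in _ <= X]mulrC; exact: hdot_cauchy_schwarz. Qed.

Lemma hgram_psd z x y s t :
  0 <= s * s^* * hgram z x x + s * t^* * hgram z x y
    + t * s^* * (hgram z x y)^* + t * t^* * hgram z y y.
Proof.
have := hgram_ge0 z (comb s x t y); rewrite hgram_conj /hgram !(hdot_combl, hdot_combr).
move: (hdot x x) (hdot x y) (hdot y x) (hdot y y) (hdot z z) (hdot x z) (hdot z x).
by move: (hdot y z) (hdot z y) => a1 a2 a3 a4 a5 a6 a7 a8 a9; congr (0 <= _); ring.
Qed.

(** Cauchy-Schwarz for the form [hgram z], itself semidefinite by Cauchy-Schwarz for [hdot]. At a
    point, [gramian] is such a form. *)
Lemma hgram_cauchy_schwarz z x y :
  hgram z x y * hgram z y x <= hgram z x x * hgram z y y.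
Proof. by rewrite -(hgram_conj z x y); apply: psd_cauchy_schwarz => s t; exact: hgram_psd. Qed.

End hermitian_form.

Lemma ev_critical {A C : comPzRingType} (ev : {rmorphism A -> C}) (q u v g y y' dv dv' : A) k :
  ev dv = - (k%:R * ev v * ev y) -> ev dv' = - (k%:R * ev v * ev y') ->
  ev (q * ((1 - 2 * v) * v + g + v * (k%:R ^+ 2 * (y * y') + k%:R * (v - 3 * u + 2))
    + k%:R * (dv * y' + dv' * y))) =
  ev q * ((1 - 2 * ev v) * ev v + ev g + k%:R * ev v * (ev v - 3 * ev u + 2)
    - k%:R ^+ 2 * ev v * ev (y * y')).
Proof.
move=> h h'.
by rewrite !(rmorphXn ev, rmorphB ev, rmorphM ev, rmorphD ev, rmorph_nat ev, rmorph1 ev) h h'; ring.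
Qed.

Lemma ev_lap_linear {A C : comPzRingType} (ev : {rmorphism A -> C}) (u v g y : A) k :
  ev ((1 - 2 * v) * v + g + k%:R * (u * (y + v - 3 * u + 2))) =
  (1 - 2 * ev v) * ev v + ev g + k%:R * (ev u * (ev y + ev v - 3 * ev u + 2)).
Proof.
by rewrite !(rmorphB ev, rmorphM ev, rmorphD ev, rmorph_nat ev, rmorph1 ev).
Qed.

Lemma ev_lap_quartic {R : realType} {A : comPzRingType} (ev : {rmorphism A -> R[i]})
    (u v g x : A) (ux vx gx xx : R) :
  ev u = ux%:C%C -> ev v = vx%:C%C -> ev g = gx%:C%C -> ev x = xx%:C%C ->
  ev (2 * x + 2 * (4 - u) * g + 2 * v * (1 - 2 * v) ^+ 2 + 10 * v ^+ 2 * (1 - 2 * v)) =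
  (2 * xx + 2 * (4 - ux) * gx + 2 * vx * (1 - 2 * vx) ^+ 2
    + 10 * vx ^+ 2 * (1 - 2 * vx))%:C%C.
Proof.
move=> eu ev' eg ex.
rewrite !(rmorphXn ev, rmorphB ev, rmorphM ev, rmorphD ev, rmorph_nat ev, rmorph1 ev).
rewrite eu ev' eg ex.
by rewrite !(rmorphXn (real_complex R), rmorphB (real_complex R), rmorphM (real_complex R),
  rmorphD (real_complex R), rmorph_nat (real_complex R), rmorph1 (real_complex R)).
Qed.

Lemma conj_opp_natM {C : numClosedFieldType} k (a b : C) :
  a^* = a -> (- (k%:R * (a * b)))^* = - (k%:R * (a * b^*)).
Proof. by move=> ar; rewrite rmorphN !rmorphM /= ar rmorph_nat. Qed.

Lemma le_add_double {R : realType} (a b d e : R) : 0 <= e -> a + b + d <= 2 * e + a + b + d.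
Proof. by move=> e0; lra. Qed.

Lemma conj_cauchy_schwarz {C : numClosedFieldType} (c p p' q n : C) :
  0 <= c -> p^* = p' -> p * p' <= q * n -> c * p * (c * p)^* <= c * q * (c * n).
Proof.
move=> c0 pp h; have cr : c^* = c by apply/CrealP; exact: ger0_real.
rewrite rmorphM /= cr pp mulrACA [X in _ <= X]mulrACA.
by rewrite ler_wpM2l // mulr_ge0.
Qed.

Lemma ev_lap_wronsk {R : realType} {A : comPzRingType} (ev : {rmorphism A -> R[i]})
    (u n q p y y' e : A) (ux nx qx yy : R) :
  ev e = 0 -> ev u = ux%:C%C -> ev n = nx%:C%C -> ev q = qx%:C%C ->
  ev y' = (ev y)^* -> ev y * (ev y)^* = yy%:C%C -> ev p = - (3 * ev y * ev n) ->
  ev ((9 - 10 * u) * n + 3 * y * e + 3 * y' * p + q) =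
  ((9 - 10 * ux) * nx - 9 * (yy * nx) + qx)%:C%C.
Proof.
move=> ee eu en eq ey eyy ep.
rewrite !(rmorphXn ev, rmorphB ev, rmorphM ev, rmorphD ev, rmorph_nat ev, rmorph1 ev).
rewrite ee ep eu en eq ey mulr0 addr0.
rewrite !(rmorph_nat (real_complex R), rmorphB (real_complex R), rmorphM (real_complex R),
  rmorphD (real_complex R)).
rewrite -[X in _ - 9 * (X * _)]/(yy%:C%C) -eyy; ring.
Qed.

(** If [n > 0], the Gram inequality gives [q >= 9 yy n], which outweighs the negative term and
    leaves [(9 - 10 u) n > 0]. *)
Lemma wronsk_critical_eq0 {R : realType} (y : R[i]) (u n q yy : R) :
  u < 9 / 10 -> 0 <= n -> y * y^* = yy%:C%C ->
  - (3 * y * n%:C%C) * (- (3 * y * n%:C%C))^* <= q%:C%C * n%:C%C ->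
  (9 - 10 * u) * n - 9 * (yy * n) + q <= 0 -> n = 0.
Proof.
move=> u9 n0 eyy.
have -> : - (3 * y * n%:C%C) * (- (3 * y * n%:C%C))^* = (9 * (yy * n) * n)%:C%C.
  rewrite (_ : - (3 * y * n%:C%C) = - (3 * (n%:C%C * y))); last by ring.
  rewrite conj_opp_natM; last by exact: conjc_real.
  rewrite !(rmorphM (real_complex R)) rmorph_nat -[X in 9 * (X * _)]/(yy%:C%C) -eyy; ring.
rewrite -rmorphM lecR => h le; apply/eqP; rewrite eq_le n0 andbT leNgt; apply/negP => np.
have : 9 * (yy * n) <= q by rewrite -(ler_pM2r np).
have : 0 < (9 - 10 * u) * n by rewrite mulr_gt0 //; lra.
by lra.
Qed.

(** * The identities evaluated at a point, in particular at a critical point *)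

Section pointwise.
Context {R : realType} {A : comPzRingType} {m : nat}.
Variables (D : A -> A) (cj : {rmorphism A -> A}) (rho : A) (f : 'rV[A]_m).
Hypothesis cjK : involutive cj.
Hypothesis derD : forall a b, D (a + b) = D a + D b.
Hypothesis derM : forall a b, D (a * b) = D a * b + a * D b.
Hypothesis der_comm : forall a,
  D (cjder D cj a) = cjder D cj (D a) + rho * cjder D cj a - cj rho * D a.
Hypothesis two_reg : forall a : A, a + a = 0 -> a = 0.
Local Notation E := (cjder D cj).
Local Notation "X ^c" := (map_mx cj X).
Local Notation z := (map_mx D f).
Hypothesis f_real : f^c = f.
Hypothesis ff : dot f f = 1.
Hypothesis zz : dot z z = 0.
Hypothesis zzb : dot z z^c = 1.
Hypothesis f_minimal : map_mx E z = - f + cj rho *: z.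
Local Notation u := (hsq D cj rho f).
Variable j : A.
Hypothesis uj : u * j = 1.
Local Notation y := (dlogu D cj rho f j).
Local Notation v := (vv D cj rho f j).
Local Notation g := (gg D cj rho f j).
Local Notation xi := (xi D rho f j).
Local Notation zeta := (zeta D rho f j).
Local Notation chi := (chi D rho f j).
Local Notation Nw := (wronsk D cj rho f j).
Local Notation lap := (lap D cj rho).

Variable ev : {rmorphism A -> R[i]}.
Hypothesis ev_cj : forall a, ev (cj a) = (ev a)^*.
Local Notation val a := (complex.Re (ev a)).

Let rcE := (rmorphXn (real_complex R), rmorphB (real_complex R), rmorphM (real_complex R),
  rmorphD (real_complex R), rmorph_nat (real_complex R), rmorph1 (real_complex R)).

Lemma ev_real a : cj a = a -> ev a = (val a)%:C%C.
Proof.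
move=> ca; have := ev_cj a; rewrite ca; case: (ev a) => p q [] /eqP.
by rewrite -subr_eq0 opprK -mulr2n mulrn_eq0 => /eqP ->.
Qed.

Lemma ev_dot (X Y : 'rV[A]_m) :
  ev (dot X Y^c) = hdot (fun i => ev (X 0 i)) (fun i => ev (Y 0 i)).
Proof.
by rewrite rmorph_sum; apply: eq_bigr => i _; rewrite rmorphM mxE ev_cj.
Qed.

Lemma ev_gramian (X Y : 'rV[A]_m) : ev (gramian D cj rho f j X Y) =
  hgram (fun i => ev (xi 0 i)) (fun i => ev (X 0 i)) (fun i => ev (Y 0 i)).
Proof. by rewrite rmorphB !rmorphM !ev_dot. Qed.

Hypothesis u_gt0 : 0 < val u.

Lemma cj_dot_self (X : 'rV[A]_m) : cj (dot X X^c) = dot X X^c.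
Proof. by rewrite cj_dot (cjvK cjK) dotC. Qed.

Let cju : cj u = u. Proof. exact: cj_dot_self. Qed.
Let cjv : cj v = v. Proof. by rewrite rmorphM cju cj_dot_self. Qed.
Let cjg : cj g = g. Proof. by rewrite rmorphM cju cj_dot_self. Qed.
Let cjyy : cj (y * cj y) = y * cj y. Proof. by rewrite rmorphM cjK mulrC. Qed.

Let evu := ev_real cju.
Let evv := ev_real cjv.
Let evg := ev_real cjg.
Let evyy := ev_real cjyy.

Lemma val_ge0 a : 0 <= ev a -> 0 <= val a.
Proof. by case: (ev a) => p q; rewrite lecE => /andP[]. Qed.

Lemma val_mul_ge0 a : 0 <= ev a -> 0 <= val (u * a).
Proof.
by move=> a0; apply: val_ge0; rewrite rmorphM evu mulr_ge0 // lecR ltW.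
Qed.

Lemma val_v_ge0 : 0 <= val v.
Proof. by apply: val_mul_ge0; rewrite ev_dot hdot_ge0. Qed.

Lemma val_g_ge0 : 0 <= val g.
Proof. by apply: val_mul_ge0; rewrite ev_dot hdot_ge0. Qed.

Lemma ev_u5_ge0 : 0 <= ev u ^+ 5.
Proof. by rewrite exprn_ge0 // evu lecR ltW. Qed.

Lemma val_wronsk_ge0 : 0 <= val Nw.
Proof.
apply: val_ge0; rewrite (wronskE cjK derD derM der_comm two_reg f_real ff zzb f_minimal uj).
by rewrite rmorphM rmorphXn mulr_ge0 ?ev_u5_ge0 // ev_gramian hgram_ge0.
Qed.

Let lap_v0 := lap_v cjK derD derM der_comm two_reg f_real ff zzb f_minimal uj.

Let cj_der_v : cj (D v) = E v.
Proof. by rewrite (cj_der D cjK) cjv. Qed.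

Let cj_grad_v : cj (D v * E v) = D v * E v.
Proof. by rewrite rmorphM cj_der_v -cj_der_v cjK mulrC. Qed.

Lemma val_wronsk : val Nw = val u ^+ 3 * (val g * val v - val (D v * E v)).
Proof.
rewrite /wronsk rmorphM rmorphXn rmorphB (rmorphM ev g) evu evg evv (ev_real cj_grad_v).
rewrite (_ : _ * _ = (val u ^+ 3 * (val g * val v - val (D v * E v)))%:C%C) //.
by rewrite !rcE.
Qed.

Lemma val_grad_v_le : val (D v * E v) <= val g * val v.
Proof. by have := val_wronsk_ge0; rewrite val_wronsk pmulr_rge0 ?exprn_gt0 // subr_ge0. Qed.

(** As [u] is not zero, criticality reads [D v = - (n+1) v y], which expresses every gradient term
    through [|y|^2]. *)
Lemma critical_v_uX n : ev (D (v * u ^+ n.+1)) = 0 ->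
  val (D v * E v) = n.+1%:R ^+ 2 * val v ^+ 2 * val (y * cj y) /\
  val (lap (v * u ^+ n.+1)) = val u ^+ n.+1 * ((1 - 2 * val v) * val v + val g
    + n.+1%:R * val v * (val v - 3 * val u + 2)
    - n.+1%:R ^+ 2 * val v * val (y * cj y)).
Proof.
rewrite derM (der_uX derM uj) (rmorphD ev) (rmorphM ev (D v)) (rmorphM ev v).
rewrite (rmorphM ev _ y) (rmorphM ev n.+1%:R) (rmorphXn ev) (rmorph_nat ev) => h.
have ux0 : ev u ^+ n.+1 != 0.
  by rewrite evu expf_neq0 // -(rmorph0 (real_complex R)) (inj_eq (@complexI R)) gt_eqF.
have hV : ev (D v) = - (n.+1%:R * ev v * ev y).
  apply/eqP; rewrite -addr_eq0 -(mulIr_eq0 _ (mulIf ux0)) -h; apply/eqP; ring.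
have vr : (ev v)^* = ev v by rewrite -ev_cj cjv.
have hE : ev (E v) = - (n.+1%:R * ev v * ev (cj y)).
  rewrite -cj_der_v !ev_cj hV (rmorphN Num.conj) !(rmorphM Num.conj).
  by congr (- (_ * _ * _)); [exact: (rmorph_nat Num.conj)|exact: vr].
have nr : n.+1%:R = (n.+1%:R : R)%:C%C by rewrite rmorph_nat.
split.
  rewrite (rmorphM ev (D v)) hV hE.
  have -> : - (n.+1%:R * ev v * ev y) * - (n.+1%:R * ev v * ev (cj y)) =
      n.+1%:R ^+ 2 * ev v ^+ 2 * (ev y * ev (cj y)) by ring.
  rewrite -rmorphM evv evyy nr.
  rewrite (_ : _ * _ = (n.+1%:R ^+ 2 * val v ^+ 2 * val (y * cj y))%:C%C) //.
  by rewrite !rcE.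
rewrite (lap_v_uX cjK derD derM der_comm two_reg f_real ff zzb f_minimal uj).
have -> : ev (u ^+ n.+1 * ((1 - 2 * v) * v + g
    + v * (n.+1%:R ^+ 2 * (y * cj y) + n.+1%:R * (v - 3 * u + 2))
    + n.+1%:R * (D v * cj y + E v * y))) =
  ev (u ^+ n.+1) * ((1 - 2 * ev v) * ev v + ev g + n.+1%:R * ev v * (ev v - 3 * ev u + 2)
    - n.+1%:R ^+ 2 * ev v * ev (y * cj y)).
  exact: ev_critical hV hE.
rewrite (rmorphXn ev) evv evu evg evyy nr.
rewrite [X in complex.Re X](_ : _ = (val u ^+ n.+1 * ((1 - 2 * val v) * val v + val g
    + n.+1%:R * val v * (val v - 3 * val u + 2)
    - n.+1%:R ^+ 2 * val v * val (y * cj y)))%:C%C) //.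
by rewrite !rcE.
Qed.

(** Here criticality reads [D v = - k u y]. *)
Lemma ev_dlogu_der (k : nat) : ev (D (v + k%:R * u)) = 0 ->
  val (D v * E v) = k%:R ^+ 2 * val u ^+ 2 * val (y * cj y).
Proof.
have ek : D k%:R = 0 by exact: der_nat derD derM k.
rewrite derD (derM k%:R) ek mul0r add0r (der_u uj) (rmorphD ev) (rmorphM ev k%:R).
rewrite (rmorphM ev u) (rmorph_nat ev) => /eqP; rewrite addr_eq0 => /eqP hV.
have ur : (ev u)^* = ev u by rewrite -ev_cj cju.
rewrite (rmorphM ev (D v)) -cj_der_v ev_cj hV.
rewrite (conj_opp_natM _ _ ur) -ev_cj.
have -> : - (k%:R * (ev u * ev y)) * - (k%:R * (ev u * ev (cj y))) =
    k%:R ^+ 2 * ev u ^+ 2 * (ev y * ev (cj y)) by ring.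
have nr : k%:R = (k%:R : R)%:C%C by rewrite rmorph_nat.
rewrite -rmorphM evu evyy nr.
rewrite (_ : _ * _ = (k%:R ^+ 2 * val u ^+ 2 * val (y * cj y))%:C%C) //.
by rewrite !rcE.
Qed.

Lemma val_lap_v_u (k : nat) : val (lap (v + k%:R * u)) =
  (1 - 2 * val v) * val v + val g
  + k%:R * (val u * (val (y * cj y) + val v - 3 * val u + 2)).
Proof.
rewrite (lapD cj rho derD) (lap_natM rho cjK derD derM) lap_v0.
rewrite (lap_hsq cjK derD derM der_comm two_reg f_real ff zzb f_minimal uj).
have -> : ev ((1 - 2 * v) * v + g + k%:R * (u * (y * cj y + v - 3 * u + 2))) =
  (1 - 2 * ev v) * ev v + ev g + k%:R * (ev u * (ev (y * cj y) + ev v - 3 * ev u + 2)).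
  exact: ev_lap_linear.
have nr : k%:R = (k%:R : R)%:C%C by rewrite rmorph_nat.
rewrite evv evu evg evyy nr.
rewrite [X in complex.Re X](_ : _ = ((1 - 2 * val v) * val v + val g
  + k%:R * (val u * (val (y * cj y) + val v - 3 * val u + 2)))%:C%C) //.
by rewrite !rcE.
Qed.

Lemma val_lap_g_sqr_v : 2 * (4 - val u) * val g + 2 * val v * (1 - 2 * val v) ^+ 2
  + 10 * val v ^+ 2 * (1 - 2 * val v) <= val (lap (2 * g + 5 * v ^+ 2)).
Proof.
rewrite (lap_g_sqr_v cjK derD derM der_comm two_reg f_real ff zz zzb f_minimal uj).
have c0 : 0 <= val (u * dot chi chi^c) by apply: val_mul_ge0; rewrite ev_dot hdot_ge0.
have cr : cj (u * dot chi chi^c) = u * dot chi chi^c by rewrite rmorphM cju cj_dot_self.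
rewrite (ev_lap_quartic evu evv evg (ev_real cr)).
exact: le_add_double c0.
Qed.

(** Criticality kills [E Nw] and turns [der_wronsk] into [P = - 3 y Nw]; Cauchy-Schwarz for the Gram
    form bounds [|P|^2] by [Q Nw]. *)
Lemma critical_wronsk : ev (D Nw) = 0 -> val (lap Nw) <= 0 -> val u < 9 / 10 -> val Nw = 0.
Proof.
have cN : cj Nw = Nw by exact: cj_wronsk.
have evN := ev_real cN.
pose P := u ^+ 5 * gramian D cj rho f j chi zeta.
pose Q := u ^+ 5 * gramian D cj rho f j chi chi.
have cQ : cj Q = Q.
  have cx : cj (xsq D cj rho f j) = xsq D cj rho f j by exact: cj_dot_self.
  rewrite (rmorphM cj (_ ^+ 5)) (rmorphXn cj) cju (rmorphB cj) (rmorphM cj _ (dot _ _)).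
  rewrite (rmorphM cj (dot _ _)) cx !(cj_dot cj) !(cjvK cjK) (dotC chi^c).
  by rewrite (dotC chi^c) (dotC xi^c) [dot xi _ * _]mulrC.
have evQ := ev_real cQ.
move=> dN lN u9; have EN : ev (E Nw) = 0.
  by rewrite -{1}cN -(cj_der D cjK) ev_cj dN conjC0.
rewrite (der_wronsk cjK derD derM der_comm two_reg f_real ff zz zzb f_minimal uj) in dN.
rewrite (lap_wronsk cjK derD derM der_comm two_reg f_real ff zz zzb f_minimal uj) in lN.
rewrite -/P in dN lN; rewrite -/Q in lN.
have PP : ev P * (ev P)^* <= ev Q * ev Nw.
  rewrite (wronskE cjK derD derM der_comm two_reg f_real ff zzb f_minimal uj).
  rewrite /P /Q !(rmorphM ev (u ^+ 5)) (rmorphXn ev) !ev_gramian.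
  exact: conj_cauchy_schwarz ev_u5_ge0 (hgram_conj _ _ _) (hgram_cauchy_schwarz _ _ _).
have hP : ev P = - (3 * ev y * ev Nw).
  apply/eqP; rewrite -addr_eq0 addrC; apply/eqP; rewrite -dN.
  by rewrite !(rmorphD ev) !(rmorphM ev) (rmorph_nat ev).
have eyy : ev y * (ev y)^* = (val (y * cj y))%:C%C by rewrite -ev_cj -rmorphM.
rewrite (ev_lap_wronsk EN evu evN evQ (ev_cj y) eyy hP) in lN.
rewrite hP evQ evN in PP.
exact: (wronsk_critical_eq0 u9 val_wronsk_ge0 eyy PP lN).
Qed.
End pointwise.

(** * The contradiction, for functions on a compact space *)

Lemma compact_max {T : topologicalType} {R : realType} (F : T -> R) (p0 : T) :
  compact [set: T] -> continuous F -> exists p, forall q, F q <= F p.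
Proof.
move=> cT cF; have [|p _ H] := compact_EVT_max _ cT (continuous_subspaceT cF).
  by exists p0.
by exists p => q; apply: H; rewrite inE.
Qed.

Lemma quartic_ratio_le1 {R : realType} (a e : R) : 5 / 6 < a -> 0 <= e -> e <= 1 / 400 ->
  9 / 10 * (a + e) ^+ 4 <= a ^+ 4.
Proof.
(* [e <= 1/400] is less than 2 percent of [a > 5/6], and 9/10 times [1.02^4] is below 1. *)
move=> a0 e0 e1; have ae : a + e <= 102 / 100 * a by lra.
have h2 : (a + e) ^+ 2 <= (102 / 100 * a) ^+ 2 by rewrite lerXn2r ?nnegrE //; lra.
have h4 : ((a + e) ^+ 2) ^+ 2 <= ((102 / 100 * a) ^+ 2) ^+ 2.
  by rewrite lerXn2r ?nnegrE ?exprn_ge0 //; lra.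
rewrite -!exprM [(2 * 2)%N]/= in h4.
have : 0 <= a ^+ 4 by apply: exprn_ge0; lra.
have : (102 / 100 * a) ^+ 4 = (102 / 100) ^+ 4 * a ^+ 4 by rewrite exprMn.
by move: (a ^+ 4) ((a + e) ^+ 4) h4 => x y; lra.
Qed.

Section critical_inequalities.
Context {R : realType}.
Implicit Types u v g n G Y : R.

(** For [v > 0], the gradient relation gives [16 v Y <= g]. Dividing by [v] leaves
    [2 v + 9 - 12 u <= 0], so [v <= 6 u - 9/2], which is less than [9/10]. *)
Lemma max_v_u4_bound u v g G Y :
  0 < u -> u < 9 / 10 -> 0 <= v -> G <= g * v -> G = 4 ^+ 2 * v ^+ 2 * Y ->
  u ^+ 4 * ((1 - 2 * v) * v + g + 4 * v * (v - 3 * u + 2) - 4 ^+ 2 * v * Y) <= 0 ->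
  v <= 9 / 10.
Proof.
move=> u0 u9 v0 Gg GE; rewrite pmulr_rle0 ?exprn_gt0 // => h.
have := v0; rewrite le_eqVlt => /predU1P[<-|vp]; first by lra.
have : 16 * v * Y <= g by rewrite -(ler_pM2r vp) (le_trans _ Gg) // GE le_eqVlt; apply/orP; left; apply/eqP; ring.
move=> gY; have : v * (2 * v + 9 - 12 * u) <= 0 by lra.
by rewrite pmulr_rle0 //; lra.
Qed.

(** Since [4 - u] exceeds [31/10], [2 g] is at most [(12 v^3 - 2 v - 2 v^2) / (31/10)]. The worst
    case is [v = 1], where this is [80/31], just below [26/10]. *)
Lemma max_g_sqr_v_bound u v g : u < 9 / 10 -> 0 <= v -> v <= 1 ->
  0 <= g -> 2 * (4 - u) * g + 2 * v * (1 - 2 * v) ^+ 2 + 10 * v ^+ 2 * (1 - 2 * v) <= 0 ->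
  2 * g + 5 * v ^+ 2 <= 76 / 10.
Proof.
move=> u9 v0 v1 g0 h.
have ug : u * g <= 9 / 10 * g by rewrite ler_wpM2r // ltW.
have v2 : v ^+ 2 <= 1 by rewrite expr_le1.
have v3 : v ^+ 3 <= v by rewrite exprS ler_piMr.
have vv : 0 <= v ^+ 2 by exact: sqr_ge0.
have e : 2 * v * (1 - 2 * v) ^+ 2 + 10 * v ^+ 2 * (1 - 2 * v) =
  2 * v + 2 * v ^+ 2 - 12 * v ^+ 3 by ring.
lra.
Qed.

(** If [v < 3/10], then [40 u (3 u - 2 - v)] exceeds [20/3], whereas [g], [40 u Y] and [v - 2 v^2]
    are at most [38/10], [12/100] and [1/8]. *)
Lemma min_v_u_bound u v g G Y :
  5 / 6 < u -> u < 9 / 10 -> 0 <= v -> v <= 1 -> 0 <= g -> g <= 38 / 10 ->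
  G <= g * v -> G = 40 ^+ 2 * u ^+ 2 * Y ->
  0 <= (1 - 2 * v) * v + g + 40 * (u * (Y + v - 3 * u + 2)) -> 3 / 10 <= v.
Proof.
move=> u5 u9 v0 v1 g0 g4 Gg GE h; rewrite leNgt; apply/negP => v3.
have gv : g * v <= g by rewrite ler_piMr.
(* From [1600 u^2 Y = G <= g v <= g], with one factor [u] bounded below by [5/6]. *)
have uY : 40 * 5 / 6 * (40 * (u * Y)) <= 38 / 10.
  have [uY|uY] := leP 0 (u * Y).
    have : 5 / 6 * (u * Y) <= u * (u * Y) by rewrite ler_wpM2r // ltW.
    have : G = 1600 * (u * (u * Y)) by rewrite GE; ring.
    by lra.
  by lra.
have vq : 0 <= v ^+ 2 by exact: sqr_ge0.
have uv : (5 / 6) * (3 * u - 2 - v) <= u * (3 * u - 2 - v) by rewrite ler_wpM2r //; lra.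
have : (1 - 2 * v) * v + g + 40 * (u * (Y + v - 3 * u + 2)) =
   v - 2 * v ^+ 2 + g + 40 * (u * Y) - 40 * (u * (3 * u - 2 - v)) by ring.
lra.
Qed.

(** The relation [g = 4 v Y] removes the gradient terms; what remains is [v (5 - 6 u) >= 0]. *)
Lemma min_v_u2_absurd u v g G Y : 5 / 6 < u -> 0 < v -> G = g * v ->
  G = 2 ^+ 2 * v ^+ 2 * Y ->
  0 <= u ^+ 2 * ((1 - 2 * v) * v + g + 2 * v * (v - 3 * u + 2) - 2 ^+ 2 * v * Y) -> False.
Proof.
move=> u5 vp Gg GE; rewrite pmulr_rge0 ?exprn_gt0 //; last by lra.
have -> : g = 4 * v * Y.
  by apply: (mulIf (lt0r_neq0 vp)); rewrite -Gg GE; ring.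
have : v * (5 - 6 * u) < 0 by rewrite pmulr_rlt0 //; lra.
by lra.
Qed.
End critical_inequalities.

(** The global argument separated from the geometry: the surface enters only through pointwise
    relations and necessary conditions at extremal points. [n], [G] and [Y] stand for [w], [|D v|^2]
    and [|y|^2]. *)
Lemma no_critical_functions {T : topologicalType} {R : realType} (p0 : T)
    (u v g n G Y : T -> R) (a e : R) :
  compact [set: T] -> continuous u -> continuous v -> continuous g -> continuous n ->
  5 / 6 < a -> a + e < 9 / 10 -> e <= 1 / 400 -> (forall p, a <= u p <= a + e) ->
  (forall p, 0 <= v p) -> (forall p, 0 <= g p) ->
  (forall p, G p <= g p * v p) -> (forall p, n p = u p ^+ 3 * (g p * v p - G p)) ->
  (forall p, (forall q, n q <= n p) -> n p = 0) ->
  (forall p, (forall q, v q * u q ^+ 4 <= v p * u p ^+ 4) ->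
    G p = 4 ^+ 2 * v p ^+ 2 * Y p /\
    u p ^+ 4 * ((1 - 2 * v p) * v p + g p + 4 * v p * (v p - 3 * u p + 2)
      - 4 ^+ 2 * v p * Y p) <= 0) ->
  (forall p, (forall q, 2 * g q + 5 * v q ^+ 2 <= 2 * g p + 5 * v p ^+ 2) ->
    2 * (4 - u p) * g p + 2 * v p * (1 - 2 * v p) ^+ 2
      + 10 * v p ^+ 2 * (1 - 2 * v p) <= 0) ->
  (forall p, (forall q, v p + 40 * u p <= v q + 40 * u q) ->
    G p = 40 ^+ 2 * u p ^+ 2 * Y p /\
    0 <= (1 - 2 * v p) * v p + g p + 40 * (u p * (Y p + v p - 3 * u p + 2))) ->
  ~ (forall p, (forall q, v p * u p ^+ 2 <= v q * u q ^+ 2) ->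
    G p = 2 ^+ 2 * v p ^+ 2 * Y p /\
    0 <= u p ^+ 2 * ((1 - 2 * v p) * v p + g p + 2 * v p * (v p - 3 * u p + 2)
      - 2 ^+ 2 * v p * Y p)).
Proof.
move=> cT cu cv cg cn a5 b9 e1 ub v0 g0 Gg nE HB HC HD HE HF.
have u5 p : 5 / 6 < u p by have /andP[? _] := ub p; lra.
have u9 p : u p < 9 / 10 by have /andP[_ ?] := ub p; lra.
have up p : 0 < u p by have := u5 p; lra.
have e0 : 0 <= e by have /andP[] := ub p0; lra.
have a0 : 0 <= a by lra.
have cuX k : continuous (fun p => u p ^+ k).
  elim: k => [|k IH] p; first by under eq_fun do rewrite expr0; exact: cvg_cst.
  by under eq_fun do rewrite exprS; apply: cvgM; [exact: cu|exact: IH].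
have n0 p : n p = 0.
  have [q nq] := compact_max p0 cT cn.
  have np : 0 <= n p by rewrite nE mulr_ge0 ?subr_ge0 // exprn_ge0 // ltW.
  by apply/eqP; rewrite eq_le np andbT -(HB q nq).
have GE p : G p = g p * v p.
  have /eqP := n0 p; rewrite nE mulf_eq0 expf_eq0 /= gt_eqF //= subr_eq0.
  by move=> /eqP.
have v1 p : v p <= 1.
  have [|q vq] := @compact_max _ _ (fun p => v p * u p ^+ 4) p0 cT.
    by move=> q; apply: cvgM; [exact: cv|exact: cuX].
  have [h1 h2] := HC q vq.
  have h := max_v_u4_bound (up q) (u9 q) (v0 q) (Gg q) h1 h2.
  have /andP[ap _] := ub p; have /andP[aq bq] := ub q.
  have ap4 : a ^+ 4 <= u p ^+ 4 by rewrite lerXn2r ?nnegrE // ltW.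
  have bq4 : u q ^+ 4 <= (a + e) ^+ 4 by rewrite lerXn2r ?nnegrE //; [exact: ltW|lra].
  have r := quartic_ratio_le1 a5 e0 e1.
  have a4 : 0 < a ^+ 4 by rewrite exprn_gt0 //; lra.
  rewrite -(ler_pM2r a4) mul1r.
  apply: (le_trans (ler_wpM2l (v0 p) ap4)); apply: (le_trans (vq p)).
  apply: le_trans r; apply: ler_pM => //; exact: exprn_ge0 (ltW (up q)).
have g4 p : g p <= 38 / 10.
  have [|q gq] := @compact_max _ _ (fun p => 2 * g p + 5 * v p ^+ 2) p0 cT.
    move=> q; apply: cvgD; (apply: cvgM; first exact: cvg_cst); first exact: cg.
    by under eq_fun do rewrite expr2; apply: cvgM; exact: cv.
  have h := max_g_sqr_v_bound (u9 q) (v0 q) (v1 q) (g0 q) (HD q gq).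
  by have := gq p; have := sqr_ge0 (v p); lra.
have vp p : 0 < v p.
  have [|q vq] := @compact_max _ _ (fun p => - (v p + 40 * u p)) p0 cT.
    move=> q; apply: cvgN; apply: cvgD; first exact: cv.
    by apply: cvgM; [exact: cvg_cst|exact: cu].
  have [|h1 h2] := HE q; first by move=> r; rewrite -lerN2.
  have h := min_v_u_bound (u5 q) (u9 q) (v0 q) (v1 q) (g0 q) (g4 q) (Gg q) h1 h2.
  (* Comparison with the minimum gives [v p >= 3/10 - 40 e >= 1/5]. *)
  by have /andP[? ?] := ub p; have /andP[? ?] := ub q; have := vq p; lra.
have [|q vq] := @compact_max _ _ (fun p => - (v p * u p ^+ 2)) p0 cT.
  by move=> q; apply: cvgN; apply: cvgM; [exact: cv|exact: cuX].
have [|h1 h2] := HF q; first by move=> r; rewrite -lerN2.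
exact: min_v_u2_absurd (u5 q) (vp q) (GE q) h1 h2.
Qed.

(** * Invariance of [u], [v], [g] and [w] under change of null frame *)

Record null_frame {A : comPzRingType} {m : nat} (D : A -> A) (cj : {rmorphism A -> A})
    (rho : A) (f : 'rV[A]_m) : Prop := NullFrame {
  nfD : forall a b, D (a + b) = D a + D b;
  nfM : forall a b, D (a * b) = D a * b + a * D b;
  nf_comm : forall a, D (cjder D cj a) = cjder D cj (D a) + rho * cjder D cj a - cj rho * D a;
  nf_null : dot (map_mx D f) (map_mx D f) = 0;
  nf_unit : dot (map_mx D f) (map_mx cj (map_mx D f)) = 1;
  nf_minimal : map_mx (cjder D cj) (map_mx D f) = - f + cj rho *: map_mx D f }.

Section intrinsic_invariants.
Context {A : comPzRingType} {m : nat}.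
Variables (cj : {rmorphism A -> A}) (f : 'rV[A]_m).
Hypothesis cjK : involutive cj.
Hypothesis two_reg : forall a : A, a + a = 0 -> a = 0.
Hypothesis f_real : map_mx cj f = f.
Hypothesis ff : dot f f = 1.

Section one_frame.
Variables (D : A -> A) (r j : A).
Hypothesis F : null_frame D cj r f.
Hypothesis uj : hsq D cj r f * j = 1.

(** This is [lap_hsq] solved for [v]. Unlike [xi], the ingredients [u], its squared gradient and its
    Laplacian do not depend on the frame; [gg_intrinsic] then treats [g] in the same way, from
    [v]. *)
Lemma vv_intrinsic : vv D cj r f j = j * lap D cj r (hsq D cj r f)
  - j ^+ 2 * (D (hsq D cj r f) * cjder D cj (hsq D cj r f)) + 3 * hsq D cj r f - 2.
Proof.
have [h1 h2 h3 _ h5 h6] := F.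
have := lap_hsq cjK h1 h2 h3 two_reg f_real ff h5 h6 uj.
rewrite (cj_y cjK uj) /dlogu => ->.
move: uj; move: (hsq _ _ _ _) (vv _ _ _ _ _) => u v uj'.
rewrite mulrA (mulrC j) uj' mul1r; ring.
Qed.

Lemma gg_intrinsic : gg D cj r f j = lap D cj r (vv D cj r f j)
  - (1 - 2 * vv D cj r f j) * vv D cj r f j.
Proof.
have [h1 h2 h3 _ h5 h6] := F.
by rewrite (lap_v cjK h1 h2 h3 two_reg f_real ff h5 h6 uj) addrAC subrr add0r.
Qed.
End one_frame.

Variables (D D' : A -> A) (r r' j mu nu : A).
Hypothesis F : null_frame D cj r f.
Hypothesis F' : null_frame D' cj r' f.
Hypothesis D'E : forall a, D' a = mu * D a + nu * cjder D cj a.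

Lemma null_frame_hsq : hsq D' cj r' f = hsq D cj r f.
Proof.
have [h1 h2 h3 h4 h5 h6] := F; have [k1 k2 k3 k4 k5 k6] := F'.
exact: frame_change_hsq cjK h1 h2 D'E two_reg f_real ff h4 h5 h6 k4 k5 k6 k1 k2.
Qed.

Lemma null_frame_lap a : lap D' cj r' a = lap D cj r a.
Proof.
have [h1 h2 h3 h4 h5 h6] := F; have [k1 k2 k3 k4 k5 k6] := F'.
exact: frame_change_lap cjK h1 h2 D'E two_reg h3 f_real h4 h5 h6 k4 k5 k6 a.
Qed.

Lemma null_frame_grad a : D' a * cjder D' cj a = D a * cjder D cj a.
Proof.
have [h1 h2 h3 h4 h5 h6] := F; have [k1 k2 k3 k4 k5 k6] := F'.
exact: frame_change_grad cjK D'E two_reg f_real h4 h5 k4 k5 a.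
Qed.

Hypothesis uj : hsq D cj r f * j = 1.

Lemma null_frame_vv : vv D' cj r' f j = vv D cj r f j.
Proof.
have uj' : hsq D' cj r' f * j = 1 by rewrite null_frame_hsq.
rewrite (vv_intrinsic F uj) (vv_intrinsic F' uj').
by rewrite null_frame_hsq null_frame_lap null_frame_grad.
Qed.

Lemma null_frame_gg : gg D' cj r' f j = gg D cj r f j.
Proof.
have uj' : hsq D' cj r' f * j = 1 by rewrite null_frame_hsq.
by rewrite (gg_intrinsic F uj) (gg_intrinsic F' uj') null_frame_vv null_frame_lap.
Qed.

Lemma null_frame_wronsk : wronsk D' cj r' f j = wronsk D cj r f j.
Proof.
by rewrite /wronsk null_frame_gg null_frame_vv null_frame_hsq null_frame_grad.
Qed.
End intrinsic_invariants.

(** * Compatibility of the invariants with ring morphisms *)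

Section restriction_of_invariants.
Context {A B : comPzRingType} {m : nat}.
Variables (D : A -> A) (D' : B -> B) (cj : {rmorphism A -> A}) (cj' : {rmorphism B -> B}).
Variables (ph : {rmorphism A -> B}) (rho j : A) (f : 'rV[A]_m).
Hypothesis phD : forall a, ph (D a) = D' (ph a).
Hypothesis ph_cj : forall a, ph (cj a) = cj' (ph a).
Local Notation "X ^ph" := (map_mx ph X) (at level 2).

Lemma morph_cjder a : ph (cjder D cj a) = cjder D' cj' (ph a).
Proof. by rewrite /cjder ph_cj phD ph_cj. Qed.

Lemma morph_dot (X Y : 'rV[A]_m) : ph (dot X Y) = dot X^ph Y^ph.
Proof. by rewrite rmorph_sum; apply: eq_bigr => i _; rewrite rmorphM !mxE. Qed.

Lemma morph_map_cj (X : 'rV[A]_m) : (map_mx cj X)^ph = map_mx cj' X^ph.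
Proof. by apply/rowP => i; rewrite !mxE ph_cj. Qed.

Lemma morph_map_der (X : 'rV[A]_m) : (map_mx D X)^ph = map_mx D' X^ph.
Proof. by apply/rowP => i; rewrite !mxE phD. Qed.

Lemma morph_nabv k (X : 'rV[A]_m) : (nabv D rho k X)^ph = nabv D' (ph rho) k X^ph.
Proof.
by apply/rowP => i; rewrite !mxE /nab rmorphD phD !rmorphM rmorph_int.
Qed.

Lemma morph_hess : (hess D rho f)^ph = hess D' (ph rho) f^ph.
Proof. by rewrite /hess morph_nabv morph_map_der. Qed.

Lemma morph_hsq : ph (hsq D cj rho f) = hsq D' cj' (ph rho) f^ph.
Proof. by rewrite /hsq morph_dot morph_map_cj morph_hess. Qed.

Lemma morph_xi : (xi D rho f j)^ph = xi D' (ph rho) f^ph (ph j).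
Proof. by rewrite /xi morph_nabv /eta map_mxZ morph_hess. Qed.

Lemma morph_vv : ph (vv D cj rho f j) = vv D' cj' (ph rho) f^ph (ph j).
Proof. by rewrite /vv /xsq rmorphM morph_hsq morph_dot morph_map_cj morph_xi. Qed.

Lemma morph_gg : ph (gg D cj rho f j) = gg D' cj' (ph rho) f^ph (ph j).
Proof.
by rewrite /gg /zeta rmorphM morph_hsq morph_dot morph_map_cj morph_nabv morph_xi.
Qed.

Lemma morph_wronsk : ph (wronsk D cj rho f j) = wronsk D' cj' (ph rho) f^ph (ph j).
Proof.
rewrite /wronsk -morph_gg -morph_vv -morph_hsq rmorphM rmorphXn rmorphB.
by rewrite (rmorphM ph (gg _ _ _ _ _)) (rmorphM ph (D _)) phD morph_cjder.
Qed.
End restriction_of_invariants.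

(** * Necessary conditions at extremal points *)

Section extremal_points.
Context {R : realType} {A : comPzRingType} {m : nat}.
Variables (D : A -> A) (cj : {rmorphism A -> A}) (rho : A) (f : 'rV[A]_m) (j : A).
Variables (ev : {rmorphism A -> R[i]}) (is_max : A -> Prop).
Hypothesis F : null_frame D cj rho f.
Hypothesis cjK : involutive cj.
Hypothesis two_reg : forall a : A, a + a = 0 -> a = 0.
Hypothesis f_real : map_mx cj f = f.
Hypothesis ff : dot f f = 1.
Hypothesis uj : hsq D cj rho f * j = 1.
Hypothesis ev_cj : forall a, ev (cj a) = (ev a)^*.
Local Notation u := (hsq D cj rho f).
Local Notation v := (vv D cj rho f j).
Local Notation g := (gg D cj rho f j).
Local Notation w := (wronsk D cj rho f j).
Local Notation val a := (complex.Re (ev a)).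
Local Notation ux := (val u).
Local Notation vx := (val v).
Local Notation gx := (val g).
Local Notation Gx := (val (D v * cjder D cj v)).
Local Notation Yx := (val (dlogu D cj rho f j * cj (dlogu D cj rho f j))).
Hypothesis u_gt0 : 0 < ux.
Hypothesis max_critical : forall a, cj a = a -> is_max a ->
  ev (D a) = 0 /\ val (lap D cj rho a) <= 0.

Let cju : cj u = u. Proof. exact: cj_hsq. Qed.
Let cjv : cj v = v. Proof. exact: cj_v. Qed.
Let cjg : cj g = g. Proof. by rewrite rmorphM cju (cj_dot_self cjK). Qed.

Lemma pointwise_inequalities :
  [/\ 0 <= vx, 0 <= gx, Gx <= gx * vx & val w = ux ^+ 3 * (gx * vx - Gx)].
Proof.
have [h1 h2 h3 h4 h5 h6] := F; split.
- exact: val_v_ge0.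
- exact: val_g_ge0.
- exact: val_grad_v_le.
- exact: val_wronsk.
Qed.

Lemma max_wronsk : is_max w -> ux < 9 / 10 -> val w = 0.
Proof.
have [h1 h2 h3 h4 h5 h6] := F => wm u9.
have [d l] := max_critical (cj_wronsk _ _ _ cjK _) wm.
exact: (critical_wronsk cjK h1 h2 h3 two_reg f_real ff h4 h5 h6 uj ev_cj u_gt0 d l u9).
Qed.

Lemma max_v_u4 : is_max (v * u ^+ 4) ->
  Gx = 4 ^+ 2 * vx ^+ 2 * Yx /\
  ux ^+ 4 * ((1 - 2 * vx) * vx + gx + 4 * vx * (vx - 3 * ux + 2) - 4 ^+ 2 * vx * Yx) <= 0.
Proof.
have [h1 h2 h3 h4 h5 h6] := F => vm.
have c : cj (v * u ^+ 4) = v * u ^+ 4 by rewrite rmorphM (rmorphXn cj) cju cjv.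
have [d l] := max_critical c vm.
have [e1 e2] := critical_v_uX cjK h1 h2 h3 two_reg f_real ff h5 h6 uj ev_cj u_gt0 d.
by split; [exact: e1|rewrite -e2].
Qed.

Lemma min_v_u2 : is_max (- (v * u ^+ 2)) ->
  Gx = 2 ^+ 2 * vx ^+ 2 * Yx /\
  0 <= ux ^+ 2 * ((1 - 2 * vx) * vx + gx + 2 * vx * (vx - 3 * ux + 2) - 2 ^+ 2 * vx * Yx).
Proof.
have [h1 h2 h3 h4 h5 h6] := F => vm.
have c : cj (- (v * u ^+ 2)) = - (v * u ^+ 2).
  by rewrite (rmorphN cj) rmorphM (rmorphXn cj) cju cjv.
have [d l] := max_critical c vm.
have d' : ev (D (v * u ^+ 2)) = 0.
  by move: d; rewrite (derN h1) (rmorphN ev) => /eqP; rewrite oppr_eq0 => /eqP.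
have [e1 e2] := critical_v_uX cjK h1 h2 h3 two_reg f_real ff h5 h6 uj ev_cj u_gt0 d'.
split; first exact: e1.
rewrite -e2; move: l; rewrite (lapN _ _ h1) (rmorphN ev).
by rewrite (raddfN (@complex.Re R : {additive _ -> _})) oppr_le0.
Qed.

Lemma max_g_sqr_v : is_max (2 * g + 5 * v ^+ 2) ->
  2 * (4 - ux) * gx + 2 * vx * (1 - 2 * vx) ^+ 2 + 10 * vx ^+ 2 * (1 - 2 * vx) <= 0.
Proof.
have [h1 h2 h3 h4 h5 h6] := F => gm.
have c : cj (2 * g + 5 * v ^+ 2) = 2 * g + 5 * v ^+ 2.
  by rewrite rmorphD (rmorphM cj 2) (rmorphM cj 5) (rmorphXn cj) !(rmorph_nat cj) cjg cjv.
have [d l] := max_critical c gm.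
exact: le_trans (val_lap_g_sqr_v cjK h1 h2 h3 two_reg f_real ff h4 h5 h6 uj ev_cj u_gt0) l.
Qed.

Lemma min_v_u : is_max (- (v + 40 * u)) ->
  Gx = 40 ^+ 2 * ux ^+ 2 * Yx /\
  0 <= (1 - 2 * vx) * vx + gx + 40 * (ux * (Yx + vx - 3 * ux + 2)).
Proof.
have [h1 h2 h3 h4 h5 h6] := F => vm.
have c : cj (- (v + 40 * u)) = - (v + 40 * u).
  by rewrite (rmorphN cj) rmorphD (rmorphM cj 40) (rmorph_nat cj) cju cjv.
have [d l] := max_critical c vm.
have d' : ev (D (v + 40 * u)) = 0.
  by move: d; rewrite (derN h1) (rmorphN ev) => /eqP; rewrite oppr_eq0 => /eqP.
split; first exact: (ev_dlogu_der cjK h1 h2 uj ev_cj d').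
move: l; rewrite (lapN _ _ h1) (rmorphN ev).
rewrite (raddfN (@complex.Re R : {additive _ -> _})) oppr_le0.
have e := val_lap_v_u cjK h1 h2 h3 two_reg f_real ff h5 h6 uj ev_cj 40.
by move=> l; exact: etrans (congr1 (Order.le 0) (esym e)) l.
Qed.
End extremal_points.

(** * Evaluation at a point and restriction to a smaller open set *)

Section evaluation.
Context {R : realType} {M : riemannianManifold R 2} (W0 : opens M) (p : M).
Hypothesis Wp : oset W0 p.

(** The proof that [p] lies in the open set is an argument of the map, so that the morphism
    structure can be attached to it: elsewhere evaluation sends 1 to 0. *)
Definition sfun_ev of oset W0 p := fun a : sfun W0 => sfun_val a p.

Fact sfun_ev_additive : additive (sfun_ev Wp).
Proof. by move=> a b; exact: svalB. Qed.
Fact sfun_ev_multiplicative : multiplicative (sfun_ev Wp).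
Proof. by split=> [a b|]; [exact: svalM|exact: sval1]. Qed.
HB.instance Definition _ := GRing.isAdditive.Build (sfun W0) R[i] (sfun_ev Wp) sfun_ev_additive.
HB.instance Definition _ :=
  GRing.isMultiplicative.Build (sfun W0) R[i] (sfun_ev Wp) sfun_ev_multiplicative.

Lemma sfun_ev_conj a : sfun_ev Wp (sfun_conj a) = (sfun_ev Wp a)^*.
Proof. exact: sfun_conjE. Qed.
End evaluation.

Section restriction.
Context {R : realType} {M : riemannianManifold R 2} (W0 W1 : opens M).
Hypothesis W10 : oset W1 `<=` oset W0.

Definition sfun_res (a : sfun W0) : sfun W1 :=
  sfun_of (smooth_map_on_subset W10 (sfun_re a)) (smooth_map_on_subset W10 (sfun_im a)).

Lemma sfun_resE a p : oset W1 p -> sfun_res a p = a p.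
Proof. by move=> Wp; rewrite /sfun_res sfun_ofE //; case: (sfun_val a p). Qed.

Fact sfun_res_additive : additive sfun_res.
Proof.
move=> a b; apply: sfunP => p Wp.
by rewrite svalB // !sfun_resE // svalB //; exact: W10.
Qed.
Fact sfun_res_multiplicative : multiplicative sfun_res.
Proof.
split=> [a b|]; apply: sfunP => p Wp.
  by rewrite svalM // !sfun_resE // svalM //; exact: W10.
by rewrite sfun_resE // !sval1 //; exact: W10.
Qed.
HB.instance Definition _ :=
  GRing.isAdditive.Build (sfun W0) (sfun W1) sfun_res sfun_res_additive.
HB.instance Definition _ :=
  GRing.isMultiplicative.Build (sfun W0) (sfun W1) sfun_res sfun_res_multiplicative.

Lemma sfun_res_conj a : sfun_res (sfun_conj a) = sfun_conj (sfun_res a).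
Proof.
apply: sfunP => p Wp; rewrite sfun_resE // sfun_conjE; last exact: W10.
by rewrite sfun_conjE // sfun_resE.
Qed.

Lemma sfun_res_pder c (ac : atlas c) (Wc : oset W0 `<=` dom c) (Wc' : oset W1 `<=` dom c) v a :
  sfun_res (pder ac Wc v a) = pder ac Wc' v (sfun_res a).
Proof.
apply: sfunP => p Wp; rewrite sfun_resE // !pder_pderR //; last exact: W10.
have e (F G : M -> R) : (forall q, oset W1 q -> F q = G q) ->
    pderR (oset W0) c v F p = pderR (oset W1) c v G p.
  move=> FG; rewrite (pderRE _ _ _ Wp) (pderRE _ _ _ (W10 Wp)) -!(pderRE _ _ _ Wp).
  exact: pderR_eq (osetP W1) Wc' FG.
by congr (_ +i* _)%C; apply: e => q Wq; rewrite sfun_resE.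
Qed.
End restriction.

Lemma lin2_change {A : comPzRingType} (f0 f1 x00 x01 x10 x11 p q : A) :
  f0 * (x00 * p + x01 * q) + f1 * (x10 * p + x11 * q) =
  (f0 * x00 + f1 * x10) * p + (f0 * x01 + f1 * x11) * q.
Proof. by ring. Qed.

Section local_invariants.
Context {R : realType} {M : riemannianManifold R 2} {N : nat}.
Variable Phi : M -> 'rV[R]_N.+1.
Hypothesis Phi_spherical : spherical Phi.
Hypothesis Phi_immersion : immersion Phi.
Hypothesis Phi_isometric : isometric Phi.
Hypothesis Phi_minimal : minimal Phi.

Local Notation conn := (connection Phi_immersion).
Local Notation pos := (position Phi_immersion).
#[local] Opaque position fr0 fr1.

Definition frame_der (W0 : opens M) (c : chart R 2 M) (ac : atlas c)
    (Wc : oset W0 `<=` dom c) : sfun W0 -> sfun W0 :=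
  field_der (pder ac Wc (delta_mx 0 0)) (pder ac Wc (delta_mx 0 1))
    (fr0 Phi_immersion ac Wc) (fr1 Phi_immersion ac Wc).

Section one_chart.
Variables (W0 : opens M) (c : chart R 2 M) (ac : atlas c) (Wc : oset W0 `<=` dom c).

Lemma immersion_null_frame :
  null_frame (frame_der ac Wc) (@sfun_conj R M W0) (conn ac Wc) (pos W0).
Proof.
split.
- exact: frame_derD.
- exact: frame_derM.
- exact: frame_comm.
- exact: frame_null.
- exact: frame_unit.
- exact: frame_minimal.
Qed.

Variables (W1 : opens M) (W10 : oset W1 `<=` oset W0) (Wc' : oset W1 `<=` dom c).

Lemma sfun_res_position : map_mx (sfun_res W10) (pos W0) = pos W1.
Proof.
apply/rowP => i; rewrite [LHS]mxE; apply: sfunP => p Wp.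
rewrite (sfun_resE W10 _ Wp); apply: (etrans (positionE Phi_immersion i (W10 Wp))).
exact: esym (positionE Phi_immersion i Wp).
Qed.

Transparent fr0 fr1.
Lemma sfun_res_fr0 : sfun_res W10 (fr0 Phi_immersion ac Wc) = fr0 Phi_immersion ac Wc'.
Proof.
apply: sfunP => p Wp; rewrite (sfun_resE W10 _ Wp).
apply: (etrans (sfun_ofE _ _ (W10 Wp))); exact: esym (sfun_ofE _ _ Wp).
Qed.

Lemma sfun_res_fr1 : sfun_res W10 (fr1 Phi_immersion ac Wc) = fr1 Phi_immersion ac Wc'.
Proof.
apply: sfunP => p Wp; rewrite (sfun_resE W10 _ Wp).
apply: (etrans (sfun_ofE _ _ (W10 Wp))); exact: esym (sfun_ofE _ _ Wp).
Qed.
#[local] Opaque fr0 fr1.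

Lemma sfun_res_frame_der a :
  sfun_res W10 (frame_der ac Wc a) = frame_der ac Wc' (sfun_res W10 a).
Proof.
have h (x0 x1 y0 y1 : sfun W0) : sfun_res W10 (x0 * y0 + x1 * y1) =
    sfun_res W10 x0 * sfun_res W10 y0 + sfun_res W10 x1 * sfun_res W10 y1.
  by rewrite rmorphD !rmorphM.
apply: (etrans (h _ _ _ _)); apply: f_equal2; apply: f_equal2.
- exact: sfun_res_fr0.
- exact: sfun_res_pder.
- exact: sfun_res_fr1.
- exact: sfun_res_pder.
Qed.

Lemma sfun_res_connection : sfun_res W10 (conn ac Wc) = conn ac Wc'.
Proof.
have cjE a : sfun_res W10 (cjder (frame_der ac Wc) (@sfun_conj R M W0) a) =
    cjder (frame_der ac Wc') (@sfun_conj R M W1) (sfun_res W10 a).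
  exact: morph_cjder sfun_res_frame_der (sfun_res_conj W10) a.
apply: (etrans (sfun_res_conj W10 _)); apply: congr1.
apply: (etrans (morph_dot (sfun_res W10) _ _)); apply: f_equal2.
  apply: (etrans (morph_map_der cjE _)); apply: congr1.
  by apply: (etrans (morph_map_der sfun_res_frame_der _)); rewrite sfun_res_position.
apply: (etrans (morph_map_cj (sfun_res_conj W10) _)); apply: congr1.
by apply: (etrans (morph_map_der sfun_res_frame_der _)); rewrite sfun_res_position.
Qed.
End one_chart.

(** The coordinate fields of [d] are combinations of those of [c], and these, by [field_span], of
    the null frame over [c] and its conjugate. *)
Lemma frame_der_change (W0 : opens M) (c d : chart R 2 M) (ac : atlas c) (ad : atlas d)
    (Wc : oset W0 `<=` dom c) (Wd : oset W0 `<=` dom d) :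
  exists mu nu, forall a, frame_der ad Wd a =
    mu * frame_der ac Wc a + nu * cjder (frame_der ac Wc) (@sfun_conj R M W0) a.
Proof.
pose X i k := pder ad Wd (delta_mx 0 i) (chart_coord ac Wc k).
pose f0 := fr0 Phi_immersion ad Wd; pose f1 := fr1 Phi_immersion ad Wd.
have [mu [nu h]] := @field_span (sfun W0) (pder ac Wc (delta_mx 0 0))
  (pder ac Wc (delta_mx 0 1)) (@sfun_conj R M W0) _ _ _ (@sfun_conjK R M W0) (conj_pder ac Wc _) (conj_pder ac Wc _)
  (fr_det_inv Phi_immersion ac Wc) (f0 * X 0 0 + f1 * X 1 0) (f0 * X 0 1 + f1 * X 1 1).
exists mu, nu => a; apply: (etrans _ (h a)).
have e i := pder_change ac ad Wc Wd (delta_mx 0 i) a.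
apply: (etrans (f_equal2 (fun x y => f0 * x + f1 * y) (e 0) (e 1))).
exact: lin2_change.
Qed.

End local_invariants.

Lemma mulr_inv_uniq {A : comPzRingType} (u x y : A) : u * x = 1 -> u * y = 1 -> x = y.
Proof. by move=> ux uy; rewrite -[x]mul1r -uy mulrAC ux mul1r. Qed.

(** * Independence of the chart *)

Section chart_independence.
Context {R : realType} {M : riemannianManifold R 2} {N : nat}.
Variable Phi : M -> 'rV[R]_N.+1.
Hypothesis Phi_spherical : spherical Phi.
Hypothesis Phi_immersion : immersion Phi.
Hypothesis Phi_isometric : isometric Phi.
Hypothesis Phi_minimal : minimal Phi.
#[local] Opaque position fr0 fr1 frame_der connection.

Local Notation cj W0 := (@sfun_conj R M W0).
Local Notation der := (frame_der Phi_immersion).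
Local Notation conn := (connection Phi_immersion).
Local Notation pos := (position Phi_immersion).
Local Notation nf := (immersion_null_frame Phi_spherical Phi_immersion Phi_isometric Phi_minimal).

Definition hsq_on (W0 : opens M) c (ac : atlas c) (Wc : oset W0 `<=` dom c) : sfun W0 :=
  hsq (der ac Wc) (cj W0) (conn ac Wc) (pos W0).
Definition vv_on (W0 : opens M) c (ac : atlas c) (Wc : oset W0 `<=` dom c) (j : sfun W0) :=
  vv (der ac Wc) (cj W0) (conn ac Wc) (pos W0) j.
Definition gg_on (W0 : opens M) c (ac : atlas c) (Wc : oset W0 `<=` dom c) (j : sfun W0) :=
  gg (der ac Wc) (cj W0) (conn ac Wc) (pos W0) j.
Definition wronsk_on (W0 : opens M) c (ac : atlas c) (Wc : oset W0 `<=` dom c) (j : sfun W0) :=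
  wronsk (der ac Wc) (cj W0) (conn ac Wc) (pos W0) j.

Section restrict.
Variables (W0 W1 : opens M) (W10 : oset W1 `<=` oset W0).
Variables (c : chart R 2 M) (ac : atlas c).
Variables (Wc : oset W0 `<=` dom c) (Wc' : oset W1 `<=` dom c).
Let resD := sfun_res_frame_der Phi_immersion ac Wc W10 Wc'.
Let res_pos := sfun_res_position Phi_immersion W10.
Let res_conn := sfun_res_connection Phi_immersion ac Wc W10 Wc'.

Lemma res_hsq_on : sfun_res W10 (hsq_on ac Wc) = hsq_on ac Wc'.
Proof.
apply: (etrans (morph_hsq _ _ resD (sfun_res_conj W10))).
exact: (f_equal2 (hsq (der ac Wc') (cj W1)) res_conn res_pos).
Qed.

Lemma res_vv_on j : sfun_res W10 (vv_on ac Wc j) = vv_on ac Wc' (sfun_res W10 j).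
Proof.
apply: (etrans (morph_vv _ _ _ resD (sfun_res_conj W10))).
exact: (f_equal2 (fun r f => vv (der ac Wc') (cj W1) r f (sfun_res W10 j)) res_conn res_pos).
Qed.

Lemma res_gg_on j : sfun_res W10 (gg_on ac Wc j) = gg_on ac Wc' (sfun_res W10 j).
Proof.
apply: (etrans (morph_gg _ _ _ resD (sfun_res_conj W10))).
exact: (f_equal2 (fun r f => gg (der ac Wc') (cj W1) r f (sfun_res W10 j)) res_conn res_pos).
Qed.

Lemma res_wronsk_on j : sfun_res W10 (wronsk_on ac Wc j) = wronsk_on ac Wc' (sfun_res W10 j).
Proof.
apply: (etrans (morph_wronsk _ _ _ resD (sfun_res_conj W10))).
exact: (f_equal2 (fun r f => wronsk (der ac Wc') (cj W1) r f (sfun_res W10 j)) res_conn res_pos).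
Qed.
End restrict.

Definition opensI (W0 W1 : opens M) := Opens (openI (osetP W0) (osetP W1)).

Section two_charts.
Variables (W0 W1 : opens M) (c d : chart R 2 M) (ac : atlas c) (ad : atlas d).
Variables (Wc : oset W0 `<=` dom c) (Wd : oset W1 `<=` dom d).
Let W2 := opensI W0 W1.
Let W20 : oset W2 `<=` oset W0. Proof. by move=> p []. Qed.
Let W21 : oset W2 `<=` oset W1. Proof. by move=> p []. Qed.
Let W2c : oset W2 `<=` dom c. Proof. by move=> p /W20 /Wc. Qed.
Let W2d : oset W2 `<=` dom d. Proof. by move=> p /W21 /Wd. Qed.
Let cjK := @sfun_conjK R M W2.
Let two := @sfun_two_reg R M W2.
Let f_real := position_conj Phi_immersion W2.
Let ff := position_dot Phi_spherical Phi_immersion W2.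

Let hsq_W2 : hsq_on ad W2d = hsq_on ac W2c.
Proof.
have [mu [nu DE]] := frame_der_change Phi_immersion ac ad W2c W2d.
exact: (@null_frame_hsq _ _ (cj W2) _ cjK two f_real ff _ _ _ _ _ _ (nf ac W2c) (nf ad W2d) DE).
Qed.

Let eq_on_overlap (a : sfun W0) (b : sfun W1) p : sfun_res W20 a = sfun_res W21 b ->
  oset W0 p -> oset W1 p -> a p = b p.
Proof.
move=> ab W0p W1p; have Wp : oset W2 p by exact: conj.
by rewrite -(sfun_resE W20 a Wp) ab (sfun_resE W21 b Wp).
Qed.

Lemma hsq_on_indep p : oset W0 p -> oset W1 p -> hsq_on ac Wc p = hsq_on ad Wd p.
Proof.
apply: eq_on_overlap; rewrite (res_hsq_on W20 ac Wc W2c) -hsq_W2.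
exact: esym (res_hsq_on W21 ad Wd W2d).
Qed.

Variables (j : sfun W0) (k : sfun W1).
Hypotheses (uj : hsq_on ac Wc * j = 1) (uk : hsq_on ad Wd * k = 1).

Let res_j : hsq_on ac W2c * sfun_res W20 j = 1.
Proof.
rewrite -(res_hsq_on W20 ac Wc W2c); apply: (etrans (esym (rmorphM (sfun_res W20) _ _))).
by rewrite uj; exact: (rmorph1 (sfun_res W20)).
Qed.

(** Both are inverses of the same function on the overlap, and inverses are unique. *)
Let res_jk : sfun_res W21 k = sfun_res W20 j.
Proof.
have h : hsq_on ac W2c * sfun_res W21 k = 1.
  rewrite -hsq_W2 -(res_hsq_on W21 ad Wd W2d).
  apply: (etrans (esym (rmorphM (sfun_res W21) _ _))).
  by rewrite uk; exact: (rmorph1 (sfun_res W21)).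
exact: mulr_inv_uniq h res_j.
Qed.

Lemma vv_on_indep p : oset W0 p -> oset W1 p -> vv_on ac Wc j p = vv_on ad Wd k p.
Proof.
have [mu [nu DE]] := frame_der_change Phi_immersion ac ad W2c W2d.
apply: eq_on_overlap; apply: (etrans (res_vv_on W20 ac Wc W2c j)).
apply: (etrans _ (esym (res_vv_on W21 ad Wd W2d k))); rewrite res_jk.
exact: esym (@null_frame_vv _ _ (cj W2) _ cjK two f_real ff _ _ _ _ _ _ _ (nf ac W2c) (nf ad W2d) DE res_j).
Qed.

Lemma gg_on_indep p : oset W0 p -> oset W1 p -> gg_on ac Wc j p = gg_on ad Wd k p.
Proof.
have [mu [nu DE]] := frame_der_change Phi_immersion ac ad W2c W2d.
apply: eq_on_overlap; apply: (etrans (res_gg_on W20 ac Wc W2c j)).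
apply: (etrans _ (esym (res_gg_on W21 ad Wd W2d k))); rewrite res_jk.
exact: esym (@null_frame_gg _ _ (cj W2) _ cjK two f_real ff _ _ _ _ _ _ _ (nf ac W2c) (nf ad W2d) DE res_j).
Qed.

Lemma wronsk_on_indep p : oset W0 p -> oset W1 p -> wronsk_on ac Wc j p = wronsk_on ad Wd k p.
Proof.
have [mu [nu DE]] := frame_der_change Phi_immersion ac ad W2c W2d.
apply: eq_on_overlap; apply: (etrans (res_wronsk_on W20 ac Wc W2c j)).
apply: (etrans _ (esym (res_wronsk_on W21 ad Wd W2d k))); rewrite res_jk.
exact: esym (@null_frame_wronsk _ _ (cj W2) _ cjK two f_real ff _ _ _ _ _ _ _ (nf ac W2c) (nf ad W2d) DE res_j).
Qed.
End two_charts.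

(** The set from which [xget] selects is inhabited, by the Gram-Schmidt frame completed with a
    normal frame. All its elements are equal, by [sff_sum] within a chart and [hsq_on_indep] across
    charts. *)
Lemma sff_sqnormE (W0 : opens M) c (ac : atlas c) (Wc : oset W0 `<=` dom c) p : oset W0 p ->
  sff_sqnorm Phi p = 2 * complex.Re (hsq_on ac Wc p).
Proof.
move=> Wp; apply: xget_unique => [|s].
  have [nu [nn nB]] := normal_frame_exists Phi_spherical Phi_immersion ac Wc Wp.
  have ad := tangent_coords_adapted Phi_spherical Phi_immersion Phi_isometric ac Wc Wp nn nB.
  exists c, (tangent_coords Phi c p), nu; split => //; first exact: Wc.
  exact: esym (sff_sum Phi_spherical Phi_immersion Phi_isometric Phi_minimal ac Wc Wp ad).
move=> [d [e [nu [ad dp fr ->]]]].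
pose W1 : opens M := Opens (@dom_open _ _ _ d).
apply: (etrans (@sff_sum _ _ _ _ Phi_spherical Phi_immersion Phi_isometric Phi_minimal W1 _ ad
  (fun _ h => h) _ _ _ dp fr)).
congr (2 * complex.Re _); exact: hsq_on_indep.
Qed.

End chart_independence.

(** * The global functions on the surface *)

Section global_invariants.
Context {R : realType} {M : riemannianManifold R 2} {N : nat}.
Variable Phi : M -> 'rV[R]_N.+1.
Hypothesis Phi_spherical : spherical Phi.
Hypothesis Phi_immersion : immersion Phi.
Hypothesis Phi_isometric : isometric Phi.
Hypothesis Phi_minimal : minimal Phi.
Hypothesis S_gt0 : forall p, 0 < sff_sqnorm Phi p.
#[local] Opaque position fr0 fr1 frame_der connection.

Definition chart_opens (c : chart R 2 M) := Opens (@dom_open _ _ _ c).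

Section in_chart.
Variables (c : chart R 2 M) (ac : atlas c).
Local Notation W := (chart_opens c).
Local Notation cj := (@sfun_conj R M W).
Definition chart_sub : oset W `<=` dom c := fun p dp => dp.

Definition chart_der := frame_der Phi_immersion ac chart_sub.
Definition chart_conn := connection Phi_immersion ac chart_sub.
Definition chart_u : sfun W := hsq_on Phi_immersion ac chart_sub.

Lemma chart_u_re_gt0 p : dom c p -> 0 < complex.Re (chart_u p).
Proof.
move=> dp; have := S_gt0 p.
rewrite (sff_sqnormE Phi_spherical Phi_immersion Phi_isometric Phi_minimal ac chart_sub dp).
by rewrite pmulr_rgt0.
Qed.

Fact smooth_chart_j : smooth_map_on (oset W) (fun p => (complex.Re (chart_u p))^-1).
Proof.
apply: smooth_map_onV (sfun_re chart_u); first exact: osetP.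
by move=> p dp; rewrite gt_eqF // chart_u_re_gt0.
Qed.
Definition chart_j : sfun W := sreal smooth_chart_j.

Lemma chart_uj : chart_u * chart_j = 1.
Proof.
apply: sfunP => p dp; rewrite (sval1 dp); apply: (etrans (svalM _ _ dp)).
have cu : cj chart_u = chart_u by exact: (cj_hsq _ _ _ (@sfun_conjK R M W)).
rewrite [chart_j p](srealE _ dp) [in LHS](sreal_re cu) (srealE _ dp).
have u0 := chart_u_re_gt0 dp.
by rewrite -(rmorphM (real_complex R)) mulfV ?gt_eqF // rmorph1.
Qed.

Definition chart_v := vv_on Phi_immersion ac chart_sub chart_j.
Definition chart_g := gg_on Phi_immersion ac chart_sub chart_j.
Definition chart_w := wronsk_on Phi_immersion ac chart_sub chart_j.
Definition chart_G := chart_der chart_v * cjder chart_der cj chart_v.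
Definition chart_Y := dlogu chart_der cj chart_conn (position Phi_immersion W) chart_j
  * cj (dlogu chart_der cj chart_conn (position Phi_immersion W) chart_j).
End in_chart.

Section chart_change.
Variables (c d : chart R 2 M) (ac : atlas c) (ad : atlas d).

Lemma chart_u_indep p : dom c p -> dom d p -> chart_u ac p = chart_u ad p.
Proof.
exact: (hsq_on_indep Phi_spherical Phi_immersion Phi_isometric Phi_minimal ac ad
  (@chart_sub c) (@chart_sub d)).
Qed.
Lemma chart_v_indep p : dom c p -> dom d p -> chart_v ac p = chart_v ad p.
Proof.
exact: (vv_on_indep Phi_spherical Phi_isometric Phi_minimal (chart_uj ac) (chart_uj ad)).
Qed.
Lemma chart_g_indep p : dom c p -> dom d p -> chart_g ac p = chart_g ad p.
Proof.
exact: (gg_on_indep Phi_spherical Phi_isometric Phi_minimal (chart_uj ac) (chart_uj ad)).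
Qed.
Lemma chart_w_indep p : dom c p -> dom d p -> chart_w ac p = chart_w ad p.
Proof.
exact: (wronsk_on_indep Phi_spherical Phi_isometric Phi_minimal (chart_uj ac) (chart_uj ad)).
Qed.
End chart_change.

Definition chart_at (p : M) : chart R 2 M := s2val (cid2 (atlas_cover p)).
Definition atlas_at p : atlas (chart_at p) := s2valP (cid2 (atlas_cover p)).
Definition dom_at p : dom (chart_at p) p := s2valP' (cid2 (atlas_cover p)).

Definition inv_u p := complex.Re (chart_u (atlas_at p) p).
Definition inv_v p := complex.Re (chart_v (atlas_at p) p).
Definition inv_g p := complex.Re (chart_g (atlas_at p) p).
Definition inv_w p := complex.Re (chart_w (atlas_at p) p).
(** [inv_G] and [inv_Y] enter only relations at a single point, all read in the chart selected
    there. *)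
Definition inv_G p := complex.Re (chart_G (atlas_at p) p).
Definition inv_Y p := complex.Re (chart_Y (atlas_at p) p).

Lemma local_continuous (F : M -> R) (a : forall c, atlas c -> sfun (chart_opens c)) :
  (forall c (ac : atlas c) p, dom c p -> F p = complex.Re (a c ac p)) -> continuous F.
Proof.
move=> Fa p; have ac := atlas_at p; have dp := dom_at p.
set c := chart_at p in ac dp.
have cont := smooth_map_on_continuous (osetP (chart_opens c)) (sfun_re (a c ac)) dp.
rewrite /continuous_at (Fa c ac p dp); apply: cvg_trans cont; apply: near_eq_cvg.
have n := open_nbhs_nbhs (conj (@dom_open _ _ _ c) dp).
by apply: filterS n => q dq; rewrite (Fa c ac q dq).
Qed.

Section at_chart.
Variables (c : chart R 2 M) (ac : atlas c) (q : M) (dq : dom c q).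
Lemma inv_uE : inv_u q = complex.Re (chart_u ac q).
Proof. exact: (congr1 (@complex.Re R) (chart_u_indep (atlas_at q) ac (dom_at q) dq)). Qed.
Lemma inv_vE : inv_v q = complex.Re (chart_v ac q).
Proof. exact: (congr1 (@complex.Re R) (chart_v_indep (atlas_at q) ac (dom_at q) dq)). Qed.
Lemma inv_gE : inv_g q = complex.Re (chart_g ac q).
Proof. exact: (congr1 (@complex.Re R) (chart_g_indep (atlas_at q) ac (dom_at q) dq)). Qed.
Lemma inv_wE : inv_w q = complex.Re (chart_w ac q).
Proof. exact: (congr1 (@complex.Re R) (chart_w_indep (atlas_at q) ac (dom_at q) dq)). Qed.
End at_chart.

End global_invariants.

Section real_values.
Context {R : realType} {M : riemannianManifold R 2} {W0 : opens M}.
Local Notation cj := (@sfun_conj R M W0).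
Local Notation Re := (@complex.Re R).
Implicit Types a b : sfun W0.

Lemma real_valE a p : oset W0 p -> cj a = a -> a p = (Re (a p))%:C%C.
Proof. by move=> Wp ca; rewrite [in LHS](sreal_re ca) (srealE _ Wp). Qed.

Lemma real_valM a b p : oset W0 p -> cj a = a -> cj b = b -> Re ((a * b) p) = Re (a p) * Re (b p).
Proof.
move=> Wp ca cb; rewrite (svalM _ _ Wp) (real_valE Wp ca) (real_valE Wp cb).
by rewrite -(rmorphM (real_complex R)).
Qed.

Lemma real_valX a n p : oset W0 p -> cj a = a -> Re ((a ^+ n) p) = Re (a p) ^+ n.
Proof.
by move=> Wp ca; rewrite (svalX _ _ Wp) (real_valE Wp ca) -(rmorphXn (real_complex R)).
Qed.

Lemma real_valD a b p : oset W0 p -> Re ((a + b) p) = Re (a p) + Re (b p).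
Proof. by move=> Wp; rewrite (svalD _ _ Wp); case: (a p) (b p) => ? ? []. Qed.

Lemma real_valN a p : oset W0 p -> Re ((- a) p) = - Re (a p).
Proof. by move=> Wp; rewrite (svalN _ Wp); case: (a p). Qed.

Lemma real_val_natM n a p : oset W0 p -> Re ((n%:R * a) p) = n%:R * Re (a p).
Proof.
move=> Wp; rewrite (svalM _ _ Wp) (sval_nat _ Wp) mulr_natl.
by rewrite (raddfMn (Re : {additive _ -> _})) mulr_natl.
Qed.
End real_values.

(** * The contradiction *)

Section global_extrema.
Context {R : realType} {M : riemannianManifold R 2} {N : nat}.
Variable Phi : M -> 'rV[R]_N.+1.
Hypothesis Phi_spherical : spherical Phi.
Hypothesis Phi_immersion : immersion Phi.
Hypothesis Phi_isometric : isometric Phi.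
Hypothesis Phi_minimal : minimal Phi.
Hypothesis S_gt0 : forall p, 0 < sff_sqnorm Phi p.

Local Notation iu := (inv_u Phi_immersion).
Local Notation iv := (inv_v Phi_spherical Phi_immersion Phi_isometric Phi_minimal S_gt0).
Local Notation ig := (inv_g Phi_spherical Phi_immersion Phi_isometric Phi_minimal S_gt0).
Local Notation iw := (inv_w Phi_spherical Phi_immersion Phi_isometric Phi_minimal S_gt0).
Local Notation iG := (inv_G Phi_spherical Phi_immersion Phi_isometric Phi_minimal S_gt0).
Local Notation iY := (inv_Y Phi_spherical Phi_immersion Phi_isometric Phi_minimal S_gt0).

Section at_point.
Variable p : M.
Let c := chart_at p.
Let ac : atlas c := atlas_at p.
Let dp : oset (chart_opens c) p := dom_at p.
Local Notation W := (chart_opens c).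
Local Notation cj := (@sfun_conj R M W).
Local Notation D := (chart_der Phi_immersion ac).
Local Notation conn := (chart_conn Phi_immersion ac).
Local Notation u := (chart_u Phi_immersion ac).
Local Notation v := (chart_v Phi_spherical Phi_immersion Phi_isometric Phi_minimal S_gt0 ac).
Local Notation g := (chart_g Phi_spherical Phi_immersion Phi_isometric Phi_minimal S_gt0 ac).
Local Notation w := (chart_w Phi_spherical Phi_immersion Phi_isometric Phi_minimal S_gt0 ac).
Local Notation Re := (@complex.Re R).

Let ev : {rmorphism sfun W -> R[i]} := sfun_ev dp.
Let is_max (a : sfun W) := forall q, dom c q -> Re (a q) <= Re (a p).
Let nf : null_frame D cj conn (position Phi_immersion W) :=
  immersion_null_frame Phi_spherical Phi_immersion Phi_isometric Phi_minimal ac (@chart_sub _ _ c).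
Let uj := chart_uj Phi_spherical Phi_immersion Phi_isometric Phi_minimal S_gt0 ac.
Let ev_cj := sfun_ev_conj dp.
Let u_gt0 : 0 < Re (ev u) :=
  chart_u_re_gt0 Phi_spherical Phi_immersion Phi_isometric Phi_minimal S_gt0 ac dp.

Let max_critical a : cj a = a -> is_max a -> ev (D a) = 0 /\ Re (ev (lap D cj conn a)) <= 0.
Proof.
move=> ca am; apply: (frame_local_max Phi_immersion ac (@chart_sub _ _ c) conn dp ca).
by apply: filterS (open_nbhs_nbhs (conj (osetP W) dp)) => q dq; exact: am.
Qed.

Let f_real := position_conj Phi_immersion W.
Let ff := position_dot Phi_spherical Phi_immersion W.

Let cjK := @sfun_conjK R M W.
Let two := @sfun_two_reg R M W.

Let cju : cj u = u := cj_hsq _ _ _ cjK.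
Let cjv : cj v = v := cj_v _ _ _ cjK _.
Let cju_exp n : cj (u ^+ n) = u ^+ n.
Proof. by apply: (etrans (rmorphXn (@sfun_conj R M W) _ _)); congr (_ ^+ n); exact: cju. Qed.

Let uE q (dq : dom c q) : Re (u q) = iu q.
Proof. exact: esym (inv_uE Phi_spherical Phi_immersion Phi_isometric Phi_minimal ac dq). Qed.
Let vE q (dq : dom c q) : Re (v q) = iv q.
Proof. exact: esym (inv_vE Phi_spherical Phi_immersion Phi_isometric Phi_minimal S_gt0 ac dq). Qed.
Let gE q (dq : dom c q) : Re (g q) = ig q.
Proof. exact: esym (inv_gE Phi_spherical Phi_immersion Phi_isometric Phi_minimal S_gt0 ac dq). Qed.
Let wE q (dq : dom c q) : Re (w q) = iw q.
Proof. exact: esym (inv_wE Phi_spherical Phi_immersion Phi_isometric Phi_minimal S_gt0 ac dq). Qed.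

Let is_max_of (F : M -> R) (a : sfun W) : (forall q, dom c q -> Re (a q) = F q) ->
  (forall q, F q <= F p) -> is_max a.
Proof. by move=> aF Fp q dq; rewrite (aF _ dq) (aF _ dp). Qed.

Let vuE n q : dom c q -> Re ((v * u ^+ n) q) = iv q * iu q ^+ n.
Proof.
move=> dq; apply: (etrans (@real_valM R M W v (u ^+ n) q dq cjv (cju_exp n))).
exact: (f_equal2 *%R (vE dq) (etrans (@real_valX R M W u n q dq cju) (congr1 (fun x => x ^+ n) (uE dq)))).
Qed.

Lemma inv_pointwise :
  [/\ 0 <= iv p, 0 <= ig p, iG p <= ig p * iv p & iw p = iu p ^+ 3 * (ig p * iv p - iG p)].
Proof. exact: (pointwise_inequalities nf cjK two f_real ff uj ev_cj u_gt0). Qed.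

Lemma inv_max_w : (forall q, iw q <= iw p) -> iu p < 9 / 10 -> iw p = 0.
Proof.
move=> h; exact: (max_wronsk nf cjK two f_real ff uj ev_cj u_gt0 max_critical (is_max_of wE h)).
Qed.

Lemma inv_max_v_u4 : (forall q, iv q * iu q ^+ 4 <= iv p * iu p ^+ 4) ->
  iG p = 4 ^+ 2 * iv p ^+ 2 * iY p /\
  iu p ^+ 4 * ((1 - 2 * iv p) * iv p + ig p + 4 * iv p * (iv p - 3 * iu p + 2)
    - 4 ^+ 2 * iv p * iY p) <= 0.
Proof.
move=> h.
exact: (max_v_u4 nf cjK two f_real ff uj ev_cj u_gt0 max_critical (is_max_of (vuE 4) h)).
Qed.

Lemma inv_min_v_u2 : (forall q, iv p * iu p ^+ 2 <= iv q * iu q ^+ 2) ->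
  iG p = 2 ^+ 2 * iv p ^+ 2 * iY p /\
  0 <= iu p ^+ 2 * ((1 - 2 * iv p) * iv p + ig p + 2 * iv p * (iv p - 3 * iu p + 2)
    - 2 ^+ 2 * iv p * iY p).
Proof.
move=> h; have aF q : dom c q -> Re ((- (v * u ^+ 2)) q) = - (iv q * iu q ^+ 2).
  by move=> dq; apply: (etrans (@real_valN R M W _ q dq)); congr (- _); exact: vuE.
have h' q : - (iv q * iu q ^+ 2) <= - (iv p * iu p ^+ 2) by rewrite lerN2.
exact: (min_v_u2 nf cjK two f_real ff uj ev_cj u_gt0 max_critical (is_max_of aF h')).
Qed.

Lemma inv_max_g_sqr_v :
  (forall q, 2 * ig q + 5 * iv q ^+ 2 <= 2 * ig p + 5 * iv p ^+ 2) ->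
  2 * (4 - iu p) * ig p + 2 * iv p * (1 - 2 * iv p) ^+ 2
    + 10 * iv p ^+ 2 * (1 - 2 * iv p) <= 0.
Proof.
move=> h; have aF q : dom c q -> Re ((2 * g + 5 * v ^+ 2) q) = 2 * ig q + 5 * iv q ^+ 2.
  move=> dq; apply: (etrans (@real_valD R M W _ _ q dq)); apply: f_equal2.
    exact: (etrans (@real_val_natM R M W 2 _ q dq) (congr1 ( *%R _) (gE dq))).
  apply: (etrans (@real_val_natM R M W 5 _ q dq) (congr1 ( *%R _) _)).
  exact: (etrans (@real_valX R M W v 2 q dq cjv) (congr1 (fun x => x ^+ 2) (vE dq))).
exact: (max_g_sqr_v nf cjK two f_real ff uj ev_cj u_gt0 max_critical (is_max_of aF h)).
Qed.

Lemma inv_min_v_u : (forall q, iv p + 40 * iu p <= iv q + 40 * iu q) ->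
  iG p = 40 ^+ 2 * iu p ^+ 2 * iY p /\
  0 <= (1 - 2 * iv p) * iv p + ig p + 40 * (iu p * (iY p + iv p - 3 * iu p + 2)).
Proof.
move=> h; have aF q : dom c q -> Re ((- (v + 40 * u)) q) = - (iv q + 40 * iu q).
  move=> dq; apply: (etrans (@real_valN R M W _ q dq)); congr (- _).
  apply: (etrans (@real_valD R M W _ _ q dq)); apply: f_equal2; first exact: vE.
  exact: (etrans (@real_val_natM R M W 40 _ q dq) (congr1 ( *%R _) (uE dq))).
have h' q : - (iv q + 40 * iu q) <= - (iv p + 40 * iu p) by rewrite lerN2.
exact: (min_v_u nf cjK two f_real ff uj ev_cj max_critical (is_max_of aF h')).
Qed.
End at_point.

Lemma sff_sqnorm_inv_u p : sff_sqnorm Phi p = 2 * iu p.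
Proof.
exact: (sff_sqnormE Phi_spherical Phi_immersion Phi_isometric Phi_minimal (atlas_at p)
  (@chart_sub _ _ (chart_at p)) (dom_at p)).
Qed.

Lemma continuous_inv_u : continuous iu.
Proof.
apply: (@local_continuous _ _ _ (fun c ac => chart_u Phi_immersion ac)) => c ac p dp.
exact: (inv_uE Phi_spherical Phi_immersion Phi_isometric Phi_minimal ac dp).
Qed.

Theorem no_pinched_surface (a e : R) (p0 : M) : compact [set: M] ->
  5 / 6 < a -> a + e < 9 / 10 -> e <= 1 / 400 ->
  ~ (forall p, 2 * a <= sff_sqnorm Phi p <= 2 * (a + e)).
Proof.
move=> cM a5 a9 e1 Sb.
have ub p : a <= iu p <= a + e.
  by have := Sb p; rewrite sff_sqnorm_inv_u !ler_pM2l.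
have u9 p : iu p < 9 / 10 by have /andP[_ h] := ub p; exact: le_lt_trans h a9.
have H p := inv_pointwise p.
apply: (@no_critical_functions _ _ p0 iu iv ig iw iG iY a e cM continuous_inv_u) => //.
- apply: (@local_continuous _ _ _ (fun c ac => chart_v Phi_spherical Phi_immersion Phi_isometric Phi_minimal S_gt0 ac)) => c ac p dp.
  exact: (inv_vE Phi_spherical Phi_immersion Phi_isometric Phi_minimal S_gt0 ac dp).
- apply: (@local_continuous _ _ _ (fun c ac => chart_g Phi_spherical Phi_immersion Phi_isometric Phi_minimal S_gt0 ac)) => c ac p dp.
  exact: (inv_gE Phi_spherical Phi_immersion Phi_isometric Phi_minimal S_gt0 ac dp).
- apply: (@local_continuous _ _ _ (fun c ac => chart_w Phi_spherical Phi_immersion Phi_isometric Phi_minimal S_gt0 ac)) => c ac p dp.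
  exact: (inv_wE Phi_spherical Phi_immersion Phi_isometric Phi_minimal S_gt0 ac dp).
- by move=> p; have [] := H p.
- by move=> p; have [] := H p.
- by move=> p; have [] := H p.
- by move=> p; have [] := H p.
- by move=> p h; exact: inv_max_w h (u9 p).
- exact: inv_max_v_u4.
- exact: inv_max_g_sqr_v.
- exact: inv_min_v_u.
- exact: inv_min_v_u2.
Qed.

End global_extrema.

(** * From the pinching hypothesis to the bounds on [u] *)

Lemma sff_sqnorm_ge0 {R : realType} {n N : nat} (M : riemannianManifold R n)
    (Phi : M -> 'rV[R]_N.+1) p : 0 <= sff_sqnorm Phi p.
Proof.
rewrite /sff_sqnorm; case: xgetP => // s _ [c [e [nu [_ _ _ ->]]]].
by do 3 (apply: sumr_ge0 => ? _); exact: sqr_ge0.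
Qed.

(** Each upper bound on the square root of [calF s] gives an upper bound on [m]; such bounds are
    checked by comparing squares. *)
Lemma pinching_bounds {R : realType} (s m : R) : 5 / 3 <= s <= 9 / 5 -> s <= m ->
  m < s + (134 - 114 * s + Num.sqrt (calF s)) / 108 ->
  [/\ 5 / 3 < s, m < 9 / 5 & m - s <= 1 / 200].
Proof.
move=> /andP[s5 s9] sm hm.
have q0 : 0 <= (3 * s - 5) * (9 - 5 * s) by rewrite mulr_ge0 //; lra.
have FE : calF s = (134 - 114 * s) ^+ 2 + 864 * ((3 * s - 5) * (9 - 5 * s)).
  by rewrite /calF; lra.
have t0 : 0 <= (134 - 114 * s) ^+ 2 by exact: sqr_ge0.
have F0 : 0 <= calF s by rewrite FE; lra.
have r2 : Num.sqrt (calF s) ^+ 2 = calF s by rewrite sqr_sqrtr.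
have r0 : 0 <= Num.sqrt (calF s) by exact: sqrtr_ge0.
have bound c : 0 <= c -> calF s <= c ^+ 2 -> Num.sqrt (calF s) <= c.
  by move=> c0 Fc; rewrite -(@ler_pXn2r _ 2) ?nnegrE // r2.
move: r0 bound hm; rewrite FE; clear FE F0 r2; move: (Num.sqrt _) => r r0 bound hm.
(* The value of the root at which the upper bound on [m] becomes exactly [9/5]. *)
have b1 : r <= 302 / 5 + 6 * s.
  apply: bound; first by lra.
  have : (302 / 5 + 6 * s) ^+ 2 = (134 - 114 * s) ^+ 2
    + 864 * (3 * s - 5) * (9 - 5 * s) + 216 / 10 * (1264 / 10) * (9 - 5 * s) by field.
  by move=> ->; lra.
(* As [54/100] is [108/200], this is the value at which the bound on [m - s] becomes [1/200]. *)
have b2 : r <= 54 / 100 - (134 - 114 * s).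
  apply: bound; first by lra.
  (* [26/15] is the midpoint of [5/3] and [9/5], where [(3 s - 5) (9 - 5 s)] is largest. *)
  have : 0 <= (s - 26 / 15) ^+ 2 by exact: sqr_ge0.
  by lra.
split; [|lra|lra].
(* At [s = 5/3] the root is [|134 - 114 s| = 56] with [134 - 114 s = -56], and the hypothesis
   becomes [m < s]. *)
rewrite lt_neqAle s5 andbT; apply/eqP => es.
have : r <= - (134 - 114 * s) by apply: bound; [lra|rewrite -es; lra].
by lra.
Qed.

Theorem corollaryB (R : realType) (M : riemannianManifold R 2)
    (M_closed : compact [set: M]) (N : nat) :
  ~ exists Phi : M -> 'rV[R]_N.+1,
      spherical Phi /\ immersion Phi /\ isometric Phi /\ minimal Phi /\
      5 / 3 <= Smin Phi <= 9 / 5 /\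
      Smax Phi < Smin Phi
        + (134 - 114 * Smin Phi + Num.sqrt (calF (Smin Phi))) / 108.
Proof.
move=> [Phi [sph [imm [iso [mini [range_s hm]]]]]].
have lbS : has_lbound (range (sff_sqnorm Phi)).
  by exists 0 => _ [p _ <-]; exact: sff_sqnorm_ge0.
have minS p : Smin Phi <= sff_sqnorm Phi p by apply: ge_inf => //; exists p.
have S_gt0 p : 0 < sff_sqnorm Phi p.
  by apply: lt_le_trans (minS p); move: range_s => /andP[h _]; lra.
(* An empty [M] is excluded by the lower bound on [Smin], since the infimum of the empty set is 0 by
   convention. *)
have [p0 _] : exists p : M, True.
  apply: contrapT => empty; move: range_s => /andP[+ _].
  suff -> : Smin Phi = 0 by lra.
  rewrite /Smin (_ : range _ = set0) ?inf0 //.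
  by apply/seteqP; split=> // s [p]; case: empty; exists p.
have cu : continuous (inv_u imm) by exact: continuous_inv_u.
have [q uq] := compact_max p0 M_closed cu.
(* [Smax] bounds [S] only once the range is known to be bounded; this comes from compactness and the
   continuity of [u]. *)
have ubS : has_ubound (range (sff_sqnorm Phi)).
  exists (sff_sqnorm Phi q) => _ [p _ <-].
  by rewrite !(sff_sqnorm_inv_u sph imm iso mini) ler_pM2l.
have maxS p : sff_sqnorm Phi p <= Smax Phi by apply: ub_le_sup => //; exists p.
have [s5 m9 ms] := pinching_bounds range_s (le_trans (minS p0) (maxS p0)) hm.
(* Since [u = S / 2], [a] and [a + e] are the halves of [Smin] and [Smax]. *)
apply: (@no_pinched_surface _ _ _ Phi sph imm iso mini S_gt0 (Smin Phi / 2)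
  ((Smax Phi - Smin Phi) / 2) p0 M_closed); [lra|lra|lra|] => p.
have eq1 : 2 * (Smin Phi / 2) = Smin Phi by field.
have eq2 : 2 * (Smin Phi / 2 + (Smax Phi - Smin Phi) / 2) = Smax Phi by field.
by rewrite eq1 eq2 minS maxS.
Qed.
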